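(* Let $n,m,r\ge 1$ and let $g:\mathbb{R}^n_y\times\mathbb{R}^m_t\to\mathbb{C}^{r\times r}$ be a metric (on $\mathbb{R}^{n+m}$, with variables $(y,t)$). Assume that $g$ is log concave in the sense of Nakano, and define $\tilde g:\mathbb{R}^m\to\mathbb{C}^{r\times r}$ by $$\tilde g(t):=\int_{\mathbb{R}^n}g(y,t)\,dV(y),$$ where the integral is taken elementwise and all these integrals are assumed to converge. Then $\tilde g$ is log concave in the sense of Nakano as well.
   Context: A matrix-valued function $g:\mathbb{R}^N\to\mathbb{C}^{r\times r}$ is called a metric if (i) each matrix element of $g$ is twice differentiable, and (ii) $g(x)$ is a hermitian, strictly positive definite matrix for every $x\in\mathbb{R}^N$. For a metric $g$ put $$\Theta^g_{jk}:=\frac{\partial}{\partial x_k}\Big(g^{-1}\frac{\partial g}{\partial x_j}\Big),\qquad j,k=1,\dots,N,$$ where differentiation is elementwise, juxtaposition is matrix multiplication and $g^{-1}$ is the matrix inverse. For $u,v\in\mathbb{C}^r$ set $(u,v)_g:=v^*gu$, where $v^*$ is the conjugate transpose of $v$. The metric $g$ is log concave in the sense of Nakano if for every $N$-tuple of vectors $\{u_j\}_{j=1}^N\subset\mathbb{C}^r$ $$\sum_{j,k=1}^N\big(\Theta^g_{jk}u_j,u_k\big)_g\le 0$$ at every point of $\mathbb{R}^N$. $dV$ denotes Lebesgue measure.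
   Formalization: The formal theorem additionally assumes that each matrix element of g̃ is twice differentiable; this is part of being a metric and does not follow from the other hypotheses, even for n = m = r = 1 and g smooth. *)

(* Defs.v *)
From HB Require Import structures.
From mathcomp Require Import all_boot all_order all_algebra.
From mathcomp Require Import sesquilinear spectral.
From mathcomp Require Import complex.
From mathcomp Require Import all_classical all_reals all_analysis.

Set Implicit Arguments.
Unset Strict Implicit.
Unset Printing Implicit Defensive.

Import Order.TTheory GRing.Theory Num.Theory.
Import numFieldNormedType.Exports.

Local Open Scope classical_set_scope.
Local Open Scope ring_scope.
Local Open Scope complex_scope.
Local Open Scope sesquilinear_scope.

(* MathComp-Analysis has Lebesgue measure on R only. On R^n, realised as n-tuples
   with the product sigma-algebra, it is built as the n-fold product:
   lebesgue_tuple n.+1 is the image of lebesgue_measure \x lebesgue_tuple n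
   under (x, s) |-> x :: s. *)
Section LebesgueTuple.
Variable R : realType.

Local Notation Rt n := (n.-tuple (measurableTypeR R)).

Section LebesgueCons.
Local Open Scope ereal_scope.
Variables (n : nat) (mu : {sigma_finite_measure set (Rt n) -> \bar R}).

Definition tuple_cons (p : measurableTypeR R * Rt n) : Rt n.+1 :=
  [tuple of p.1 :: p.2].

Lemma measurable_tuple_cons : measurable_fun setT tuple_cons.
Proof. exact: measurable_cons. Qed.

Definition lebesgue_cons : set (Rt n.+1) -> \bar R :=
  pushforward (@lebesgue_measure R \x mu) tuple_cons.

Let lebesgue_cons0 : lebesgue_cons set0 = 0.
Proof. by rewrite /lebesgue_cons /pushforward preimage_set0 measure0. Qed.

Let lebesgue_cons_ge0 A : 0 <= lebesgue_cons A.
Proof. by rewrite /lebesgue_cons /pushforward; exact: measure_ge0. Qed.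

Let lebesgue_cons_sigma_additive : semi_sigma_additive lebesgue_cons.
Proof.
move=> F mF tF mUF; rewrite /lebesgue_cons /pushforward preimage_bigcup.
have mp A : measurable A -> measurable (tuple_cons @^-1` A).
  by move=> mA; rewrite -[X in measurable X]setTI; exact: measurable_tuple_cons.
apply: measure_semi_sigma_additive.
- by move=> k; apply: mp; exact: mF.
- apply/trivIsetP => /= i j _ _ ij; rewrite -preimage_setI.
  by move/trivIsetP : tF => /(_ _ _ _ _ ij) ->//; rewrite preimage_set0.
- by rewrite -preimage_bigcup; exact: mp.
Qed.

HB.instance Definition _ := isMeasure.Build _ _ _ lebesgue_cons
  lebesgue_cons0 lebesgue_cons_ge0 lebesgue_cons_sigma_additive.

Let lebesgue_cons_sigma_finite : sigma_finite setT lebesgue_cons.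
Proof.
have /sigma_finiteP[F [TF ndF Foo]] := sigma_finiteT (@lebesgue_measure R).
have /sigma_finiteP[G [TG ndG Goo]] := sigma_finiteT mu.
pose un (s : Rt n.+1) : measurableTypeR R * Rt n := (thead s, [tuple of behead s]).
have unK : cancel un tuple_cons by move=> s; rewrite [RHS]tuple_eta.
have consK : cancel tuple_cons un.
  by move=> [x s]; congr pair; apply: val_inj.
have mun : measurable_fun setT un.
  apply/measurable_fun_pairP; split; [exact: measurable_tnth|exact: measurable_behead].
exists (fun k => un @^-1` (F k `*` G k)).
  rewrite -preimage_bigcup (_ : \bigcup_k _ = setT) ?preimage_setT//.
  apply/seteqP; split => // -[x s] _ /=.
  have [i _ Fix] : (\bigcup_k F k) x by rewrite -TF.
  have [j _ Gjs] : (\bigcup_k G k) s by rewrite -TG.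
  exists (maxn i j) => //; split => /=.
  - by move: x Fix; exact/subsetPset/ndF/leq_maxl.
  - by move: s Gjs; exact/subsetPset/ndG/leq_maxr.
move=> k; have [mFk Fkoo] := Foo k; have [mGk Gkoo] := Goo k.
have mFG : measurable (F k `*` G k) by exact: measurableX.
split; first by rewrite -[X in measurable X]setTI; exact: mun.
rewrite /lebesgue_cons /pushforward -comp_preimage.
rewrite (_ : un \o tuple_cons = id); last by apply/funext => p; exact: consK.
by rewrite preimage_id product_measure1E// lte_mul_pinfty// ge0_fin_numE.
Qed.

HB.instance Definition _ := Measure_isSigmaFinite.Build _ _ _ lebesgue_cons
  lebesgue_cons_sigma_finite.

End LebesgueCons.

Fixpoint lebesgue_tuple (n : nat) : {sigma_finite_measure set (Rt n) -> \bar R} :=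
  match n with
  | 0 => \d_([tuple] : Rt 0)
  | n'.+1 => lebesgue_cons (lebesgue_tuple n')
  end.

Lemma lebesgue_tuple_box (n : nat) (A : 'I_n -> set (measurableTypeR R)) :
  (forall i, measurable (A i)) ->
  lebesgue_tuple n [set s | forall i, A i (tnth s i)]
  = (\prod_(i < n) lebesgue_measure (A i))%E.
Proof.
elim: n A => [|n IH] A mA /=.
  rewrite big_ord0 diracE mem_set//; by case.
rewrite /lebesgue_cons /pushforward big_ord_recl -IH; last by move=> i; exact: mA.
rewrite -product_measure1E//; last first.
  rewrite (_ : [set _ | _] = \bigcap_(i in [set: 'I_n])
      ((fun s : Rt n => tnth s i) @^-1` A (lift ord0 i))).
    apply: fin_bigcap_measurable => // i _.
    by rewrite -[X in measurable X]setTI; exact: measurable_tnth.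
  by apply/seteqP; split => s /= h i => [_|]; exact: h.
congr (product_measure1 _ _ _); apply/seteqP; split => -[x s] /= h.
  split; first by have := h ord0.
  by move=> i; have := h (lift ord0 i); rewrite tnthS.
move=> i; case: (unliftP ord0 i) => [j|] ->; last exact: h.1.
by rewrite tnthS; exact: h.2.
Qed.

End LebesgueTuple.

Section Nakano.
Variable R : realType.
Local Notation C := R[i].

(* R[i] carries no normed R-module structure: a complex-valued function is
   differentiated, and integrated, through its real and imaginary parts. *)
Section Calculus.
Variable N : nat.

Definition partial (j : 'I_N) (f : 'rV[R]_N -> R) (x : 'rV[R]_N) : R :=
  'D_(delta_mx 0 j) f x.

(* Frechet differentiability of f and of its derivative; the latter amounts to
   Frechet differentiability of each partial derivative. *)
Definition twice_differentiable (f : 'rV[R]_N -> R) : Prop :=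
  (forall x, differentiable f x) /\
  (forall j x, differentiable (partial j f) x).

Definition ctwice_differentiable (f : 'rV[R]_N -> C) : Prop :=
  twice_differentiable (fun x => complex.Re (f x)) /\
  twice_differentiable (fun x => complex.Im (f x)).

Definition cpartial (j : 'I_N) (f : 'rV[R]_N -> C) (x : 'rV[R]_N) : C :=
  partial j (fun z => complex.Re (f z)) x +i* partial j (fun z => complex.Im (f z)) x.

Definition mxpartial (r : nat) (j : 'I_N) (g : 'rV[R]_N -> 'M[C]_r)
    (x : 'rV[R]_N) : 'M[C]_r :=
  \matrix_(a, b) cpartial j (fun z => g z a b) x.

End Calculus.

Section Metric.
Variables N r : nat.

(* The strict order of R[i] makes 0 < z mean that z is real and positive. *)
Definition posdefmx (A : 'M[C]_r) : Prop :=
  forall v : 'cV[C]_r, v != 0 -> 0 < (v ^t* *m A *m v) 0 0.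

Definition mxtwice_differentiable (g : 'rV[R]_N -> 'M[C]_r) : Prop :=
  forall a b, ctwice_differentiable (fun x => g x a b).

Definition is_metric (g : 'rV[R]_N -> 'M[C]_r) : Prop :=
  mxtwice_differentiable g /\
  (forall x, g x \is hermsymmx /\ posdefmx (g x)).

Definition Theta (g : 'rV[R]_N -> 'M[C]_r) (j k : 'I_N) : 'rV[R]_N -> 'M[C]_r :=
  mxpartial k (fun x => invmx (g x) *m mxpartial j g x).

Definition mxform (A : 'M[C]_r) (u v : 'cV[C]_r) : C := (v ^t* *m A *m u) 0 0.

(* The sum is real when g is a metric; z <= 0 in R[i] says that z is real and
   nonpositive. *)
Definition nakano_log_concave (g : 'rV[R]_N -> 'M[C]_r) : Prop :=
  is_metric g /\
  forall (x : 'rV[R]_N) (u : 'I_N -> 'cV[C]_r),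
    \sum_(j < N) \sum_(k < N) mxform (g x) (Theta g j k x *m u j) (u k) <= 0.

End Metric.

Section Marginal.
Variables n m r : nat.
Variable g : 'rV[R]_(n + m) -> 'M[C]_r.

Local Notation Rt := (n.-tuple (measurableTypeR R)).

Definition row_of_tuple (y : Rt) : 'rV[R]_n := \row_i tnth y i.

Definition slice (t : 'rV[R]_m) (a b : 'I_r) (y : Rt) : C :=
  g (row_mx (row_of_tuple y) t) a b.

Definition marginal_converges : Prop :=
  forall t a b,
    (lebesgue_tuple R n).-integrable setT
      (fun y => (complex.Re (slice t a b y))%:E) /\
    (lebesgue_tuple R n).-integrable setT
      (fun y => (complex.Im (slice t a b y))%:E).

Definition marginal (t : 'rV[R]_m) : 'M[C]_r :=
  \matrix_(a, b)
    (Rintegral (lebesgue_tuple R n) setT (fun y => complex.Re (slice t a b y)) +i*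
     Rintegral (lebesgue_tuple R n) setT (fun y => complex.Im (slice t a b y))).

End Marginal.
End Nakano.

(* Main.v *)
Require Import Defs.
From mathcomp Require Import all_boot all_order all_algebra.
From mathcomp Require Import sesquilinear.
From mathcomp Require Import complex.
From mathcomp Require Import all_classical all_reals all_analysis.
From mathcomp Require Import measurable_realfun.
From mathcomp Require Import ring lra.

Set Implicit Arguments.
Unset Strict Implicit.
Unset Printing Implicit Defensive.

Import Order.TTheory GRing.Theory Num.Theory.
Import numFieldNormedType.Exports.

Local Open Scope classical_set_scope.
Local Open Scope ring_scope.

(** Replacing a hermitian matrix [A] by the real symmetric matrix
    [[Re A, -Im A], [Im A, Re A]], one may take [g] real. With
    [P = sum_j (d_j g) u_j], Nakano log concavity is the pointwise inequality
    [sum_k d_k (u_k^T P) <= P^T g^-1 P]. Integrated over boxes it involves first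
    derivatives only, and a Goursat-type subdivision shows that the two forms are
    equivalent for twice differentiable metrics, although the second derivatives
    need be neither continuous nor integrable.

    The integrated form passes from [g] to [gt = int_0^L g dy]: let
    [Pt = int_0^L P dy], [F = gt^-1 Pt], and complete the [u_j] by the [y]-component
    [w = g^-1 int_0^y (g F - P)], which vanishes for [y = 0] and [y = L]. Then
    [P + (d_y g) w = g (F - w')], and integrating the inequality for [g] in [y] gives
    the right-hand side [int_0^L (|F|_g^2 - |w'|_g^2) <= F^T gt F = Pt^T gt^-1 Pt].

    Integrating one variable at a time gives the marginals over boxes, which converge
    to the marginal over the whole space. Their gradients converge as well, because
    [v^T g^-1 v] is convex along each coordinate direction; hence the integrated form
    survives the limit, and the pointwise form follows from it. *)

(** * Primitives of continuous functions *)

Section OneVariable.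
Variable R : realType.
Implicit Types (f g F : R -> R) (a b c t : R).
Local Notation mu := (@lebesgue_measure R).

(** Convergence is assumed for the entries of [g] only, so nothing can be differentiated under the
    integral over the whole space. Everything between the two ends of the proof is therefore stated
    with increments and integrals of continuous functions.

    The integrated inequality speaks of constant vectors [u_j], whereas the correction [w] varies
    with [y] and depends on the remaining variables. The latter is met by choosing [w] for one point
    [x] and comparing both sides only near [x], up to an error proportional to volume, which
    subdivision tolerates. The former is met by cutting the interval in [y] into thin slabs with [w]
    constant on each; a Cousin-type covering argument adds up the slabs.

    In the limit over boxes, the gradients are reached through the slopes of convex functions.
    Slopes are squeezed between increments: hence they converge where the limit is differentiable,
    so differentiability of the marginal enters here, and they are bounded by neighbouring values of
    the function, which gives domination. Polarisation passes from quadratic forms to matrix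
    entries. *)

Lemma mean_value f df a b : (forall t, is_derive t 1 f (df t)) ->
  a <= b -> exists2 c, a <= c <= b & f b - f a = df c * (b - a).
Proof.
move=> dF ab.
have [c cab E] : exists2 c, c \in `[a, b] & f b - f a = df c * (b - a).
  apply: MVT_segment => //.
  apply: continuous_subspaceT => x; apply: differentiable_continuous.
  by apply/derivable1_diffP; case: (dF x).
by exists c => //; move: cab; rewrite in_itv.
Qed.

Lemma le_of_derive_ge0 f df a b : (forall t, is_derive t 1 f (df t)) ->
  a <= b -> (forall t, a <= t <= b -> 0 <= df t) -> f a <= f b.
Proof.
move=> dF ab df0; have [c cab E] := mean_value dF ab.
by rewrite -subr_ge0 E mulr_ge0 ?subr_ge0//; exact: df0.
Qed.

Lemma eq_of_derive f g df a b : (forall t, is_derive t 1 f (df t)) ->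
  (forall t, is_derive t 1 g (df t)) -> f b - f a = g b - g a.
Proof.
wlog ab : a b / a <= b => [H|] fd gd.
  have [/H->//|/ltW/H E] := leP a b.
  by apply: oppr_inj; rewrite !opprB; exact: E.
have H t : is_derive t 1 (f - g) (df t - df t) by exact: is_deriveB.
have H' t : is_derive t 1 (g - f) (df t - df t) by exact: is_deriveB.
have z t : a <= t <= b -> 0 <= df t - df t by rewrite subrr.
have := le_of_derive_ge0 H ab z; have := le_of_derive_ge0 H' ab z.
by rewrite !fctE => h1 h2; lra.
Qed.

Let integrable_seg f a b : continuous f -> mu.-integrable `[a, b] (EFin \o f).
Proof.
move=> cf; apply: continuous_compact_integrable; first exact: segment_compact.
exact: continuous_subspaceT.
Qed.

(** Free of division and of the punctured neighbourhood, this form lets errors at several points be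
    added linearly. *)
Lemma is_derive_epsP f t d : is_derive t 1 f d <->
  forall e, 0 < e -> \forall h \near 0, `|f (t + h) - f t - d * h| <= e * `|h|.
Proof.
have E : is_derive t 1 f d <-> h^-1 *: (f (h *: 1 + t) - f t) @[h --> 0^'] --> d.
  split => [[df <-]|H]; first exact: df.
  have dd : derivable f t 1 by apply/cvg_ex; exists d.
  by apply: DeriveDef => //; exact: cvg_lim.
have K e h : h != 0 -> (`|d - h^-1 *: (f (h *: 1 + t) - f t)| <= e) =
    (`|f (t + h) - f t - d * h| <= e * `|h|).
  move=> h0; rewrite -ler_pdivrMr ?normr_gt0// -normfV -normrM.
  rewrite distrC mulrBl mulfK// [h *: 1]mulr1 (addrC h).
  by rewrite [_ *: _]mulrC.
rewrite E; split => [/cvgrPdist_le H e e0|H].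
  have := H e e0; rewrite near_withinE; apply: filterS => h hH.
  have [->|h0] := eqVneq h 0; first by rewrite addr0 subrr mulr0 subrr normr0 mulr0.
  by rewrite -K//; exact: hH.
apply/cvgrPdist_le => e e0; rewrite near_withinE.
by have := H e e0; apply: filterS => h hH h0; rewrite K.
Qed.

(** The estimates at [a] and at [b] are subtracted: since [c] lies between them, the distances to
    [c] add up to [b - a]. This turns a sign of the derivative at [c] into the local hypothesis of
    [cousin]. *)
Lemma is_derive_straddle f c d e : is_derive c 1 f d -> 0 < e ->
  exists2 del, 0 < del & forall a b, a <= c -> c <= b -> b - a < del ->
    `|f b - f a - d * (b - a)| <= e * (b - a).
Proof.
move=> /is_derive_epsP H e0; have /nbhs_ballP[del /= del0 D] := H _ e0.
exists del => // a b ac cb ab.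
have /D : ball 0 del (b - c) by rewrite /ball/= sub0r normrN ger0_norm ?subr_ge0//; lra.
have /D : ball 0 del (a - c) by rewrite /ball/= sub0r normrN ler0_norm ?subr_le0//; lra.
rewrite /= !(addrC c) !subrK (@ler0_norm _ (a - c)) ?subr_le0// (@ger0_norm _ (b - c)) ?subr_ge0//.
rewrite !ler_norml => /andP[h1 h2] /andP[h3 h4]; apply/andP; split; nra.
Qed.

(** The increment of the product is [f (c + h) * g (c + h)], in which [g (c + h)] may be replaced by
    [g c] at the cost of o(h); continuity of [g] suffices for this. Gradients of metrics occur below
    as such continuous factors. *)
Lemma is_derive_mul0 f g c d : is_derive c 1 f d -> f c = 0 ->
  {for c, continuous g} -> is_derive c 1 (fun t => f t * g t) (d * g c).
Proof.
move=> df f0 cg; apply/is_derive_epsP => e e0.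
(* Each of the error terms [A1] and [A2] below is at most [e' * (M + 1)] times |h|, which is half of
   [e] times |h|. *)
pose M := `|g c| + `|d| + 1.
have M0 : 0 < M by rewrite ltr_wpDl ?ltr01// addr_ge0.
pose e' := e / (2 * (M + 1)).
have e'0 : 0 < e' by rewrite divr_gt0// mulr_gt0// addr_gt0.
have /cvgrPdist_le/(_ _ (@ltr01 R)) g1 := cg.
have /cvgrPdist_le/(_ _ e'0) g2 := cg.
have sh : (fun h => c + h) @ 0 --> c.
  rewrite -[X in _ --> X]addr0; apply: cvgD; [exact: cvg_cst|exact: cvg_id].
move/is_derive_epsP/(_ e' e'0) : df => D.
near=> h.
have k1 : `|g c - g (c + h)| <= 1 by near: h; exact: (sh _ g1).
have k2 : `|g c - g (c + h)| <= e' by near: h; exact: (sh _ g2).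
have k3 : `|f (c + h) - f c - d * h| <= e' * `|h| by near: h; exact: D.
rewrite f0 subr0 in k3; rewrite f0 mul0r subr0.
have -> : f (c + h) * g (c + h) - d * g c * h =
  (f (c + h) - d * h) * g (c + h) - d * h * (g c - g (c + h)) by ring.
apply: (le_trans (ler_normB _ _)); rewrite !normrM.
have gM : `|g (c + h)| <= M + 1.
  have -> : g (c + h) = g c - (g c - g (c + h)) by ring.
  apply: (le_trans (ler_normB _ _)); rewrite /M.
  by have := normr_ge0 d; lra.
have E : e = 2 * (M + 1) * e' by rewrite /e' mulrC divfK// gt_eqF// mulr_gt0// addr_gt0.
have dM : `|d| <= M + 1 by rewrite /M; have := normr_ge0 (g c); lra.
have h0 := normr_ge0 h.
have A1 : `|f (c + h) - d * h| * `|g (c + h)| <= e' * `|h| * (M + 1).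
  by apply: ler_pM.
have A2 : `|d| * `|h| * `|g c - g (c + h)| <= (M + 1) * `|h| * e'.
  by apply: ler_pM; rewrite ?mulr_ge0 ?ler_wpM2r.
rewrite E; nra.
Unshelve. all: by end_near. Qed.

(** The integral over [[0, t]] is unoriented and vanishes for [t < 0]; subtracting two integrals
    from a common lower end, left of both [0] and [t], gives the primitive on the whole line that
    vanishes at [0]. *)
Definition prim f t : R :=
  \int[mu]_(x in `[- (`|t| + 1), t]) f x - \int[mu]_(x in `[- (`|t| + 1), 0]) f x.

(** The piece between two lower ends cancels in the difference. One [M] can thus serve for all
    points near [t], as differentiation at [t] requires. *)
Lemma primE f M t : continuous f -> `|t| < M ->
  prim f t = \int[mu]_(x in `[- M, t]) f x - \int[mu]_(x in `[- M, 0]) f x.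
Proof.
move=> cf tM.
have key m m' : `|t| < m -> m <= m' ->
   \int[mu]_(x in `[- m', t]) f x - \int[mu]_(x in `[- m', 0]) f x =
   \int[mu]_(x in `[- m, t]) f x - \int[mu]_(x in `[- m, 0]) f x.
  move=> tm mm'.
  have tm' := tm; rewrite ltr_norml in tm'; case/andP: tm' => t1 t2.
  have m0 : 0 < m by apply: le_lt_trans tm; rewrite normr_ge0.
  have E s : - m < s -> \int[mu]_(x in `[- m', s]) f x =
     \int[mu]_(x in `[- m', - m]) f x + \int[mu]_(x in `[- m, s]) f x.
    move=> ms.
    rewrite -(@Rintegral_itv_obnd_cbnd _ (- m) (BRight s)); last first.
      apply: (integrableS _ _ _ (integrable_seg (- m) s cf)) => //.
      by apply: subset_itvr; rewrite bnd_simp.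
    rewrite -(@Rintegral_itvB _ _ (BLeft (- m')) (BRight s) (- m)).
    - by lra.
    - exact: integrable_seg.
    - by rewrite bnd_simp lerN2.
    - by rewrite bnd_simp ltW.
  by rewrite E// (E 0) ?oppr_lt0//; lra.
rewrite /prim; case: (leP (`|t| + 1) M) => H; last by apply: key; rewrite ?ltW.
by apply/esym/key => //; rewrite ltrDl.
Qed.

Lemma is_derive_prim f t : continuous f -> is_derive t 1 (prim f) (f t).
Proof.
move=> cf.
pose M : R := `|t| + 2.
pose F (y : R) : R := \int[mu]_(x in `[- M, y]) f x.
have tM : `|t| < M by rewrite ltrDl.
have /andP[t1 t2] : - M < t < M by rewrite -ltr_norml.
have [dF F1] : derivable F t 1 /\ derive1 F t = f t.
  by apply: (@continuous_FTC1_closed _ _ _ _ M) => //; [exact: integrable_seg | exact: cf].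
have HF : is_derive t 1 F (f t) by rewrite -F1 derive1E; exact: derivableP.
have H : is_derive t 1 (fun y => F y - F 0) (f t).
  by rewrite -(subr0 (f t)); apply: is_deriveB.
apply: (near_eq_is_derive _ H).
near=> y; apply/esym; rewrite (@primE _ M)// /F.
near: y; apply: (@cvgr_norm_lt _ _ _ (nbhs t) _ id t) => //.
Unshelve. all: by end_near. Qed.

Lemma prim0 f : prim f 0 = 0.
Proof. by rewrite /prim subrr. Qed.

Lemma prim_unique f F t : continuous f -> (forall s : R, is_derive s 1 F (f s)) ->
  prim f t = F t - F 0.
Proof.
move=> cf dF.
have := @eq_of_derive (prim f) F f 0 t (fun s => is_derive_prim s cf) dF.
by rewrite prim0 subr0.
Qed.

Lemma Rintegral_prim f a b : continuous f -> a <= b ->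
  \int[mu]_(x in `[a, b]) f x = prim f b - prim f a.
Proof.
move=> cf ab; pose M := `|a| + `|b| + 1.
have aM : `|a| < M by rewrite /M; have := normr_ge0 b; lra.
have bM : `|b| < M by rewrite /M; have := normr_ge0 a; lra.
rewrite (primE cf aM) (primE cf bM) opprB addrA subrK Rintegral_itvB ?bnd_simp//.
- rewrite Rintegral_itv_obnd_cbnd//.
  apply: (integrableS _ _ _ (integrable_seg a b cf)) => //.
  by apply: subset_itvr; rewrite bnd_simp.
- exact: integrable_seg.
- by move: aM; rewrite ltr_norml => /andP[/ltW].
Qed.

Lemma prim_int f t : continuous f -> 0 <= t ->
  prim f t = \int[mu]_(x in `[0, t]) f x.
Proof. by move=> cf t0; rewrite Rintegral_prim// prim0 subr0. Qed.

End OneVariable.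

(** * Continuity of pointwise operations *)

Section Continuity.
Variables (R : realType) (T : topologicalType).

Lemma continuous_add (V : normedModType R) (f g : T -> V) :
  continuous f -> continuous g -> continuous (fun z => f z + g z).
Proof. by move=> cf cg z; apply: cvgD; [exact: cf|exact: cg]. Qed.

Lemma continuous_sub (V : normedModType R) (f g : T -> V) :
  continuous f -> continuous g -> continuous (fun z => f z - g z).
Proof. by move=> cf cg z; apply: cvgB; [exact: cf|exact: cg]. Qed.

Lemma continuous_mul (f g : T -> R) :
  continuous f -> continuous g -> continuous (fun z => f z * g z).
Proof. by move=> cf cg z; apply: cvgM; [exact: cf|exact: cg]. Qed.

Lemma continuous_scale (V : normedModType R) (f : T -> R) (g : T -> V) :
  continuous f -> continuous g -> continuous (fun z => f z *: g z).
Proof. by move=> cf cg z; apply: cvgZ; [exact: cf|exact: cg]. Qed.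

Lemma continuous_cst (U : topologicalType) (c : U) : continuous (fun _ : T => c).
Proof. by move=> z; exact: cvg_cst. Qed.

Lemma continuous_sum (I : Type) (r : seq I) (P : pred I) (F : I -> T -> R) :
  (forall a, P a -> continuous (F a)) -> continuous (fun z => \sum_(a <- r | P a) F a z).
Proof. by move=> cF; apply: continuous_big => //; exact: add_continuous. Qed.

Lemma continuous_compose (U W : topologicalType) (f : U -> W) (g : T -> U) :
  continuous f -> continuous g -> continuous (fun z => f (g z)).
Proof. by move=> cf cg z; apply: continuous_comp; [exact: cg|exact: cf]. Qed.

Lemma continuous_idfun : continuous (fun z : T => z).
Proof. by move=> z; exact: cvg_id. Qed.

Lemma continuous_epsP (f : T -> R) : continuous f <->
  forall x e, 0 < e -> \forall y \near x, `|f y - f x| <= e.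
Proof.
split=> [cf x e e0|H x].
  have /cvgrPdist_le/(_ _ e0) := cf x.
  by apply: filterS => y; rewrite distrC.
apply/cvgrPdist_le => e e0; have := H x e e0.
by apply: filterS => y; rewrite distrC.
Qed.

End Continuity.

(** * Integrals and increments along coordinate directions *)

Section Operators.
Variables (R : realType) (N : nat).
Local Notation V := 'rV[R]_N.
Implicit Types (f g : V -> R) (i j k : 'I_N) (l : seq 'I_N) (x y z : V)
  (s : 'I_N -> R) (t r e c : R).

Definition unitv i : V := delta_mx 0 i.
Local Notation "''e_' i" := (unitv i) (at level 8, i at level 2).

(** Integration over the segment from [x] to [x + t *: 'e_i], kept as an operator on functions of
    the starting point; integrals over boxes become compositions of such operators, and [t] may be
    negative. *)
Definition intg i t f x : R := prim (fun r => f (x + r *: 'e_i)) t.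
Definition incr i t f x : R := f (x + t *: 'e_i) - f x.

Lemma line_continuous f i : continuous f ->
  continuous (fun p : R * V => f (p.2 + p.1 *: 'e_i)).
Proof.
move=> cf; apply: (continuous_compose cf).
apply: continuous_add; first by move=> p; exact: cvg_snd.
by apply: continuous_scale; [move=> p; exact: cvg_fst|exact: continuous_cst].
Qed.

Lemma line1_continuous f i x : continuous f -> continuous (fun r : R => f (x + r *: 'e_i)).
Proof.
move=> cf; apply: (continuous_compose cf); apply: continuous_add.
  exact: continuous_cst.
by apply: continuous_scale; [exact: continuous_idfun|exact: continuous_cst].
Qed.

Lemma translation_continuous f x : continuous f -> continuous (fun z => f (z + x)).
Proof.
move=> cf; apply: (continuous_compose cf); apply: continuous_add.
  exact: continuous_idfun.
exact: continuous_cst.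
Qed.

(** Compactness of [[- b, b]], in its near-covering form, makes one neighbourhood of [x] serve for
    the whole segment; this uniformity is behind the continuity of [intg] and differentiation under
    it. *)
Lemma tube f i x b e : continuous f -> 0 < e ->
  \forall y \near x, forall r, - b <= r <= b -> `|f (y + r *: 'e_i) - f (x + r *: 'e_i)| <= e.
Proof.
move=> cf e0.
have := @segment_compact R (- b) b => /compact_near_coveringP.
move=> /(_ _ (nbhs x) (fun y r => `|f (y + r *: 'e_i) - f (x + r *: 'e_i)| <= e)).
have H : forall r : R, `[- b, b]%classic r -> \forall r' \near r & y \near nbhs x,
    `|f (y + r' *: 'e_i) - f (x + r' *: 'e_i)| <= e.
  move=> r _.
  have c1 : continuous (fun p : R * V => f (p.2 + p.1 *: 'e_i) - f (x + p.1 *: 'e_i)).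
    apply: continuous_sub; first exact: line_continuous.
    apply: (@continuous_compose _ _ _ (fun r : R => f (x + r *: 'e_i))).
      exact: line1_continuous.
    by move=> p; exact: cvg_fst.
  have /cvgrPdist_le/(_ _ e0) := c1 (r, x).
  by apply: filterS => p; rewrite subrr sub0r normrN.
move=> /(_ _ H); apply: filterS => y Hy r rb; apply: (Hy r).
by rewrite /= in_itv.
Qed.

Lemma is_derive_intg i t f x : continuous f ->
  is_derive t 1 (fun t => intg i t f x) (f (x + t *: 'e_i)).
Proof.
by move=> cf; apply: (@is_derive_prim _ (fun r => f (x + r *: 'e_i))); exact: line1_continuous.
Qed.

Lemma intg0 i f x : intg i 0 f x = 0. Proof. exact: prim0. Qed.

Lemma intg_unique i t f x (F : R -> R) : continuous f ->
  (forall r : R, is_derive r 1 F (f (x + r *: 'e_i))) -> intg i t f x = F t - F 0.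
Proof. by move=> cf; apply: prim_unique; exact: line1_continuous. Qed.

Lemma intgD i t f g x : continuous f -> continuous g ->
  intg i t (fun z => f z + g z) x = intg i t f x + intg i t g x.
Proof.
move=> cf cg.
apply: etrans (@intg_unique _ _ _ _ (fun t => intg i t f x + intg i t g x) _ _) _.
- exact: continuous_add.
- by move=> r; apply: is_deriveD; exact: is_derive_intg.
- by rewrite !intg0 addr0 subr0.
Qed.

Lemma intgZ i t f c x : continuous f ->
  intg i t (fun z => c * f z) x = c * intg i t f x.
Proof.
move=> cf.
apply: etrans (@intg_unique _ _ _ _ (fun t => c * intg i t f x) _ _) _.
- by apply: continuous_mul => //; exact: continuous_cst.
- by move=> r; apply: (@is_deriveZ _ _ _ (fun t => intg i t f x)); exact: is_derive_intg.
- by rewrite !intg0 mulr0 subr0.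
Qed.

Lemma intgB i t f g x : continuous f -> continuous g ->
  intg i t (fun z => f z - g z) x = intg i t f x - intg i t g x.
Proof.
move=> cf cg; rewrite -[RHS]addr0.
have E : (fun z => f z - g z) = (fun z => f z + (-1) * g z).
  by apply/funext => z; rewrite mulN1r.
rewrite E intgD// ?intgZ//; first by rewrite mulN1r addr0.
by apply: continuous_mul => //; exact: continuous_cst.
Qed.

Lemma intg_cst i t c x : intg i t (fun=> c) x = c * t.
Proof.
apply: etrans (@intg_unique _ _ _ _ (fun t => c * t) _ _) _.
- exact: continuous_cst.
- move=> r; have := @is_deriveZ _ _ _ (@id R) c r 1 1 (is_derive_id _ _).
by rewrite [c *: 1]mulr1.
- by rewrite mulr0 subr0.
Qed.

Lemma intg_sum (I : Type) (r : seq I) (F : I -> V -> R) i t x :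
  (forall a, continuous (F a)) ->
  intg i t (fun z => \sum_(a <- r) F a z) x = \sum_(a <- r) intg i t (F a) x.
Proof.
move=> cF; elim: r => [|a r IH].
  have -> : (fun z => \sum_(a <- [::]) F a z) = (fun=> 0).
    by apply/funext => z; rewrite big_nil.
  by rewrite intg_cst mul0r big_nil.
have -> : (fun z => \sum_(b <- a :: r) F b z) = (fun z => F a z + \sum_(b <- r) F b z).
  by apply/funext => z; rewrite big_cons.
by rewrite big_cons intgD ?IH//; exact: continuous_sum.
Qed.

Lemma intg_cat i a b f x : continuous f ->
  intg i (a + b) f x = intg i a f x + intg i b f (x + a *: 'e_i).
Proof.
move=> cf.
suff E : intg i b f (x + a *: 'e_i) = intg i (a + b) f x - intg i a f x.
  by rewrite E subrKC.
suff H : forall r : R, is_derive r 1 (fun t => intg i (a + t) f x) (f (x + a *: 'e_i + r *: 'e_i)).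
  by have -> := @intg_unique _ b _ _ _ cf H; rewrite /= addr0.
move=> r; rewrite -addrA -scalerDl.
apply/is_derive_epsP => e e0.
have /is_derive_epsP/(_ _ e0) := @is_derive_intg i (a + r) f x cf.
by apply: filterS => h; rewrite addrA.
Qed.

Lemma intg_le i t f g x : continuous f -> continuous g -> 0 <= t ->
  (forall r, 0 <= r <= t -> f (x + r *: 'e_i) <= g (x + r *: 'e_i)) ->
  intg i t f x <= intg i t g x.
Proof.
move=> cf cg t0 fg.
have D (r : R) : is_derive r 1 (fun t => intg i t g x - intg i t f x)
    (g (x + r *: 'e_i) - f (x + r *: 'e_i)).
  by apply: is_deriveB; exact: is_derive_intg.
have := le_of_derive_ge0 D t0; rewrite !intg0 subrr subr_ge0; apply => r rt.
by rewrite subr_ge0 fg.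
Qed.

Lemma intg_gt0 i t f x : continuous f -> 0 < t -> (forall z, 0 < f z) ->
  0 < intg i t f x.
Proof.
move=> cf t0 f0.
have [c _] := @mean_value _ _ _ 0 t (fun r => is_derive_intg i r x cf) (ltW t0).
by rewrite intg0 !subr0 => ->; rewrite mulr_gt0.
Qed.

Lemma intg_norm_le i t f x e : continuous f ->
  (forall r, - `|t| <= r <= `|t| -> `|f (x + r *: 'e_i)| <= e) ->
  `|intg i t f x| <= e * `|t|.
Proof.
move=> cf.
have pos (s : R) y : 0 <= s -> (forall r, 0 <= r <= s -> `|f (y + r *: 'e_i)| <= e) ->
    `|intg i s f y| <= e * s.
  move=> s0 H; rewrite ler_norml -mulNr -!(intg_cst i s _ y); apply/andP; split;
    apply: intg_le => //; try exact: continuous_cst.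
    by move=> r /H; rewrite ler_norml => /andP[].
  by move=> r /H; rewrite ler_norml => /andP[].
have [t0|t0] := leP 0 t => H.
  rewrite ger0_norm// in H *; apply: pos => // r /andP[r0 rt]; apply: H.
  by rewrite rt andbT (le_trans _ r0)// oppr_le0.
rewrite ltr0_norm// in H *.
have : intg i (t + - t) f x = 0 by rewrite subrr intg0.
rewrite intg_cat// => /eqP; rewrite addr_eq0 => /eqP ->; rewrite normrN.
apply: pos; first by lra.
move=> r /andP[r0 rt]; rewrite -addrA -scalerDl; apply: H; lra.
Qed.

Lemma intg_continuous i t f : continuous f -> continuous (intg i t f).
Proof.
move=> cf; apply/continuous_epsP => x e e0.
pose b := `|t|; have b0 : 0 <= b by exact: normr_ge0.
(* The denominator [b + 1] covers the case [t = 0]. *)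
have e'0 : 0 < e / (b + 1) by rewrite divr_gt0// ltr_wpDl.
have := tube i x b cf e'0; apply: filterS => y H.
have -> : intg i t f y - intg i t f x = intg i t (fun z => f (z + (y - x)) - f z) x.
  rewrite intgB//; last exact: translation_continuous.
  congr (_ - _); rewrite /intg; congr prim; apply/funext => r.
  by congr f; rewrite addrAC subrKC.
have cd : continuous (fun z => f (z + (y - x)) - f z).
  by apply: continuous_sub => //; exact: translation_continuous.
apply: (@le_trans _ _ (e / (b + 1) * b)).
  apply: intg_norm_le => // r /H.
  by rewrite (_ : x + r *: 'e_i + (y - x) = y + r *: 'e_i)// addrAC subrKC.
by rewrite mulrAC ler_pdivrMr ?ltr_wpDl// ler_wpM2l ?lerDl// ltW.
Qed.

Lemma intg_ext i t f g x : (forall r, f (x + r *: 'e_i) = g (x + r *: 'e_i)) ->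
  intg i t f x = intg i t g x.
Proof. by move=> fg; rewrite /intg; congr prim; apply/funext. Qed.

Lemma intg_shift i t f y x :
  intg i t (fun z => f (z + y)) x = intg i t f (x + y).
Proof. by rewrite /intg; congr prim; apply/funext => r; rewrite addrAC. Qed.

(** Fubini by uniqueness of primitives: as functions of [a] both sides vanish at [0] and have the
    derivative [intg j b f] at [x + a *: 'e_i]. Differentiation under the integral along [j] rests
    on [tube]. *)
Lemma intgC i j a b f : continuous f ->
  intg i a (intg j b f) = intg j b (intg i a f).
Proof.
move=> cf; apply/funext => x.
have ci k t : continuous (intg k t f) by exact: intg_continuous.
have E0 : intg j b (intg i 0 f) x = 0.
  by rewrite (@intg_ext _ _ _ (fun=> 0)) ?intg_cst ?mul0r// => r; rewrite intg0.
suff H : forall r, is_derive r 1 (fun t => intg j b (intg i t f) x)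
    (intg j b f (x + r *: 'e_i)).
  by have -> := @intg_unique _ a _ _ _ (ci j b) H; rewrite E0 subr0.
move=> r; apply/is_derive_epsP => e e0.
set y := x + r *: 'e_i.
pose c := `|b|; have c0 : 0 <= c by exact: normr_ge0.
have e'0 : 0 < e / (c + 1) by rewrite divr_gt0// ltr_wpDl.
have /nbhs_ballP[d /= d0 D] := tube j y c cf e'0.
have sh : (fun h : R => y + h *: 'e_i) h @[h --> 0] --> y.
  rewrite -[X in _ --> X]addr0 -(scale0r 'e_i).
  by apply: cvgD; [exact: cvg_cst|apply: cvgZ; [exact: cvg_id|exact: cvg_cst]].
have /sh/nbhs_ballP[d' /= d'0 D'] := tube j y c cf e'0.
apply/nbhs_ballP; exists d' => // h; rewrite /ball/= sub0r normrN => hd'.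
have -> : intg j b (intg i (r + h) f) x - intg j b (intg i r f) x =
   intg j b (intg i h f) y.
  rewrite -intgB// -intg_shift; apply: intg_ext => u.
  by rewrite intg_cat// addrC addKr addrAC.
have -> : intg j b f y * h = intg j b (fun z => h * f z) y by rewrite intgZ// mulrC.
have ch : continuous (fun z => h * f z) by apply: continuous_mul => //; exact: continuous_cst.
rewrite -intgB//.
apply: (@le_trans _ _ (e / (c + 1) * `|h| * c)).
  apply: intg_norm_le; first exact: continuous_sub.
  move=> u ub.
  have -> : h * f (y + u *: 'e_j) = intg i h (fun=> f (y + u *: 'e_j)) (y + u *: 'e_j).
    by rewrite intg_cst mulrC.
  rewrite -intgB//; last exact: continuous_cst.
  apply: intg_norm_le.
    by apply: continuous_sub => //; exact: continuous_cst.
  move=> v vh; rewrite addrAC; apply: (D' v) => //.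
  by rewrite /ball/= sub0r normrN (le_lt_trans _ hd')// ler_norml.
rewrite mulrAC ler_wpM2r//.
by rewrite mulrAC ler_pdivrMr ?ltr_wpDl// ler_wpM2l ?lerDl// ltW.
Qed.

Lemma incr_continuous i t f : continuous f -> continuous (incr i t f).
Proof. by move=> cf; apply: continuous_sub => //; exact: translation_continuous. Qed.

Lemma incr_intg i j t b f x : continuous f ->
  incr i t (intg j b f) x = intg j b (incr i t f) x.
Proof.
move=> cf; rewrite /incr -intg_shift -intgB//; exact: translation_continuous.
Qed.

End Operators.

(** * Integrals and fluxes over boxes *)

Section Boxes.
Variables (R : realType) (N : nat).
Local Notation V := 'rV[R]_N.
Implicit Types (f g : V -> R) (i j k : 'I_N) (l : seq 'I_N) (x y z : V)
  (s : 'I_N -> R) (t r e c : R).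
Local Notation "''e_' i" := (unitv R i) (at level 8, i at level 2).

Definition boxint l s f : V -> R := foldr (fun i => intg i (s i)) f l.

Definition volume l s : R := \prod_(i <- l) s i.

Definition in_box l s x z :=
  (forall i, i \in l -> x 0 i <= z 0 i <= x 0 i + s i) /\
  (forall i, i \notin l -> z 0 i = x 0 i).

(** Outward flux of the field [p] through the boundary of the box: the increment of [p k] between
    the two faces orthogonal to ['e_k], integrated over the face. By the divergence theorem it
    stands for the integral of the divergence of [p], but it involves no derivative. *)
Definition flux l s (p : 'I_N -> V -> R) x : R :=
  \sum_(k <- l) boxint (rem k l) s (incr k (s k) (p k)) x.

Lemma boxint_continuous l s f : continuous f -> continuous (boxint l s f).
Proof. by move=> cf; elim: l => //= i l IH; exact: intg_continuous. Qed.

Lemma eq_boxint l s s' f : {in l, s =1 s'} -> boxint l s f = boxint l s' f.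
Proof.
elim: l => [//|i l IH] ss'; rewrite /boxint /= -/(boxint l s f) -/(boxint l s' f).
have <- : s i = s' i by apply: ss'; rewrite inE eqxx.
by congr intg; apply: IH => j jl; apply: ss'; rewrite inE jl orbT.
Qed.

Lemma boxint_sum (I : Type) (u : seq I) (F : I -> V -> R) l s x :
  (forall a, continuous (F a)) ->
  boxint l s (fun z => \sum_(a <- u) F a z) x = \sum_(a <- u) boxint l s (F a) x.
Proof.
move=> cF; elim: l x => //= i l IH x.
have -> : boxint l s (fun z => \sum_(a <- u) F a z) =
    (fun z => \sum_(a <- u) boxint l s (F a) z) by apply/funext.
by rewrite intg_sum// => a; exact: boxint_continuous.
Qed.

Lemma boxintD l s f g x : continuous f -> continuous g ->
  boxint l s (fun z => f z + g z) x = boxint l s f x + boxint l s g x.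
Proof.
move=> cf cg; elim: l x => //= i l IH x.
have -> : boxint l s (fun z => f z + g z) =
    (fun z => boxint l s f z + boxint l s g z) by apply/funext.
by rewrite intgD//; exact: boxint_continuous.
Qed.

Lemma boxintB l s f g x : continuous f -> continuous g ->
  boxint l s (fun z => f z - g z) x = boxint l s f x - boxint l s g x.
Proof.
move=> cf cg; elim: l x => //= i l IH x.
have -> : boxint l s (fun z => f z - g z) =
    (fun z => boxint l s f z - boxint l s g z) by apply/funext.
by rewrite intgB//; exact: boxint_continuous.
Qed.

Lemma boxintZ l s f c x : continuous f ->
  boxint l s (fun z => c * f z) x = c * boxint l s f x.
Proof.
move=> cf; elim: l x => //= i l IH x.
have -> : boxint l s (fun z => c * f z) = (fun z => c * boxint l s f z) by apply/funext.
by rewrite intgZ//; exact: boxint_continuous.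
Qed.

Lemma boxint_cst l s c x : boxint l s (fun=> c) x = c * volume l s.
Proof.
rewrite /volume; elim: l x => [|i l IH] x /=; first by rewrite big_nil mulr1.
have -> : boxint l s (fun=> c) = (fun=> c * \prod_(j <- l) s j) by apply/funext.
by rewrite intg_cst big_cons -mulrA [X in c * X]mulrC.
Qed.

Lemma boxint_shift l s f y x :
  boxint l s (fun z => f (z + y)) x = boxint l s f (x + y).
Proof.
elim: l x => //= i l IH x.
have -> : boxint l s (fun z => f (z + y)) = (fun z => boxint l s f (z + y)).
  by apply/funext.
by rewrite intg_shift.
Qed.

Lemma in_box_cons i l s x z r : i \notin l -> 0 <= r <= s i ->
  in_box l s (x + r *: 'e_i) z -> in_box (i :: l) s x z.
Proof.
move=> il /andP[r0 rs] [H1 H2]; split => j; rewrite inE.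
  have [->|ji] := eqVneq j i => /= jl.
    by rewrite H2// !mxE !eqxx mulr1; apply/andP; split; lra.
  by have := H1 _ jl; rewrite !mxE eqxx (negbTE ji) mulr0 addr0.
by rewrite negb_or => /andP[ji jl]; rewrite H2// !mxE eqxx (negbTE ji) mulr0 addr0.
Qed.

Lemma boxint_le l s f g x : continuous f -> continuous g -> uniq l ->
  (forall i, i \in l -> 0 <= s i) ->
  (forall z, in_box l s x z -> f z <= g z) ->
  boxint l s f x <= boxint l s g x.
Proof.
move=> cf cg; elim: l x => [|i l IH] x /=; first by move=> _ _; apply; split => // i.
move=> /andP[il ul] s0 fg; apply: intg_le; try exact: boxint_continuous.
  by apply: s0; rewrite inE eqxx.
move=> r rs; apply: IH => // [j jl|z zb]; first by apply: s0; rewrite inE jl orbT.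
by apply: fg; apply: in_box_cons zb.
Qed.

Lemma volume_ge0 l s : (forall i, i \in l -> 0 <= s i) -> 0 <= volume l s.
Proof. by move=> s0; rewrite /volume big_seq; apply: prodr_ge0 => i; exact: s0. Qed.

Lemma boxint_intg i t l s f : continuous f ->
  boxint l s (intg i t f) = intg i t (boxint l s f).
Proof.
move=> cf; elim: l => //= j l ->; rewrite intgC//; exact: boxint_continuous.
Qed.

Lemma boxint_perm l l' s f : continuous f -> perm_eq l l' ->
  boxint l s f = boxint l' s f.
Proof.
move=> cf; elim: l l' => [|i l IH] l' H /=.
  by have := perm_size H; case: l' {H}.
have il' : i \in l' by rewrite -(perm_mem H) inE eqxx.
have H' := perm_to_rem il'.
have E : perm_eq l (rem i l') by rewrite -(perm_cons i) (perm_trans H).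
rewrite (IH _ E) -boxint_intg//.
have aux m : i \in m -> boxint (rem i m) s (intg i (s i) f) = boxint m s f.
  elim: m => //= k m IHm; rewrite inE; have [->|ki] := eqVneq k i => /=.
    by rewrite boxint_intg.
  by move=> /IHm ->.
exact: aux.
Qed.

Lemma boxint_rem i l s f : continuous f -> i \in l ->
  boxint l s f = intg i (s i) (boxint (rem i l) s f).
Proof. by move=> cf /perm_to_rem/(boxint_perm s cf) ->. Qed.

Lemma volume_rem i l s : i \in l -> volume l s = s i * volume (rem i l) s.
Proof. by move=> /perm_to_rem H; rewrite /volume (perm_big _ H) big_cons. Qed.

End Boxes.

(** * Repeated halving of boxes *)

Section Bisection.
Variables (R : realType) (N : nat).
Local Notation V := 'rV[R]_N.
Implicit Types (i j k : 'I_N) (l : seq 'I_N) (x y z : V) (s : 'I_N -> R).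
Local Notation "''e_' i" := (unitv R i) (at level 8, i at level 2).

Definition halve i s : 'I_N -> R := fun j => if j == i then s j / 2 else s j.
Definition shrink l (n : nat) s : 'I_N -> R :=
  fun j => if j \in l then s j / 2 ^+ n else s j.

(** A box on which [P] fails has a half on which [P] fails; the directions of [l] are halved one
    after the other. Sides carry no sign here, hence the alternative [s i < 0], which [bisection]
    rules out. *)
Lemma bisection_step l (P : V -> ('I_N -> R) -> Prop) x s : uniq l ->
  (forall i, i \in l -> forall y s', P y (halve i s') ->
     P (y + (s' i / 2) *: 'e_i) (halve i s') -> P y s') ->
  ~ P x s -> exists x', ~ P x' (shrink l 1 s) /\
    (forall i, i \in l -> x 0 i <= x' 0 i <= x 0 i + s i / 2 \/ s i < 0) /\
    (forall i, i \notin l -> x' 0 i = x 0 i).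
Proof.
elim: l x s => [|i l IH] x s /=.
  by move=> _ _ nP; exists x.
move=> /andP[il ul] H nP.
have [x1 [nP1 [b1 e1]]] : exists x1, ~ P x1 (halve i s) /\
    (x 0 i <= x1 0 i <= x 0 i + s i / 2 \/ s i < 0) /\ (forall j, j != i -> x1 0 j = x 0 j).
  have [h1|h1] := pselect (P x (halve i s)).
    exists (x + (s i / 2) *: 'e_i); split.
      by move=> h2; apply: nP; apply: H h1 h2; rewrite inE eqxx.
    split; last by move=> j ji; rewrite !mxE (negbTE ji) andbF mulr0 addr0.
    by have [s0|] := leP 0 (s i); [left; rewrite !mxE !eqxx mulr1; lra|right].
  exists x; split => //; split => //.
  by have [s0|] := leP 0 (s i); [left; lra|right].
have [|x2 [nP2 [b2 e2]]] := IH x1 (halve i s) ul _ nP1.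
  by move=> j jl; apply: H; rewrite inE jl orbT.
have E : shrink l 1 (halve i s) = shrink (i :: l) 1 s.
  apply/funext => j; rewrite /shrink /halve inE expr1.
  by have [->|ji] //= := eqVneq j i; rewrite (negbTE il).
exists x2; rewrite -E; split => //; split => j; rewrite inE.
  have [->|ji] /= := eqVneq j i; first by rewrite e2.
  move=> jl; have := b2 _ jl; rewrite /halve (negbTE ji) e1//.
by rewrite negb_or => /andP[ji jl]; rewrite e2// e1.
Qed.

(** If [P] failed, successive halving would give nested failing boxes; they have a point in common,
    and there the local hypothesis is violated. *)
Lemma bisection l (P : V -> ('I_N -> R) -> Prop) s : uniq l ->
  (forall i, i \in l -> 0 < s i) ->
  (forall i, i \in l -> forall y s', (forall j, j \in l -> 0 < s' j) ->
     P y (halve i s') -> P (y + (s' i / 2) *: 'e_i) (halve i s') -> P y s') ->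
  (forall x, \forall n \near \oo, forall x', in_box l (shrink l n s) x' x ->
     P x' (shrink l n s)) ->
  forall x, P x s.
Proof.
move=> ul s0 cat loc x; apply: contrapT => nP.
have sh0 n i : i \in l -> 0 < shrink l n s i.
  by move=> il; rewrite /shrink il divr_gt0 ?s0// exprn_gt0.
(* Positivity of the sides goes into the predicate, because [bisection_step] quantifies over all
   [s']. *)
pose Q y s' := (forall j, j \in l -> 0 < s' j) -> P y s'.
(* Stated as an implication so that the choice is total; where [P] holds, [y] itself is a dummy
   value. *)
have step (n : nat) y : {y' | ~ P y (shrink l n s) -> ~ P y' (shrink l n.+1 s) /\
    (forall i, i \in l -> y 0 i <= y' 0 i <= y 0 i + s i / 2 ^+ n.+1) /\
    (forall i, i \notin l -> y' 0 i = y 0 i)}.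
  apply: cid; have [Py|nPy] := pselect (P y (shrink l n s)); first by exists y.
  have [] := @bisection_step l Q y (shrink l n s) ul.
  - move=> i il z s' h1 h2 s'0; apply: (cat i il) => //.
      apply: h1 => j jl; rewrite /halve; case: eqP => // _; rewrite ?divr_gt0//; exact: s'0.
    apply: h2 => j jl; rewrite /halve; case: eqP => // _; rewrite ?divr_gt0//; exact: s'0.
  - by move=> h; apply: nPy; apply: h => i; exact: sh0.
  move=> y' [h1 [h2 h3]].
  have E : shrink l 1 (shrink l n s) = shrink l n.+1 s.
    by apply/funext => j; rewrite /shrink; case: (j \in l) => //; rewrite expr1 exprSr invfM mulrA.
  exists y' => _; split; first by move=> h; apply: h1 => _; rewrite E.
  split => // i il; case: (h2 i il); last by rewrite ltNge ltW// sh0.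
  by rewrite /shrink il exprSr invfM mulrA.
pose u := fix u n := if n is m.+1 then sval (step m (u m)) else x.
have uP n : ~ P (u n) (shrink l n s).
  elim: n => [|n IH] /=.
    rewrite (_ : shrink l 0 s = s)//; apply/funext => j.
    by rewrite /shrink expr0 divr1; case: ifP.
  by case: (svalP (step n (u n)) IH).
have ub n i : i \in l -> u n 0 i <= u n.+1 0 i <= u n 0 i + s i / 2 ^+ n.+1.
  by move=> il; have [_ [h _]] := svalP (step n (u n)) (uP n); exact: h.
have ue n i : i \notin l -> u n 0 i = x 0 i.
  move=> il; elim: n => //= n IH; have [_ [_ h]] := svalP (step n (u n)) (uP n).
  by rewrite h.
have mono i n m : i \in l -> (n <= m)%N ->
    u n 0 i <= u m 0 i /\ u m 0 i + s i / 2 ^+ m <= u n 0 i + s i / 2 ^+ n.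
  move=> il /subnK <-; elim: (m - n)%N => [|k [h1 h2]]; first by rewrite add0n.
  have := ub (k + n)%N i il; rewrite addSn => /andP[h3 h4]; split; first lra.
  apply: le_trans h2.
  have -> : s i / 2 ^+ (k + n) = s i / 2 ^+ (k + n).+1 + s i / 2 ^+ (k + n).+1.
    by rewrite exprS invfM; field; rewrite expf_neq0// pnatr_eq0.
  by rewrite addrA lerD2r.
have up n m i : i \in l -> u n 0 i <= u m 0 i + s i / 2 ^+ m.
  move=> il; have p (a : nat) : 0 <= s i / 2 ^+ a by rewrite divr_ge0 ?ltW ?s0// exprn_gt0.
  have [/(mono i _ _ il)[h _]|/ltnW/(mono i _ _ il)[h1 h2]] := leqP n m.
    by have := p m; lra.
  by have := p n; lra.
(* The common point: in each direction of [l] the corners increase, and by [up] every corner lies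
   below every upper end. *)
pose L : V := \row_i (if i \in l then sup [set u n 0 i | n in setT] else x 0 i).
have [n _ /(_ _ (leqnn n) (u n)) H] := loc L.
apply: (uP n); apply: H; split => i il; last by rewrite mxE (negbTE il) ue.
rewrite mxE il /shrink il; apply/andP; split.
  apply: ub_le_sup; last by exists n.
  by exists (u 0%N 0 i + s i / 2 ^+ 0) => _ [m _ <-]; exact: up.
apply: ge_sup; first by exists (u 0%N 0 i), 0%N.
by move=> _ [m _ <-]; exact: up.
Qed.

End Bisection.

(** * Additivity of fluxes and the subdivision lemma *)

Section Goursat.
Variables (R : realType) (N : nat).
Local Notation V := 'rV[R]_N.
Implicit Types (f g q : V -> R) (i j k : 'I_N) (l : seq 'I_N) (x y z : V)
  (s : 'I_N -> R) (p : 'I_N -> V -> R) (t r e c : R).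
Local Notation "''e_' i" := (unitv R i) (at level 8, i at level 2).

Lemma halve_id i s : halve i s i = s i / 2.
Proof. by rewrite /halve eqxx. Qed.

Lemma boxint_halve l i s f x : continuous f -> uniq l -> i \in l ->
  boxint l s f x = boxint l (halve i s) f x +
    boxint l (halve i s) f (x + (s i / 2) *: 'e_i).
Proof.
move=> cf ul il; rewrite (boxint_rem s cf il) !(boxint_rem (halve i s) cf il) halve_id.
have -> : boxint (rem i l) (halve i s) f = boxint (rem i l) s f.
  apply: eq_boxint => j; rewrite mem_rem_uniq// inE => /andP[ji _].
  by rewrite /halve (negbTE ji).
by rewrite {1}(splitr (s i)) intg_cat//; exact: boxint_continuous.
Qed.

Lemma volume_halve l i s : uniq l -> i \in l ->
  volume l s = volume l (halve i s) + volume l (halve i s).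
Proof.
move=> ul il; rewrite (volume_rem s il) (volume_rem (halve i s) il) halve_id.
have -> : volume (rem i l) (halve i s) = volume (rem i l) s.
  rewrite /volume big_seq [RHS]big_seq; apply: eq_bigr => j.
  by rewrite mem_rem_uniq// inE => /andP[ji _]; rewrite /halve (negbTE ji).
by rewrite -mulrDl -splitr.
Qed.

(** For [k = i] the contributions of the common face cancel; for the other [k] each face is itself
    cut in two. *)
Lemma flux_halve l i s p x : (forall k, continuous (p k)) -> uniq l -> i \in l ->
  flux l s p x = flux l (halve i s) p x + flux l (halve i s) p (x + (s i / 2) *: 'e_i).
Proof.
move=> cp ul il; rewrite /flux -big_split /=; apply: eq_big_seq => k kl.
have ci t : continuous (incr k t (p k)) by exact: incr_continuous.
have [<-|ki] := eqVneq k i.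
  have E : boxint (rem k l) (halve k s) = boxint (rem k l) s.
    apply/funext => f; apply: eq_boxint => j; rewrite mem_rem_uniq// inE => /andP[ji _].
    by rewrite /halve (negbTE ji).
  rewrite E halve_id -boxint_shift -boxintD//; last exact: translation_continuous.
  congr boxint; apply/funext => z; rewrite /incr.
  have <- : z + (s k / 2) *: 'e_k + (s k / 2) *: 'e_k = z + s k *: 'e_k.
    by rewrite -addrA -scalerDl -splitr.
  by rewrite [RHS]addrC subrKA.
have ik : i \in rem k l by rewrite mem_rem_uniq// inE il eq_sym ki.
rewrite {2 4}/halve (negbTE ki); apply: boxint_halve => //.
exact: rem_uniq.
Qed.

(* A subdivision argument as in Goursat's lemma: no integrability of the
   derivatives of the [p k] is involved. *)
Lemma goursat l s p q : uniq l -> (forall i, i \in l -> 0 < s i) ->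
  (forall k, continuous (p k)) -> continuous q ->
  (forall x e, 0 < e -> \forall n \near \oo, forall x', in_box l (shrink l n s) x' x ->
     flux l (shrink l n s) p x' <=
     boxint l (shrink l n s) q x' + e * volume l (shrink l n s)) ->
  forall x, flux l s p x <= boxint l s q x.
Proof.
move=> ul s0 cp cq loc x.
apply/ler_addgt0Pr => e e0.
pose v := volume l s + 1.
have v0 : 0 < v by rewrite ltr_wpDl// volume_ge0// => i /s0/ltW.
(* The error is proportional to volume, hence additive under halving, and totals at most [e]. *)
have := @bisection R N l (fun x s => flux l s p x <= boxint l s q x + e / v * volume l s)
  s ul s0 _ _ x.
have H1 : boxint l s q x + e / v * volume l s <= boxint l s q x + e.
  by rewrite lerD2l mulrAC ler_pdivrMr// ler_wpM2l ?(ltW e0)// lerDl.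
move=> H; apply: le_trans (H _ _) H1 => {H}.
  move=> i il y s' _ h1 h2.
  rewrite (@flux_halve _ i)// (@boxint_halve _ i)// (@volume_halve _ i)//.
  by rewrite mulrDr addrACA lerD.
by move=> z; apply: loc; rewrite divr_gt0.
Qed.

End Goursat.

(** * Positive definite matrices *)

Section EntrywiseLimits.
Variables (R : realType) (T : Type) (F : set_system T).
Context {FF : Filter F}.

Definition mxcvg m n (A : T -> 'M[R]_(m, n)) (A0 : 'M[R]_(m, n)) :=
  forall i j, A z i j @[z --> F] --> A0 i j.

Lemma mxcvg_cst m n (A : 'M[R]_(m, n)) : mxcvg (fun=> A) A.
Proof. by move=> i j; exact: cvg_cst. Qed.

Lemma mxcvg_add m n (A B : T -> 'M[R]_(m, n)) A0 B0 : mxcvg A A0 -> mxcvg B B0 ->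
  mxcvg (fun z => A z + B z) (A0 + B0).
Proof.
move=> hA hB i j; rewrite mxE; under eq_fun do rewrite mxE.
by apply: cvgD; [exact: hA|exact: hB].
Qed.

Lemma mxcvg_sub m n (A B : T -> 'M[R]_(m, n)) A0 B0 : mxcvg A A0 -> mxcvg B B0 ->
  mxcvg (fun z => A z - B z) (A0 - B0).
Proof.
move=> hA hB i j; rewrite !mxE; under eq_fun do rewrite !mxE.
by apply: cvgB; [exact: hA|exact: hB].
Qed.

Lemma mxcvg_tr m n (A : T -> 'M[R]_(m, n)) A0 : mxcvg A A0 ->
  mxcvg (fun z => (A z)^T) A0^T.
Proof. by move=> hA i j; rewrite mxE; under eq_fun do rewrite mxE; exact: hA. Qed.

Lemma mxcvg_mul m n p (A : T -> 'M[R]_(m, n)) (B : T -> 'M[R]_(n, p)) A0 B0 :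
  mxcvg A A0 -> mxcvg B B0 -> mxcvg (fun z => A z *m B z) (A0 *m B0).
Proof.
move=> hA hB i j; rewrite mxE; under eq_fun do rewrite mxE.
apply: cvg_big => [|k _]; first exact: add_continuous.
by apply: cvgM; [exact: hA|exact: hB].
Qed.

Lemma mxcvg_sum (I : Type) (r : seq I) m n (A : I -> T -> 'M[R]_(m, n)) A0 :
  (forall k, mxcvg (A k) (A0 k)) ->
  mxcvg (fun z => \sum_(k <- r) A k z) (\sum_(k <- r) A0 k).
Proof.
move=> hA i j; rewrite summxE; under eq_fun do rewrite summxE.
by apply: cvg_big => [|k _]; [exact: add_continuous|exact: hA].
Qed.

Lemma cvg_det n (A : T -> 'M[R]_n) A0 : mxcvg A A0 -> \det (A z) @[z --> F] --> \det A0.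
Proof.
move=> hA; rewrite /determinant; apply: cvg_big => [|s _]; first exact: add_continuous.
apply: cvgM; first exact: cvg_cst.
by apply: cvg_big => [|i _]; [exact: mul_continuous|exact: hA].
Qed.

(** By Cramer's formula the inverse is polynomial in the entries up to division by the determinant.
    The formula governs [invmx] only on invertible matrices, so it is applied eventually along [F],
    where the determinant differs from zero. *)
Lemma mxcvg_inv n (A : T -> 'M[R]_n) A0 : mxcvg A A0 -> A0 \in unitmx ->
  mxcvg (fun z => invmx (A z)) (invmx A0).
Proof.
move=> hA uA i j.
have d0 : \det A0 != 0 by rewrite -unitfE -unitmxE.
have cA : (\det (A z))^-1 * \adj (A z) i j @[z --> F] --> (\det A0)^-1 * \adj A0 i j.
  apply: cvgM; first by apply: cvgV => //; exact: cvg_det.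
  rewrite !mxE; under eq_fun do rewrite !mxE.
  apply: cvgM; first exact: cvg_cst.
  apply: cvg_det => a b; rewrite !mxE; under eq_fun do rewrite !mxE.
  exact: hA.
rewrite {2}/invmx uA mxE; apply: cvg_trans cA; apply: near_eq_cvg.
have H := cvgr_neq0 _ (cvg_det hA) d0.
near=> z; have dz : \det (A z) != 0 by near: z; exact: H.
by rewrite /invmx unitmxE unitfE dz [RHS]mxE.
Unshelve. all: by end_near. Qed.

End EntrywiseLimits.

Section EntrywiseContinuity.
Variables (R : realType) (T : topologicalType).

Definition mxcontinuous m n (A : T -> 'M[R]_(m, n)) := forall x, mxcvg (nbhs x) A (A x).

Lemma mxcontinuousP m n (A : T -> 'M[R]_(m, n)) :
  (forall i j, continuous (fun z => A z i j)) <-> mxcontinuous A.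
Proof. by split => [cA x i j|cA i j x]; [exact: cA|exact: (cA x)]. Qed.

Lemma mxcontinuous_cst m n (A : 'M[R]_(m, n)) : mxcontinuous (fun=> A).
Proof. by move=> x; exact: mxcvg_cst. Qed.

Lemma mxcontinuous_add m n (A B : T -> 'M[R]_(m, n)) :
  mxcontinuous A -> mxcontinuous B -> mxcontinuous (fun z => A z + B z).
Proof. by move=> cA cB x; exact: (mxcvg_add (cA x) (cB x)). Qed.

Lemma mxcontinuous_sub m n (A B : T -> 'M[R]_(m, n)) :
  mxcontinuous A -> mxcontinuous B -> mxcontinuous (fun z => A z - B z).
Proof. by move=> cA cB x; exact: (mxcvg_sub (cA x) (cB x)). Qed.

Lemma mxcontinuous_mul m n p (A : T -> 'M[R]_(m, n)) (B : T -> 'M[R]_(n, p)) :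
  mxcontinuous A -> mxcontinuous B -> mxcontinuous (fun z => A z *m B z).
Proof. by move=> cA cB x; exact: (mxcvg_mul (cA x) (cB x)). Qed.

Lemma mxcontinuous_tr m n (A : T -> 'M[R]_(m, n)) :
  mxcontinuous A -> mxcontinuous (fun z => (A z)^T).
Proof. by move=> cA x; exact: (mxcvg_tr (cA x)). Qed.

Lemma mxcontinuous_sum (I : Type) (r : seq I) m n (A : I -> T -> 'M[R]_(m, n)) :
  (forall k, mxcontinuous (A k)) -> mxcontinuous (fun z => \sum_(k <- r) A k z).
Proof. by move=> cA x; apply: mxcvg_sum => k; exact: cA. Qed.

Lemma mxcontinuous_inv n (A : T -> 'M[R]_n) :
  mxcontinuous A -> (forall z, A z \in unitmx) -> mxcontinuous (fun z => invmx (A z)).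
Proof. by move=> cA uA x; exact: (mxcvg_inv (cA x)). Qed.

End EntrywiseContinuity.

Section PositiveDefinite.
Variables (R : realType) (n : nat).
Implicit Types (A B : 'M[R]_n) (u v w : 'cV[R]_n).

Definition form A u v : R := (u^T *m A *m v) 0 0.

Definition posdef A := A^T = A /\ forall v, v != 0 -> 0 < form A v v.

Lemma mx11_tr (M : 'M[R]_1) : M^T 0 0 = M 0 0. Proof. by rewrite mxE. Qed.

Lemma formDl A u v w : form A (u + v) w = form A u w + form A v w.
Proof. by rewrite /form linearD /= !mulmxDl mxE. Qed.

Lemma formDr A u v w : form A w (u + v) = form A w u + form A w v.
Proof. by rewrite /form mulmxDr mxE. Qed.

Lemma formNl A u v : form A (- u) v = - form A u v.
Proof. by rewrite /form linearN /= !mulNmx mxE. Qed.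

Lemma formNr A u v : form A u (- v) = - form A u v.
Proof. by rewrite /form mulmxN mxE. Qed.

Lemma formC A u v : A^T = A -> form A u v = form A v u.
Proof. by move=> sA; rewrite /form -mx11_tr !trmx_mul sA trmxK mulmxA. Qed.

Lemma dot_mulC A u v : A^T = A -> (u^T *m (A *m v)) 0 0 = (v^T *m (A *m u)) 0 0.
Proof. by move=> sA; have := formC u v sA; rewrite /form !mulmxA. Qed.

(** The increment from [u] to [v] of the quadratic function [v -> 2 v.p + v.Av], written so that
    every term carries the factor [v - u]. With [u] the value of a moving [v] at a point, both terms
    vanish there, and [is_mxderive_mul0] differentiates them with [p] and [A] only continuous. *)
Lemma dot_polarize A (p u v : 'cV[R]_n) : A^T = A ->
  (v^T *m (p + (p + A *m v))) 0 0 = (u^T *m (p + (p + A *m u))) 0 0 +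
  (((v - u)^T *m (p + (p + A *m u))) 0 0 + ((v - u)^T *m (A *m v)) 0 0).
Proof.
move=> sA; have := dot_mulC u v sA.
by rewrite linearB /= !mulmxBl !mulmxDr !mxE; lra.
Qed.

Lemma posdef_ge0 A v : posdef A -> 0 <= form A v v.
Proof.
move=> [_ pA]; have [->|/pA/ltW//] := eqVneq v 0.
by rewrite /form mulmx0 mxE.
Qed.

Lemma posdef_unit A : posdef A -> A \in unitmx.
Proof.
move=> [sA pA]; rewrite -row_free_unit -kermx_eq0; apply/rowV0P => v /sub_kermxP vA.
apply/eqP; apply/negPn/negP => v0.
have := pA v^T; rewrite trmx_eq0 => /(_ v0).
by rewrite /form trmxK vA mul0mx mxE ltxx.
Qed.

Lemma inv_sym A : A^T = A -> (invmx A)^T = invmx A.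
Proof. by move=> sA; rewrite trmx_inv sA. Qed.

Lemma form_inv A u v : posdef A -> form (invmx A) (A *m u) (A *m v) = form A u v.
Proof.
move=> pA; have uA := posdef_unit pA; rewrite /form trmx_mul (proj1 pA).
by rewrite -!mulmxA mulKmx.
Qed.

Lemma form_inv_ge0 A v : posdef A -> 0 <= form (invmx A) v v.
Proof.
move=> pA; rewrite -[v](mulKVmx (posdef_unit pA)) form_inv//.
exact: posdef_ge0.
Qed.

(** With [z = A^-1 v] and [w = B^-1 v], expand [0 <= form A (z - w) (z - w)]: the mixed form is
    [w.v], which equals [form B w w], and [form A w w] is at most that. *)
Lemma form_inv_antitone A B v : posdef A -> posdef B ->
  (forall w, form A w w <= form B w w) -> form (invmx B) v v <= form (invmx A) v v.
Proof.
move=> pA pB AB.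
have uA := posdef_unit pA; have uB := posdef_unit pB.
pose w := invmx B *m v; pose z := invmx A *m v.
have vB : v = B *m w by rewrite /w mulKVmx.
have vA : v = A *m z by rewrite /z mulKVmx.
have := posdef_ge0 (z - w) pA; have := AB w.
have -> : form (invmx B) v v = form B w w by rewrite {1 2}vB form_inv.
have -> : form (invmx A) v v = form A z z by rewrite {1 2}vA form_inv.
have E : form A w z = form B w w by rewrite /form -!mulmxA -vA -vB.
rewrite !(formDl, formDr, formNl, formNr) (formC z w (proj1 pA)) E; lra.
Qed.

(** Polarisation; it reduces convergence and domination of symmetric matrices to their quadratic
    forms. *)
Lemma form_entries A i j : A^T = A ->
  A i j = (form A (delta_mx i 0 + delta_mx j 0) (delta_mx i 0 + delta_mx j 0)
    - form A (delta_mx i 0) (delta_mx i 0) - form A (delta_mx j 0) (delta_mx j 0)) / 2.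
Proof.
have E a b : form A (delta_mx a 0) (delta_mx b 0) = A a b.
  by rewrite /form trmx_delta -rowE -colE !mxE.
move=> sA; rewrite !(formDl, formDr) !E.
have -> : A j i = A i j by rewrite -{1}sA mxE.
by field.
Qed.

End PositiveDefinite.

Lemma cvg_form (R : realType) (T : Type) (F : set_system T) (FF : Filter F) n
    (h : T -> 'M[R]_n) (v w : T -> 'cV[R]_n) h0 v0 w0 :
  mxcvg F h h0 -> mxcvg F v v0 -> mxcvg F w w0 ->
  form (h z) (v z) (w z) @[z --> F] --> form h0 v0 w0.
Proof.
move=> ch cv cw; apply: (mxcvg_mul (A := fun z => (v z)^T *m h z) (A0 := v0^T *m h0)) cw 0 0.
by apply: mxcvg_mul => //; exact: mxcvg_tr.
Qed.

(** * Derivatives of matrix functions of one variable *)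

Section MatrixDerivative.
Variable R : realType.

Definition is_mxderive m n (W : R -> 'M[R]_(m, n)) (c : R) (W' : 'M[R]_(m, n)) :=
  forall i j, is_derive c 1 (fun t => W t i j) (W' i j).

Lemma is_derive_bigsum (I : Type) (r : seq I) (f : I -> R -> R) (c : R) (df : I -> R) :
  (forall i, is_derive c 1 (f i) (df i)) ->
  is_derive c 1 (fun t => \sum_(i <- r) f i t) (\sum_(i <- r) df i).
Proof.
move=> H; elim: r => [|i r IH].
  rewrite big_nil; under eq_fun do rewrite big_nil.
  exact: is_derive_cst.
rewrite big_cons; under eq_fun do rewrite big_cons.
exact: is_deriveD.
Qed.

Lemma is_derive_cvg (f : R -> R) (c d : R) : is_derive c 1 f d -> f t @[t --> c] --> f c.
Proof.
move=> df; apply: differentiable_continuous; apply/derivable1_diffP.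
by case: df.
Qed.

Lemma is_mxderive_cvg m n (W : R -> 'M[R]_(m, n)) c W' :
  is_mxderive W c W' -> mxcvg (nbhs c) W (W c).
Proof. by move=> dW i j; exact: is_derive_cvg. Qed.

Lemma is_mxderive_cst m n (A : 'M[R]_(m, n)) c : is_mxderive (fun=> A) c 0.
Proof. by move=> i j; rewrite mxE; exact: is_derive_cst. Qed.

Lemma is_mxderive_sub m n (W Z : R -> 'M[R]_(m, n)) c W' Z' :
  is_mxderive W c W' -> is_mxderive Z c Z' ->
  is_mxderive (fun t => W t - Z t) c (W' - Z').
Proof.
move=> dW dZ i j; rewrite !mxE; under eq_fun do rewrite !mxE.
by apply: is_deriveB; [exact: dW|exact: dZ].
Qed.

Lemma is_mxderive_mul0 m n p (W : R -> 'M[R]_(m, n)) (Z : R -> 'M[R]_(n, p)) c W' :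
  is_mxderive W c W' -> W c = 0 -> mxcvg (nbhs c) Z (Z c) ->
  is_mxderive (fun t => W t *m Z t) c (W' *m Z c).
Proof.
move=> dW W0 cZ i j; rewrite mxE; under eq_fun do rewrite mxE.
apply: is_derive_bigsum => k; apply: is_derive_mul0; first exact: dW.
  by rewrite W0 mxE.
exact: cZ.
Qed.

Lemma is_mxderive_tr m n (W : R -> 'M[R]_(m, n)) c W' :
  is_mxderive W c W' -> is_mxderive (fun t => (W t)^T) c W'^T.
Proof. by move=> dW i j; rewrite mxE; under eq_fun do rewrite mxE; exact: dW. Qed.

Lemma is_mxderive_solve m n (A : R -> 'M[R]_m) (K : R -> 'M[R]_(m, n)) c A' K' :
  is_mxderive A c A' -> is_mxderive K c K' -> (forall t, A t \in unitmx) ->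
  is_mxderive (fun t => invmx (A t) *m K t) c
    (invmx (A c) *m (K' - A' *m (invmx (A c) *m K c))).
Proof.
move=> dA dK uA.
pose W t := invmx (A t) *m K t.
pose E t := (K t - K c) - (A t - A c) *m W c.
have EE t : W t = W c + invmx (A t) *m E t.
  rewrite /E mulmxBl (_ : A c *m W c = K c); last by rewrite /W mulKVmx.
  rewrite opprB addrA subrK mulmxBr mulKmx; last exact: uA.
  by rewrite addrC subrK.
have dE : is_mxderive E c (K' - A' *m W c).
  apply: is_mxderive_sub.
    by rewrite -[K']subr0; apply: is_mxderive_sub => //; exact: is_mxderive_cst.
  apply: (@is_mxderive_mul0 _ _ _ (fun t => A t - A c) (fun=> W c)).
  - by rewrite -[A']subr0; apply: is_mxderive_sub => //; exact: is_mxderive_cst.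
  - by rewrite subrr.
  - exact: mxcvg_cst.
have E0 : E c = 0 by rewrite /E !subrr mul0mx subrr.
(* Transposition puts the vanishing factor [E] on the left, where [is_mxderive_mul0] expects it. *)
have cV : mxcvg (nbhs c) (fun t => (invmx (A t))^T) (invmx (A c))^T.
  by apply: mxcvg_tr; apply: mxcvg_inv => //; exact: is_mxderive_cvg dA.
have := is_mxderive_mul0 (is_mxderive_tr dE) _ cV.
rewrite E0 trmx0 => /(_ erefl)/is_mxderive_tr H i j.
have -> : (fun t => (invmx (A t) *m K t) i j) =
    (fun t => W c i j + (invmx (A t) *m E t) i j).
  by apply/funext => t; rewrite -/(W t) EE mxE.
have {}H : is_derive c 1 (fun t => (invmx (A t) *m E t) i j)
    ((invmx (A c) *m (K' - A' *m W c)) i j).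
  have := H i j; rewrite trmx_mul !trmxK.
  by under eq_fun do rewrite trmx_mul !trmxK.
have := is_deriveD (is_derive_cst (W c i j) c 1) H.
by rewrite add0r.
Qed.

End MatrixDerivative.

(** * The integrated form of Nakano log concavity *)

Section ShrinkingBoxes.
Variables (R : realType) (N : nat).
Local Notation V := 'rV[R]_N.
Implicit Types (f g q : V -> R) (i j k : 'I_N) (l : seq 'I_N) (x y z v : V)
  (s : 'I_N -> R) (p : 'I_N -> V -> R) (t r e c : R).
Local Notation "''e_' i" := (unitv R i) (at level 8, i at level 2).

Lemma shrink_gt0 l n s : (forall i, i \in l -> 0 < s i) ->
  forall i, i \in l -> 0 < shrink l n s i.
Proof. by move=> s0 i il; rewrite /shrink il divr_gt0 ?s0// exprn_gt0. Qed.

Lemma near_shrink_lt l s e : (forall i, i \in l -> 0 < s i) -> 0 < e ->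
  \forall n \near \oo, forall i, i \in l -> shrink l n s i < e.
Proof.
move=> s0 e0; pose M := \sum_(i <- l) s i + 1.
have sM i : i \in l -> s i <= M.
  move=> il; rewrite /M (perm_big _ (perm_to_rem il)) big_cons /= -addrA lerDl.
  rewrite addr_ge0// big_seq; apply: sumr_ge0 => j /mem_rem jl; exact/ltW/s0.
have M0 : 0 < M.
  by rewrite /M ltr_wpDl// big_seq; apply: sumr_ge0 => j jl; exact/ltW/s0.
exists (Num.truncn (M / e)).+1 => // n /= ln i il; rewrite /shrink il.
rewrite ltr_pdivrMr ?exprn_gt0//; apply: (le_lt_trans (sM i il)).
rewrite mulrC -ltr_pdivrMr//; apply: (lt_trans (truncnS_gt _)).
rewrite -natrX ltr_nat (leq_ltn_trans ln)// ltn_expl//.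
Qed.

Lemma near_shrink l s x (A : set V) : (forall i, i \in l -> 0 < s i) ->
  (\forall z \near x, A z) ->
  \forall n \near \oo, forall x', in_box l (shrink l n s) x' x ->
    forall z, in_box l (shrink l n s) x' z -> A z.
Proof.
move=> s0 /nbhs_ballP[d /= d0 D].
have := near_shrink_lt s0 d0; apply: filterS => n H x' [h1 h2] z [h3 h4].
apply: D; split => // i j; rewrite (ord1 i) /ball /=.
have [jl|jl] := boolP (j \in l); last by rewrite h2// h4// subrr normr0.
by have := h1 _ jl; have := h3 _ jl; have := H _ jl; rewrite ltr_norml; lra.
Qed.

Lemma in_box_refl l s x : (forall i, i \in l -> 0 <= s i) -> in_box l s x x.
Proof. by move=> s0; split=> // i il; rewrite lexx lerDl s0. Qed.

Lemma incr_shift k t f v z : incr k t (fun z => f (z + v)) z = incr k t f (z + v).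
Proof. by rewrite /incr addrAC. Qed.

Lemma flux_shift l s p v z :
  flux l s (fun k z => p k (z + v)) z = flux l s p (z + v).
Proof.
apply: eq_bigr => k _; rewrite -boxint_shift; congr boxint.
by apply/funext => z'; exact: incr_shift.
Qed.

Lemma incrD k t f g z : incr k t (fun z => f z + g z) z = incr k t f z + incr k t g z.
Proof. by rewrite /incr opprD addrACA. Qed.

Lemma fluxD l s p p' z : (forall k, continuous (p k)) -> (forall k, continuous (p' k)) ->
  flux l s (fun k z => p k z + p' k z) z = flux l s p z + flux l s p' z.
Proof.
move=> cp cp'; rewrite /flux -big_split /=; apply: eq_bigr => k _.
rewrite -boxintD; try exact: incr_continuous.
by congr boxint; apply/funext => z'; exact: incrD.
Qed.

Lemma eq_flux l s p p' z : (forall k, k \in l -> p k = p' k) ->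
  flux l s p z = flux l s p' z.
Proof. by move=> pp'; apply: eq_big_seq => k kl; rewrite pp'. Qed.

End ShrinkingBoxes.

(** Proved by [bisection] in dimension one, the interval from [a] to [b] being the box with corner
    [a] and side [b - a]. *)
Lemma cousin (R : realType) (P : R -> R -> Prop) :
  (forall a b c : R, a < b -> b < c -> P a b -> P b c -> P a c) ->
  (forall c : R, exists2 d, 0 < d &
     forall a b : R, a <= c -> c <= b -> a < b -> b - a < d -> P a b) ->
  forall a b, a < b -> P a b.
Proof.
move=> cat loc a b ab.
pose l := [:: ord0 : 'I_1].
pose s := fun _ : 'I_1 => b - a.
have s0 (i : 'I_1) : i \in l -> 0 < s i by rewrite /s subr_gt0.
have := @bisection R 1 l (fun (x : 'rV_1) s => P (x 0 0) (x 0 0 + s 0)) s erefl s0 _ _ (const_mx a).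
rewrite mxE /s subrKC; apply.
  move=> i il y s' s'0; rewrite (ord1 i) !mxE eqxx mulr1 /halve eqxx.
  have s'p : 0 < s' 0 / 2 by rewrite divr_gt0// s'0// inE.
  rewrite -addrA -splitr; apply: cat; first by rewrite ltrDl.
  by rewrite ltrD2l [ltRHS]splitr ltrDl.
move=> x; have [d d0 D] := loc (x 0 0).
have := near_shrink_lt s0 d0; apply: filterS => n H x' [h1 _].
have /andP[h2 h3] := h1 0 (mem_head _ _).
apply: D => //; first by rewrite ltrDl shrink_gt0// mem_head.
by rewrite addrAC subrr add0r H// mem_head.
Qed.

Section WeakNakano.
Variables (R : realType) (N d : nat).
Local Notation V := 'rV[R]_N.
Implicit Types (i j k y : 'I_N) (l : seq 'I_N) (x z : V)
  (s : 'I_N -> R) (t r e c : R) (g : V -> 'M[R]_d) (G : 'I_N -> V -> 'M[R]_d)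
  (u : 'I_N -> 'cV[R]_d).
Local Notation "''e_' i" := (unitv R i) (at level 8, i at level 2).

(** The gradient is part of the data and is tied to [g] by the fundamental theorem of calculus in
    integrated form. That form passes to marginals by Fubini and to restrictions by substitution;
    derivatives are recovered in [c1_metric_derive]. *)
Definition c1_metric g G :=
  [/\ forall x, posdef (g x), mxcontinuous g, forall j, mxcontinuous (G j),
      forall j x, (G j x)^T = G j x &
      forall j x t a b, incr j t (fun z => g z a b) x = intg j t (fun z => G j z a b) x].

(** The vector [P] of the overview, over the directions in [l]. *)
Definition contr l G u z : 'cV[R]_d := \sum_(j <- l) G j z *m u j.

(* Nakano log concavity reads
   [sum_k d_k (sum_j u_k^T (d_j g) u_j) <= |sum_j (d_j g) u_j|^2_{g^-1}]; integrating
   over a box removes the second derivatives, and the resulting inequality survives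
   marginalisation even though second derivatives need not. *)
Definition weak_nakano l g G := forall u s x, (forall i, i \in l -> 0 < s i) ->
  flux l s (fun k z => ((u k)^T *m contr l G u z) 0 0) x <=
  boxint l s (fun z => form (invmx (g z)) (contr l G u z) (contr l G u z)) x.

Definition mxintg m n y t (A : V -> 'M[R]_(m, n)) z : 'M[R]_(m, n) :=
  \matrix_(a, b) intg y t (fun z => A z a b) z.

Lemma mxcontinuous_entry m n (A : V -> 'M[R]_(m, n)) a b :
  mxcontinuous A -> continuous (fun z => A z a b).
Proof. by move=> cA x; exact: (cA x). Qed.

Lemma mxintg_continuous m n y t (A : V -> 'M[R]_(m, n)) :
  mxcontinuous A -> mxcontinuous (mxintg y t A).
Proof.
move=> cA; apply/mxcontinuousP => i j.
have -> : (fun z => mxintg y t A z i j) = intg y t (fun z => A z i j).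
  by apply/funext => z; rewrite mxE.
by apply: intg_continuous; exact: mxcontinuous_entry.
Qed.

Lemma mxintg_mull m n p y t (B : 'M[R]_(m, n)) (A : V -> 'M[R]_(n, p)) z :
  mxcontinuous A -> mxintg y t (fun z => B *m A z) z = B *m mxintg y t A z.
Proof.
move=> cA; apply/matrixP => i j; rewrite !mxE.
have -> : (fun z => (B *m A z) i j) = (fun z => \sum_k B i k * A z k j).
  by apply/funext => z'; rewrite mxE.
rewrite intg_sum; last first.
  by move=> k; apply: continuous_mul; [exact: continuous_cst|exact: mxcontinuous_entry].
apply: eq_bigr => k _; rewrite mxE intgZ//; exact: mxcontinuous_entry.
Qed.

Lemma mxintg_mulr m n p y t (A : V -> 'M[R]_(m, n)) (B : 'M[R]_(n, p)) z :
  mxcontinuous A -> mxintg y t (fun z => A z *m B) z = mxintg y t A z *m B.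
Proof.
move=> cA; apply/matrixP => i j; rewrite !mxE.
have -> : (fun z => (A z *m B) i j) = (fun z => \sum_k B k j * A z i k).
  by apply/funext => z'; rewrite mxE; apply: eq_bigr => k _; rewrite mulrC.
rewrite intg_sum; last first.
  by move=> k; apply: continuous_mul; [exact: continuous_cst|exact: mxcontinuous_entry].
by apply: eq_bigr => k _; rewrite mxE intgZ 1?mulrC//; exact: mxcontinuous_entry.
Qed.

Lemma mxintg_sub m n y t (A B : V -> 'M[R]_(m, n)) z :
  mxcontinuous A -> mxcontinuous B ->
  mxintg y t (fun z => A z - B z) z = mxintg y t A z - mxintg y t B z.
Proof.
move=> cA cB; apply/matrixP => i j; rewrite !mxE -intgB; try exact: mxcontinuous_entry.
by apply: intg_ext => r; rewrite !mxE.
Qed.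

Lemma mxintg_sum (I : Type) (r : seq I) m n y t (A : I -> V -> 'M[R]_(m, n)) z :
  (forall k : I, mxcontinuous (A k)) ->
  mxintg y t (fun z => \sum_(k <- r) A k z) z = \sum_(k <- r) mxintg y t (A k) z.
Proof.
move=> cA; apply/matrixP => i j; rewrite mxE summxE.
have -> : (fun z => (\sum_(k <- r) A k z) i j) = (fun z => \sum_(k <- r) A k z i j).
  by apply/funext => z'; rewrite summxE.
rewrite intg_sum; last by move=> k; exact: mxcontinuous_entry.
by apply: eq_bigr => k _; rewrite mxE.
Qed.

Lemma mxintg_contr y t l G u z : (forall j, mxcontinuous (G j)) ->
  contr l (fun j => mxintg y t (G j)) u z = mxintg y t (contr l G u) z.
Proof.
move=> cG; rewrite /contr mxintg_sum.
  by apply: eq_bigr => j _; rewrite mxintg_mulr.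
by move=> j; apply: mxcontinuous_mul; [exact: cG|exact: mxcontinuous_cst].
Qed.

Lemma contr_continuous l G u : (forall j, mxcontinuous (G j)) -> mxcontinuous (contr l G u).
Proof.
move=> cG; apply: mxcontinuous_sum => j.
by apply: mxcontinuous_mul; [exact: cG|exact: mxcontinuous_cst].
Qed.

Lemma form_continuous (h : V -> 'M[R]_d) (v w : V -> 'cV[R]_d) :
  mxcontinuous h -> mxcontinuous v -> mxcontinuous w ->
  continuous (fun z => form (h z) (v z) (w z)).
Proof.
move=> ch cv cw; apply: mxcontinuous_entry; apply: mxcontinuous_mul => //.
by apply: mxcontinuous_mul => //; exact: mxcontinuous_tr.
Qed.

Lemma c1_metric_inv g G : c1_metric g G -> mxcontinuous (fun z => invmx (g z)).
Proof. by move=> [pg cg _ _ _]; apply: mxcontinuous_inv => // z; exact: posdef_unit. Qed.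

Lemma c1_metric_derive g G j x t : c1_metric g G ->
  is_mxderive (fun r => g (x + r *: 'e_j)) t (G j (x + t *: 'e_j)).
Proof.
move=> [_ _ cG _ FTC] a b.
have -> : (fun r => g (x + r *: 'e_j) a b) =
    (fun r => g x a b + intg j r (fun z => G j z a b) x).
  by apply/funext => r; rewrite -FTC /incr subrKC.
have H : is_derive t 1 (fun r => intg j r (fun z => G j z a b) x) (G j (x + t *: 'e_j) a b).
  by apply: (@is_derive_intg R N j t (fun z => G j z a b)); exact: mxcontinuous_entry.
have := is_deriveD (is_derive_cst (g x a b) t 1) H.
by rewrite add0r.
Qed.

Lemma c1_metric_incr g G j t (v w : 'cV[R]_d) z : c1_metric g G ->
  incr j t (fun z => (v^T *m g z *m w) 0 0) z =
  intg j t (fun z => (v^T *m G j z *m w) 0 0) z.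
Proof.
move=> [_ _ cG _ FTC].
have cvG : mxcontinuous (fun z => v^T *m G j z).
  by apply: mxcontinuous_mul; [exact: mxcontinuous_cst|exact: cG].
have -> : intg j t (fun z => (v^T *m G j z *m w) 0 0) z =
    (v^T *m mxintg j t (G j) z *m w) 0 0.
  by rewrite -mxintg_mull// -mxintg_mulr// mxE.
have -> : mxintg j t (G j) z = g (z + t *: 'e_j) - g z.
  by apply/matrixP => a b; rewrite !mxE -FTC.
by rewrite mulmxBr mulmxBl /incr [RHS]mxE [X in _ = _ + X]mxE.
Qed.

Lemma c1_metric_marginal y t g G : 0 < t -> c1_metric g G ->
  c1_metric (mxintg y t g) (fun j => mxintg y t (G j)).
Proof.
move=> t0 [pg cg cG sG FTC]; split.
- move=> x; split.
    apply/matrixP => a b; rewrite !mxE; apply: intg_ext => r.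
    by rewrite -{1}(proj1 (pg _)) mxE.
  move=> v v0; have -> : form (mxintg y t g x) v v = intg y t (fun z => form (g z) v v) x.
    rewrite /form -mxintg_mull// -mxintg_mulr ?mxE//.
    by apply: mxcontinuous_mul => //; exact: mxcontinuous_cst.
  apply: intg_gt0 => //; first by apply: form_continuous => //; exact: mxcontinuous_cst.
  by move=> z; exact: (proj2 (pg z)).
- exact: mxintg_continuous.
- by move=> j; exact: mxintg_continuous.
- move=> j x; apply/matrixP => a b; rewrite !mxE; apply: intg_ext => r.
  by rewrite -{1}sG mxE.
- move=> j x r a b.
  have -> : (fun z => mxintg y t g z a b) = intg y t (fun z => g z a b).
    by apply/funext => z; rewrite mxE.
  have -> : (fun z => mxintg y t (G j) z a b) = intg y t (fun z => G j z a b).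
    by apply/funext => z; rewrite mxE.
  rewrite incr_intg; last exact: mxcontinuous_entry.
  rewrite intgC; last exact: mxcontinuous_entry.
  by apply: intg_ext => r'; exact: FTC.
Qed.

End WeakNakano.

(** * Integrating out one variable *)

Section MarginalStep.
Variables (R : realType) (N d : nat).
Local Notation V := 'rV[R]_N.
Implicit Types (i j k : 'I_N) (l : seq 'I_N) (x z : V)
  (s : 'I_N -> R) (r e c : R) (u : 'I_N -> 'cV[R]_d).
Local Notation "''e_' i" := (unitv R i) (at level 8, i at level 2).

Variables (y : 'I_N) (l : seq 'I_N) (g : V -> 'M[R]_d) (G : 'I_N -> V -> 'M[R]_d).
Hypotheses (yl : uniq (y :: l)) (gG : c1_metric g G) (wN : weak_nakano (y :: l) g G).

Let cg : mxcontinuous g. Proof. by case: gG. Qed.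
Let cG j : mxcontinuous (G j). Proof. by case: gG. Qed.
Let pg x : posdef (g x). Proof. by case: gG. Qed.
Let sG j x : (G j x)^T = G j x. Proof. by case: gG. Qed.
Let ch : mxcontinuous (fun z => invmx (g z)). Proof. exact: c1_metric_inv gG. Qed.

Let P u := contr l G u.
(** The contraction for the field completed by [w] in the direction [y]. *)
Let Z u (w : 'cV[R]_d) z : 'cV[R]_d := P u z + G y z *m w.

Let cP u : mxcontinuous (P u). Proof. exact: contr_continuous. Qed.
Let cZ u w : mxcontinuous (Z u w).
Proof.
apply: mxcontinuous_add => //; apply: mxcontinuous_mul => //.
exact: mxcontinuous_cst.
Qed.
Let cdot (v : 'cV[R]_d) (A : V -> 'cV[R]_d) :
  mxcontinuous A -> continuous (fun z => (v^T *m A z) 0 0).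
Proof.
move=> cA; apply: mxcontinuous_entry; apply: mxcontinuous_mul => //.
exact: mxcontinuous_cst.
Qed.

(** The right-hand side for the completed field over a slab of thickness [r], minus all flux terms
    containing [w]: the faces orthogonal to [y] contribute [w.Z], and the cross terms
    [u_k.(d_y g) w], turned into increments along [y], contribute [w.P]. *)
Definition slab_rhs u (w : 'cV[R]_d) r z : R :=
  intg y r (fun z => form (invmx (g z)) (Z u w z) (Z u w z)) z
  - incr y r (fun z => (w^T *m (P u z + Z u w z)) 0 0) z.

Lemma slab_rhs_continuous u w r : continuous (slab_rhs u w r).
Proof.
apply: continuous_sub; first by apply: intg_continuous; exact: form_continuous.
by apply: incr_continuous; apply: cdot; exact: mxcontinuous_add.
Qed.

(* A thin slab in the direction [y] is treated with a field whose [y]-component [w]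
   is frozen. *)
Lemma slab_flux u (w : 'cV[R]_d) r s z : 0 < r -> (forall i, i \in l -> 0 < s i) ->
  flux l s (fun k => intg y r (fun z => ((u k)^T *m P u z) 0 0)) z <=
  boxint l s (slab_rhs u w r) z.
Proof.
move=> r0 s0; have /andP[ynl ul] := yl.
(* The box and the field over [l], completed by [r] and [w] in the direction [y]. *)
pose s' i := if i == y then r else s i.
pose u' i := if i == y then w else u i.
have ky k : k \in l -> (k == y) = false.
  by move=> kl; apply: contraNF ynl => /eqP <-.
have s's m f : {subset m <= l} -> boxint m s' f = boxint m s f.
  by move=> ml; apply: eq_boxint => j /ml jl; rewrite /s' ky.
have Pu' : contr (y :: l) G u' = Z u w.
  apply/funext => x; rewrite /contr big_cons /u' eqxx /Z addrC; congr (_ + _).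
  by apply: eq_big_seq => j jl; rewrite ky.
have := @wN u' s' z.
have s'0 i : i \in y :: l -> 0 < s' i.
  by rewrite inE /s'; case: eqP => //= _; exact: s0.
move=> /(_ s'0); rewrite Pu' /flux big_cons /= eqxx.
rewrite {1 2}/s' eqxx s's// {1}/u' eqxx.
have cfZ : continuous (fun z => form (invmx (g z)) (Z u w z) (Z u w z)).
  exact: form_continuous.
rewrite (s's l)// -boxint_intg//.
(* Integrated along [y], the cross term [u_k.(d_y g) w] is an increment of [u_k.g w], and the
   increment of the latter along [k] is an integral of [u_k.(d_k g) w]. Commuting increments thus
   replace equality of mixed derivatives. *)
have E k : k \in l ->
    boxint (if y == k then l else y :: rem k l) s' (incr k (s' k) (fun z => ((u' k)^T *m Z u w z) 0 0)) z =
    boxint (rem k l) s (incr k (s k) (intg y r (fun z => ((u k)^T *m P u z) 0 0))) z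
    + boxint l s (incr y r (fun z => (w^T *m (G k z *m u k)) 0 0)) z.
  move=> kl; rewrite eq_sym ky//= {1}/s' eqxx s's; last by move=> j /mem_rem.
  rewrite {1}/s' /u' ky//.
  have cuP : continuous (fun z => ((u k)^T *m P u z) 0 0) by exact: cdot.
  have cuG : continuous (fun z => ((u k)^T *m G y z *m w) 0 0).
    under eq_fun do rewrite -mulmxA.
    by apply: cdot; apply: mxcontinuous_mul => //; exact: mxcontinuous_cst.
  have cuGk : continuous (fun z => ((u k)^T *m G k z *m w) 0 0).
    under eq_fun do rewrite -mulmxA.
    by apply: cdot; apply: mxcontinuous_mul => //; exact: mxcontinuous_cst.
  have cug : continuous (fun z => ((u k)^T *m g z *m w) 0 0).
    under eq_fun do rewrite -mulmxA.
    by apply: cdot; apply: mxcontinuous_mul => //; exact: mxcontinuous_cst.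
  have -> : (fun z => ((u k)^T *m Z u w z) 0 0) =
      (fun z => ((u k)^T *m P u z) 0 0 + ((u k)^T *m G y z *m w) 0 0).
    by apply/funext => x; rewrite /Z mulmxDr mxE mulmxA.
  rewrite -boxint_intg; last by apply: incr_continuous; exact: continuous_add.
  have -> : intg y r (incr k (s k) (fun z => ((u k)^T *m P u z) 0 0 + ((u k)^T *m G y z *m w) 0 0))
     = fun z => incr k (s k) (intg y r (fun z => ((u k)^T *m P u z) 0 0)) z +
         intg k (s k) (incr y r (fun z => ((u k)^T *m G k z *m w) 0 0)) z.
    apply/funext => x.
    rewrite -incr_intg; last exact: continuous_add.
    have -> : intg y r (fun z => ((u k)^T *m P u z) 0 0 + ((u k)^T *m G y z *m w) 0 0) =
       fun z => intg y r (fun z => ((u k)^T *m P u z) 0 0) z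
         + incr y r (fun z => ((u k)^T *m g z *m w) 0 0) z.
      by apply/funext => x'; rewrite intgD// (c1_metric_incr y r (u k) w x' gG).
    rewrite incrD; congr (_ + _).
    rewrite -incr_intg//.
    have -> : intg k (s k) (fun z => ((u k)^T *m G k z *m w) 0 0) =
      incr k (s k) (fun z => ((u k)^T *m g z *m w) 0 0).
      by apply/funext => x'; rewrite (c1_metric_incr k (s k) (u k) w x' gG).
    rewrite /incr.
    rewrite (_ : x + s k *: 'e_k + r *: 'e_y = x + r *: 'e_y + s k *: 'e_k); first by ring.
    by rewrite addrAC.
  rewrite boxintD; last 2 first.
  - by apply: incr_continuous; exact: intg_continuous.
  - by apply: intg_continuous; exact: incr_continuous.
  congr (_ + _).
  rewrite boxint_intg; last exact: incr_continuous.
  rewrite -boxint_rem//; last exact: incr_continuous.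
  congr boxint; congr incr; apply/funext => x.
  by rewrite -mx11_tr !trmx_mul trmxK sG.
rewrite (eq_big_seq _ E) big_split /= -boxint_sum; last first.
  move=> k; apply: incr_continuous; apply: cdot; apply: mxcontinuous_mul => //.
  exact: mxcontinuous_cst.
have -> : (fun z => \sum_(k <- l) incr y r (fun z => (w^T *m (G k z *m u k)) 0 0) z) =
    incr y r (fun z => (w^T *m P u z) 0 0).
  apply/funext => x; rewrite /incr sumrB; congr (_ - _);
    by rewrite /P /contr mulmx_sumr summxE.
have -> : slab_rhs u w r = fun z =>
    intg y r (fun z => form (invmx (g z)) (Z u w z) (Z u w z)) z
  - (incr y r (fun z => (w^T *m P u z) 0 0) z + incr y r (fun z => (w^T *m Z u w z) 0 0) z).
  apply/funext => x; rewrite /slab_rhs -incrD; congr (_ - incr y r _ x).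
  by apply/funext => x'; rewrite mulmxDr mxE.
have ci (v : 'cV[R]_d) (A : V -> 'cV[R]_d) :
    mxcontinuous A -> continuous (incr y r (fun z => (v^T *m A z) 0 0)).
  by move=> cA; apply: incr_continuous; exact: cdot.
rewrite boxintB; last 2 first.
- exact: intg_continuous.
- by apply: continuous_add; exact: ci.
rewrite boxintD; try exact: ci.
have sy : s' y = r by rewrite /s' eqxx.
move=> H; rewrite lerBrDr; rewrite sy in H; by apply: le_trans H; rewrite [X in _ + X <= _]addrC addrCA.
Qed.

Lemma posdef_marginal t x : 0 < t -> posdef (mxintg y t g x).
Proof. by move=> t0; have [] := c1_metric_marginal y t0 gG. Qed.

(* With [w = g^-1 int_0^y (g F - P)], where [F = gt^-1 Pt], one has
   [P + (d_y g) w = g (F - w')], and the local contributions add up to the integral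
   of [|F|^2_g - |w'|^2_g]. *)
Lemma marginal_bound u t x e : 0 < t -> 0 < e -> exists rhs : V -> R,
  [/\ continuous rhs,
   forall s z, (forall i, i \in l -> 0 < s i) ->
     flux l s (fun k => intg y t (fun z => ((u k)^T *m P u z) 0 0)) z <= boxint l s rhs z &
   rhs x <= form (invmx (mxintg y t g x)) (mxintg y t (P u) x) (mxintg y t (P u) x) + e].
Proof.
move=> t0 e0.
(* [F] is fixed at the single point [x], so [rhs] is compared with the marginal form only there. *)
pose F := invmx (mxintg y t g x) *m mxintg y t (P u) x.
have ut : mxintg y t g x \in unitmx by apply/posdef_unit/posdef_marginal.
pose X r : V := x + r *: 'e_y.
have cgF : mxcontinuous (fun z => g z *m F - P u z).
  apply: mxcontinuous_sub => //.
  by apply: mxcontinuous_mul => //; exact: mxcontinuous_cst.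
pose K r := mxintg y r (fun z => g z *m F - P u z) x.
pose W r := invmx (g (X r)) *m K r.
have K0 : K 0 = 0 by apply/matrixP => i j; rewrite !mxE intg0.
(* This is the choice of [F]: over the full length, the integral of [g F] is that of [P u]. *)
have Kt : K t = 0.
  rewrite /K mxintg_sub ?mxintg_mulr ?mulKVmx ?subrr//.
  by apply: mxcontinuous_mul => //; exact: mxcontinuous_cst.
have dK c : is_mxderive K c (g (X c) *m F - P u (X c)).
  move=> i j; under eq_fun do rewrite mxE.
  apply: (@is_derive_intg R N y c (fun z => (g z *m F - P u z) i j)).
  exact: mxcontinuous_entry.
pose W' c := invmx (g (X c)) *m (g (X c) *m F - P u (X c) - G y (X c) *m W c).
have dW c : is_mxderive W c (W' c).
  apply: (@is_mxderive_solve _ _ _ (fun r => g (X r))); first exact: c1_metric_derive.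
    exact: dK.
  by move=> r; exact: posdef_unit.
have cX (m n : nat) (A : V -> 'M[R]_(m, n)) c : mxcontinuous A ->
    mxcvg (nbhs c) (fun r => A (X r)) (A (X c)).
  move=> cA i j; have := @line1_continuous R N (fun z => A z i j) y x.
  by apply; exact: mxcontinuous_entry.
pose FgF r := intg y r (fun z => form (g z) F F) x.
have cFgF : continuous (fun z => form (g z) F F).
  by apply: form_continuous => //; exact: mxcontinuous_cst.
(* The integral of [|F|^2_g] up to height [r], minus the boundary term of the moving correction
   [W r]; that term vanishes at both ends. *)
pose Phi r := FgF r - ((W r)^T *m (P u (X r) + Z u (W r) (X r))) 0 0.
(* The claim for heights between [a] and [b]. It is additive, and the allowance [e / t] per unit of
   height totals [e] over the full length. *)
pose Q a b := exists rhs : V -> R,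
  [/\ continuous rhs,
   forall s z, (forall i, i \in l -> 0 < s i) ->
     flux l s (fun k z => intg y (b - a) (fun z => ((u k)^T *m P u z) 0 0) (z + a *: 'e_y)) z
       <= boxint l s rhs z &
   rhs x <= Phi b - Phi a + e / t * (b - a)].
have cuP k : continuous (fun z => ((u k)^T *m P u z) 0 0) by exact: cdot.
have cat (a b c : R) : a < b -> b < c -> Q a b -> Q b c -> Q a c.
  move=> ab bc [f [cf f1 f2]] [h [chh h1 h2]].
  exists (fun z => f z + h z); split; first exact: continuous_add.
    move=> s z s0; rewrite boxintD//; apply: le_trans (lerD (f1 s z s0) (h1 s z s0)).
    rewrite -fluxD; last 2 first.
    - by move=> k; apply: translation_continuous; exact: intg_continuous.
    - by move=> k; apply: translation_continuous; exact: intg_continuous.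
    rewrite (eq_flux _ (p' := fun k z => intg y (b - a) (fun z => ((u k)^T *m P u z) 0 0) (z + a *: 'e_y)
      + intg y (c - b) (fun z => ((u k)^T *m P u z) 0 0) (z + b *: 'e_y)))// => k _.
    apply/funext => z'.
    rewrite (_ : c - a = (b - a) + (c - b)); last by ring.
    have Eb : z' + a *: 'e_y + (b - a) *: 'e_y = z' + b *: 'e_y.
      by rewrite -addrA -scalerDl subrKC.
    by rewrite (@intg_cat R N y (b - a) (c - b) _ _ (cuP k)) Eb.
  move: f2 h2; move: (Phi a) (Phi b) (Phi c) (e / t) (f x) (h x).
  by move=> Pa Pb Pc k fx hx; lra.
have loc (c : R) : exists2 del, 0 < del &
     forall a b : R, a <= c -> c <= b -> a < b -> b - a < del -> Q a b.
  pose w := W c.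
  (* With [w] frozen at [W c], the value of [slab_rhs] at height [a] is the increment of [Phi] plus
     that of [Psi]. The derivative of [Psi] at [c] is [D], which turns out to be minus the square
     norm of [W' c], hence at most zero. *)
  pose Psi r := intg y r (fun z => form (invmx (g z)) (Z u w z) (Z u w z)) x - FgF r
    + (((W r - w)^T *m (P u (X r) + Z u w (X r))) 0 0
      + ((W r - w)^T *m (G y (X r) *m W r)) 0 0).
  pose D := form (invmx (g (X c))) (Z u w (X c)) (Z u w (X c)) - form (g (X c)) F F
    + (((W' c)^T *m (P u (X c) + Z u w (X c))) 0 0 + ((W' c)^T *m (G y (X c) *m w)) 0 0).
  have dPsi : is_derive c 1 Psi D.
    apply: is_deriveD.
      apply: is_deriveB; last exact: (@is_derive_intg R N y c _ x cFgF).
      apply: (@is_derive_intg R N y c _ x); exact: form_continuous.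
    have dWw : is_mxderive (fun r => (W r - w)^T) c (W' c)^T.
      apply: is_mxderive_tr; rewrite -[W' c]subr0.
      by apply: is_mxderive_sub; [exact: dW|exact: is_mxderive_cst].
    have W0 : (W c - w)^T = 0 by rewrite subrr trmx0.
    apply: is_deriveD.
      apply: (is_mxderive_mul0 dWw W0 (Z := fun r => P u (X r) + Z u w (X r))).
      by apply: mxcvg_add; exact: cX.
    apply: (is_mxderive_mul0 dWw W0 (Z := fun r => G y (X r) *m W r)).
    by apply: mxcvg_mul; [exact: cX|exact: is_mxderive_cvg (dW c)].
  have D0 : D <= 0.
    have EZ : Z u w (X c) = g (X c) *m (F - W' c).
      rewrite mulmxBr /W' mulKVmx; last exact: posdef_unit.
      by rewrite /Z -/w; rewrite opprB opprB addrA [in RHS]addrC !addrA addrNK addrC.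
    have -> : D = - form (g (X c)) (W' c) (W' c).
      have -> : D = form (invmx (g (X c))) (Z u w (X c)) (Z u w (X c)) - form (g (X c)) F F
          + (((W' c)^T *m Z u w (X c)) 0 0 + ((W' c)^T *m Z u w (X c)) 0 0).
        rewrite /D; congr (_ + _); rewrite {1 2 3}/Z !mulmxDr.
        by rewrite !mxE; ring.
      rewrite EZ form_inv// mulmxA -/(form (g (X c)) (W' c) (F - W' c)).
      rewrite !(formDl, formDr, formNl, formNr) (formC F (W' c) (proj1 (pg _))).
      by ring.
    by rewrite oppr_le0 posdef_ge0.
  have et0 : 0 < e / t by rewrite divr_gt0.
  have [del del0 H] := is_derive_straddle dPsi et0.
  exists del => // a b ac cb ab abd.
  exists (fun z => slab_rhs u w (b - a) (z + a *: 'e_y)); split.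
  - by apply: translation_continuous; exact: slab_rhs_continuous.
  - move=> s z s0; rewrite boxint_shift.
    rewrite (@flux_shift _ _ _ _ (fun k => intg y (b - a) (fun z => ((u k)^T *m P u z) 0 0))).
    by apply: slab_flux => //; rewrite subr_gt0.
  have := H a b ac cb abd; rewrite ler_norml => /andP[_].
  have Dab : D * (b - a) <= 0 by rewrite mulr_le0_ge0// subr_ge0 ltW.
  have cf : continuous (fun z => form (invmx (g z)) (Z u w z) (Z u w z)) by exact: form_continuous.
  pose I r := intg y r (fun z => form (invmx (g z)) (Z u w z) (Z u w z)) x.
  pose wq r := (w^T *m (P u (X r) + Z u w (X r))) 0 0.
  pose q r := ((W r - w)^T *m (P u (X r) + Z u w (X r))) 0 0
      + ((W r - w)^T *m (G y (X r) *m W r)) 0 0.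
  have PsiE r : Psi r = I r - FgF r + q r by [].
  have PhiE r : Phi r = FgF r - (wq r + q r).
    by congr (_ - _); apply: dot_polarize; exact: sG.
  have EX : x + a *: 'e_y + (b - a) *: 'e_y = X b by rewrite -addrA -scalerDl subrKC.
  have -> : slab_rhs u w (b - a) (x + a *: 'e_y) = (I b - I a) - (wq b - wq a).
    rewrite /slab_rhs /incr EX; congr (_ - _).
    have := @intg_cat R N y a (b - a) _ x cf; rewrite subrKC => Eab.
    by rewrite /I Eab addrAC subrr add0r.
  rewrite !PsiE !PhiE.
  move: (I a) (I b) (wq a) (wq b) (q a) (q b) (FgF a) (FgF b) (D * (b - a)) (e / t * (b - a)) Dab.
  by move=> *; lra.
have [f [cf f1 f2]] := cousin cat loc t0.
exists f; split; [exact: cf| |].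
  move=> s z s0; have := f1 s z s0.
  have -> : (fun k z => intg y (t - 0) (fun z => ((u k)^T *m P u z) 0 0) (z + 0 *: 'e_y)) =
      (fun k => intg y t (fun z => ((u k)^T *m P u z) 0 0)).
    by apply/funext => k; apply/funext => z'; rewrite subr0 scale0r addr0.
  exact.
have W0 r : K r = 0 -> Phi r = FgF r.
  by move=> Kr; rewrite /Phi /W Kr mulmx0 trmx0 mul0mx mxE subr0.
have EF : FgF t = form (invmx (mxintg y t g x)) (mxintg y t (P u) x) (mxintg y t (P u) x).
  have pt := posdef_marginal x t0.
  have -> : form (invmx (mxintg y t g x)) (mxintg y t (P u) x) (mxintg y t (P u) x) =
      form (mxintg y t g x) F F by rewrite -(form_inv F F pt) mulKVmx.
  have cF : mxcontinuous (fun z => F^T *m g z).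
    by apply: mxcontinuous_mul => //; exact: mxcontinuous_cst.
  by rewrite /form -mxintg_mull// -mxintg_mulr// mxE.
move: f2; rewrite !W0// EF /FgF intg0 !subr0 divfK//.
by rewrite gt_eqF.
Qed.

(** [marginal_bound] reaches the desired right-hand side at one point; continuity extends the
    comparison to small boxes around it at the cost of [e] times the volume, as [goursat] asks. *)
Lemma weak_nakano_marginal t : 0 < t ->
  weak_nakano l (mxintg y t g) (fun j => mxintg y t (G j)).
Proof.
move=> t0 u s x s0.
have /andP[_ ul] := yl.
have gG' := c1_metric_marginal y t0 gG.
have cq : continuous (fun z => form (invmx (mxintg y t g z)) (mxintg y t (P u) z) (mxintg y t (P u) z)).
  by apply: form_continuous; [exact: c1_metric_inv gG'|exact: mxintg_continuous|exact: mxintg_continuous].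
have EP z : contr l (fun j => mxintg y t (G j)) u z = mxintg y t (P u) z.
  by rewrite mxintg_contr.
have -> : (fun z => form (invmx (mxintg y t g z)) (contr l (fun j => mxintg y t (G j)) u z)
   (contr l (fun j => mxintg y t (G j)) u z)) =
   (fun z => form (invmx (mxintg y t g z)) (mxintg y t (P u) z) (mxintg y t (P u) z)).
  by apply/funext => z; rewrite EP.
have cuP k : continuous (fun z => ((u k)^T *m P u z) 0 0) by exact: cdot.
rewrite (eq_flux _ (p' := fun k => intg y t (fun z => ((u k)^T *m P u z) 0 0))); last first.
  by move=> k _; apply/funext => z; rewrite EP -mxintg_mull// mxE.
apply: goursat => //; first by move=> k; exact: intg_continuous.
move=> {}x e e0.
have e20 : 0 < e / 2 by rewrite divr_gt0.
have [f [cf f1 f2]] := marginal_bound u x t0 e20.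
have cfq : continuous (fun z => f z - form (invmx (mxintg y t g z)) (mxintg y t (P u) z) (mxintg y t (P u) z)).
  exact: continuous_sub.
have /continuous_epsP/(_ x _ e20) := cfq.
move=> /(near_shrink s0); apply: filterS => n H x' xx'.
have sh0 := @shrink_gt0 R N l n s s0.
apply: le_trans (f1 _ _ sh0) _.
rewrite -(boxint_cst l (shrink l n s) e x') -boxintD//; last exact: continuous_cst.
apply: boxint_le => //; first by apply: continuous_add => //; exact: continuous_cst.
  by move=> i /sh0/ltW.
move=> z /(H _ xx') /=; rewrite ler_norml => /andP[_]; move: f2; lra.
Qed.

End MarginalStep.

(** * Integrated and pointwise inequalities *)

Section DifferentiableBase.
Variables (R : realType) (N : nat).
Local Notation V := 'rV[R]_N.
Implicit Types (f g q : V -> R) (i j k : 'I_N) (l : seq 'I_N) (x z v : V)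
  (s : 'I_N -> R) (p : 'I_N -> V -> R) (t r e c : R).
Local Notation "''e_' i" := (unitv R i) (at level 8, i at level 2).

Lemma boxint_approx l s f x c e : continuous f -> uniq l ->
  (forall i, i \in l -> 0 <= s i) ->
  (forall z, in_box l s x z -> `|f z - c| <= e) ->
  `|boxint l s f x - c * volume l s| <= e * volume l s.
Proof.
move=> cf ul s0 H; rewrite ler_norml -mulNr.
have H1 : boxint l s f x <= (c + e) * volume l s.
  rewrite -(boxint_cst l s _ x); apply: boxint_le => //; first exact: continuous_cst.
  by move=> z /H; rewrite ler_norml => /andP[]; lra.
have H2 : (c - e) * volume l s <= boxint l s f x.
  rewrite -(boxint_cst l s _ x); apply: boxint_le => //; first exact: continuous_cst.
  by move=> z /H; rewrite ler_norml => /andP[]; lra.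
by move: H1 H2; rewrite mulrBl mulrDl; lra.
Qed.

Lemma differentiable_approx f x e : differentiable f x -> 0 < e ->
  \forall z \near x, `|f z - f x - 'd f x (z - x)| <= e * `|z - x|.
Proof.
move=> df e0; have /eqaddoP/(_ e e0) K := diff_locally df.
have sh : (fun z => z - x) z @[z --> x] --> (0 : V).
  have : continuous (fun z : V => z - x).
    by apply: continuous_sub; [exact: continuous_idfun|exact: continuous_cst].
  by move=> /(_ x); rewrite /continuous_at subrr.
near=> z.
have : `|(f \o shift x - (cst (f x) + 'd f x)) (z - x)| <= e * `|z - x|.
  by near: z; exact: (sh _ K).
by rewrite !fctE /= subrK opprD addrA.
Unshelve. all: by end_near. Qed.

Lemma norm_le_entries (h : V) b : 0 <= b -> (forall i, `|h 0 i| <= b) -> `|h| <= b.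
Proof.
move=> b0 H; rewrite /Num.Def.normr/= mx_normrE (bigmax_le _ b0)// => -[i j] _.
by rewrite (ord1 i); exact: H.
Qed.

(** Differentiability at the one point [x] gives an affine approximation on the whole box with error
    small compared with its size, and the size is at most a fixed multiple of the side [k], as all
    sides shrink by the same factor. Two such errors enter each increment. *)
Lemma flux_term_approx l k s f x e : continuous f -> differentiable f x ->
  uniq l -> k \in l -> (forall i, i \in l -> 0 < s i) -> 0 < e ->
  \forall n \near \oo, forall x', in_box l (shrink l n s) x' x ->
    `|boxint (rem k l) (shrink l n s) (incr k (shrink l n s k) f) x' -
      'D_('e_k) f x * volume l (shrink l n s)| <= e * volume l (shrink l n s).
Proof.
move=> cf df ul kl s0 e0.
pose M := \sum_(i <- l) s i + 1.
have sM i : i \in l -> s i <= M.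
  move=> il; rewrite /M (perm_big _ (perm_to_rem il)) big_cons /= -addrA lerDl.
  rewrite addr_ge0// big_seq; apply: sumr_ge0 => j /mem_rem jl; exact/ltW/s0.
have M0 : 0 < M.
  by rewrite /M ltr_wpDl// big_seq; apply: sumr_ge0 => j jl; exact/ltW/s0.
have sk0 := s0 _ kl.
(* Chosen so that [eta] times [M / 2 ^+ n], which bounds the size of the box, is [e * w k / 2]. *)
pose eta := e * s k / (2 * M).
have eta0 : 0 < eta by rewrite divr_gt0// mulr_gt0.
have := near_shrink s0 (differentiable_approx df eta0).
apply: filterS => n H x' xx'.
pose w := shrink l n s; rewrite -/w in H xx' *.
have w0 := @shrink_gt0 R N l n s s0.
have wM i : i \in l -> w i <= M / 2 ^+ n.
  by move=> il; rewrite /w /shrink il ler_wpM2r ?invr_ge0 ?exprn_ge0// sM.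
have close z : in_box l w x' z -> `|f z - f x - 'd f x (z - x)| <= e * w k / 2.
  move=> zz; apply: (le_trans (H _ xx' z zz)).
  have -> : e * w k / 2 = eta * (M / 2 ^+ n).
    rewrite /eta /w /shrink kl; field.
    by rewrite expf_neq0 ?pnatr_eq0// gt_eqF.
  apply: ler_wpM2l; first exact: ltW.
  apply: norm_le_entries.
    by rewrite divr_ge0 ?ltW// exprn_gt0.
  case: xx' zz => [h1 h2] [h3 h4] i; rewrite !mxE.
  have [il|il] := boolP (i \in l); last first.
    by rewrite h2// h4// subrr normr0 divr_ge0 ?ltW// exprn_gt0.
  by have := h1 _ il; have := h3 _ il; have := wM _ il; rewrite ler_norml; lra.
rewrite (volume_rem w kl) !mulrA; apply: boxint_approx.
- exact: incr_continuous.
- exact: rem_uniq.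
- by move=> i /mem_rem/w0/ltW.
move=> z [z1 z2].
have zb r : 0 <= r <= w k -> in_box l w x' (z + r *: 'e_k).
  move=> rw; split => i il; rewrite !mxE eqxx /=.
    have [ik|ik] := eqVneq i k.
      by rewrite ik z2 ?mem_rem_uniq ?inE ?eqxx// mulr1; lra.
    by rewrite mulr0 addr0; apply: z1; rewrite mem_rem_uniq// inE ik.
  have ik : i != k by apply: contraNneq il => ->.
  rewrite (negbTE ik) mulr0 addr0; apply: z2.
  by apply: contra il => /mem_rem.
have wk0 : 0 <= w k by apply/ltW/w0.
have := close _ (zb 0 _); rewrite scale0r addr0 lexx wk0 => /(_ erefl) c1.
have := close _ (zb (w k) _); rewrite lexx wk0 => /(_ erefl) c2.
have E : 'd f x (z + w k *: 'e_k - x) = 'd f x (z - x) + 'D_('e_k) f x * w k.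
  by rewrite addrAC linearD linearZ /= -(deriveE 'e_k df) [_ *: _]mulrC.
move: c1 c2; rewrite E /incr !ler_norml; move: (e * w k) ('D_('e_k) f x * w k) => a b.
by move=> /andP[? ?] /andP[? ?]; lra.
Qed.

Lemma flux_approx l s p x e : (forall k, continuous (p k)) ->
  (forall k, k \in l -> differentiable (p k) x) ->
  uniq l -> (forall i, i \in l -> 0 < s i) -> 0 < e ->
  \forall n \near \oo, forall x', in_box l (shrink l n s) x' x ->
    `|flux l (shrink l n s) p x' -
      (\sum_(k <- l) 'D_('e_k) (p k) x) * volume l (shrink l n s)|
    <= e * volume l (shrink l n s).
Proof.
move=> cp dp ul s0 e0.
pose e' := e / (size l).+1%:R.
have e'0 : 0 < e' by rewrite divr_gt0.
have H : \forall n \near \oo, forall k, k \in l -> forall x', in_box l (shrink l n s) x' x ->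
    `|boxint (rem k l) (shrink l n s) (incr k (shrink l n s k) (p k)) x' -
      'D_('e_k) (p k) x * volume l (shrink l n s)| <= e' * volume l (shrink l n s).
  apply: filter_forall => k; have [kl|kl] := boolP (k \in l); last exact: nearW.
  have := flux_term_approx (cp k) (dp k kl) ul kl s0 e'0.
  by apply: filterS => n h _.
apply: filterS H => n H x' xx'.
rewrite /flux mulr_suml -sumrB; apply: (le_trans (ler_norm_sum _ _ _)).
have v0 : 0 <= volume l (shrink l n s).
  by apply: volume_ge0 => i il; apply/ltW; exact: shrink_gt0.
apply: (@le_trans _ _ (\sum_(k <- l) e' * volume l (shrink l n s))).
  by rewrite big_seq [leRHS]big_seq; apply: ler_sum => k kl; exact: H.
rewrite big_const_seq count_predT iter_addr_0 -mulr_natl mulrA ler_wpM2r// /e' mulrCA ler_piMr ?(ltW e0)//.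
by rewrite ler_pdivrMr// mul1r ler_nat.
Qed.

Lemma le_of_approx (a b : R) : (forall e, 0 < e -> a <= b + e) -> a <= b.
Proof. by move=> H; apply/ler_addgt0Pr => e; exact: H. Qed.

(** Over boxes with corner [x] shrinking to [x], both sides divided by the volume tend to the two
    sides of the pointwise inequality. *)
Lemma pointwise_of_flux l s p q x : uniq l -> (forall i, i \in l -> 0 < s i) ->
  (forall k, continuous (p k)) -> (forall k, k \in l -> differentiable (p k) x) ->
  continuous q ->
  (forall s', (forall i, i \in l -> 0 < s' i) -> flux l s' p x <= boxint l s' q x) ->
  \sum_(k <- l) 'D_('e_k) (p k) x <= q x.
Proof.
move=> ul s0 cp dp cq H; apply: le_of_approx => e e0.
have e20 : 0 < e / 2 by rewrite divr_gt0.
have /continuous_epsP/(_ x _ e20) := cq; move=> /(near_shrink s0) N1.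
have N2 := flux_approx cp dp ul s0 e20.
have [n [h1 h2]] := filter_ex (filterI N1 N2).
have sh0 := @shrink_gt0 R N l n s s0.
have shw i : i \in l -> 0 <= shrink l n s i by move=> /sh0/ltW.
have xx : in_box l (shrink l n s) x x by exact: in_box_refl.
have v0 : 0 < volume l (shrink l n s).
  by rewrite /volume big_seq; apply: prodr_gt0 => i; exact: sh0.
have A3 : boxint l (shrink l n s) q x <= (q x + e / 2) * volume l (shrink l n s).
  rewrite -(boxint_cst l (shrink l n s) _ x); apply: boxint_le => //.
    exact: continuous_cst.
  by move=> z /(h1 _ xx) /=; rewrite ler_norml => /andP[_]; lra.
have := h2 _ xx; rewrite ler_norml => /andP[A1 _].
have A2 := H _ sh0.
rewrite -(ler_pM2r v0); move: A1 A2 A3; rewrite !mulrDl; lra.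
Qed.

(** On small boxes around a point both sides are the pointwise quantities times the volume, up to a
    small multiple of the volume; [goursat] sums these local estimates, so the divergence is never
    integrated. *)
Lemma flux_of_pointwise l s p q : uniq l -> (forall i, i \in l -> 0 < s i) ->
  (forall k, continuous (p k)) -> (forall k x, k \in l -> differentiable (p k) x) ->
  continuous q -> (forall x, \sum_(k <- l) 'D_('e_k) (p k) x <= q x) ->
  forall x, flux l s p x <= boxint l s q x.
Proof.
move=> ul s0 cp dp cq H; apply: goursat => // x e e0.
have e20 : 0 < e / 2 by rewrite divr_gt0.
have /continuous_epsP/(_ x _ e20) := cq; move=> /(near_shrink s0) N1.
have N2 := flux_approx cp (dp ^~ x) ul s0 e20.
apply: filterS2 N1 N2 => n h1 h2 x' xx'.
have shw i : i \in l -> 0 <= shrink l n s i by move=> il; exact/ltW/shrink_gt0.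
have v0 : 0 <= volume l (shrink l n s) by exact: volume_ge0.
have A3 : (q x - e / 2) * volume l (shrink l n s) <= boxint l (shrink l n s) q x'.
  rewrite -(boxint_cst l (shrink l n s) _ x'); apply: boxint_le => //.
    exact: continuous_cst.
  by move=> z /(h1 _ xx') /=; rewrite ler_norml => /andP[]; lra.
have := h2 _ xx'; rewrite ler_norml => /andP[_ A1].
have := ler_wpM2r v0 (H x).
move: A1 A3; rewrite !mulrBl; lra.
Qed.

Lemma is_derive_line f i x t : differentiable f (x + t *: 'e_i) ->
  is_derive t 1 (fun r : R => f (x + r *: 'e_i)) ('D_('e_i) f (x + t *: 'e_i)).
Proof.
move=> df.
have E : (fun h : R => h^-1 *: (f (x + (h *: 1 + t) *: 'e_i) - f (x + t *: 'e_i))) =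
    (fun h : R => h^-1 *: (f (h *: 'e_i + (x + t *: 'e_i)) - f (x + t *: 'e_i))).
  apply/funext => h; congr (_ *: (f _ - _)).
  by rewrite [h *: 1]mulr1 scalerDl addrCA.
have D := diff_derivable (v := 'e_i) df.
split; first by rewrite /derivable E.
by rewrite /derive E.
Qed.

Lemma incr_intg_derive f i x t : (forall z, differentiable f z) ->
  continuous ('D_('e_i) f) -> incr i t f x = intg i t ('D_('e_i) f) x.
Proof.
move=> df cD; have := @intg_unique R N i t _ x (fun r => f (x + r *: 'e_i)) cD
  (fun r => is_derive_line (df _)).
by rewrite scale0r addr0.
Qed.

Lemma differentiable_cont f : (forall z, differentiable f z) -> continuous f.
Proof. by move=> df z; exact: differentiable_continuous. Qed.

(** The second increment of [f] is the integral along [j] of the increment along [i] of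
    ['D_('e_j) f], that is, a single flux term over a square, to which [flux_term_approx]
    applies. *)
Lemma second_derivative_incr f i j x e : i != j -> (forall z, differentiable f z) ->
  (forall z, differentiable ('D_('e_j) f) z) -> 0 < e ->
  \forall n \near \oo, `|incr i (1 / 2 ^+ n) (incr j (1 / 2 ^+ n) f) x -
     'D_('e_i) ('D_('e_j) f) x * (1 / 2 ^+ n) ^+ 2| <= e * (1 / 2 ^+ n) ^+ 2.
Proof.
move=> ij df dfj e0; pose l := [:: i; j]; pose s := fun _ : 'I_N => 1 : R.
have ul : uniq l by rewrite /= inE ij.
have s0 k : k \in l -> 0 < s k by rewrite ltr01.
have cfj := differentiable_cont dfj.
have := flux_term_approx cfj (dfj x) ul (mem_head _ _) s0 e0.
apply: filterS => n H.
have sh (k : 'I_N) : k \in l -> shrink l n s k = 1 / 2 ^+ n by rewrite /shrink => ->.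
have il : i \in l by rewrite mem_head.
have jl : j \in l by rewrite /l !inE eqxx orbT.
have := H x (in_box_refl _ (fun k kl => ltW (shrink_gt0 n s0 kl))).
rewrite /= eqxx /= /volume /l !big_cons big_nil mulr1 -/l !sh// -expr2.
have -> : intg j (1 / 2 ^+ n) (incr i (1 / 2 ^+ n) ('D_('e_j) f)) x =
   incr i (1 / 2 ^+ n) (incr j (1 / 2 ^+ n) f) x.
  rewrite -incr_intg//; congr incr; apply/funext => z.
  by rewrite incr_intg_derive.
exact.
Qed.

(** Increments commute, and by [second_derivative_incr] both mixed derivatives are limits of the
    same second increment divided by the square of the step. *)
Lemma mixed_derivatives f i j x : (forall z, differentiable f z) ->
  (forall k z, differentiable ('D_('e_k) f) z) ->
  'D_('e_i) ('D_('e_j) f) x = 'D_('e_j) ('D_('e_i) f) x.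
Proof.
move=> df ddf; have [->//|ij] := eqVneq i j.
have C a b : incr i a (incr j b f) x = incr j b (incr i a f) x.
  by rewrite /incr (_ : x + a *: 'e_i + b *: 'e_j = x + b *: 'e_j + a *: 'e_i) 1?addrAC//; ring.
have E e : 0 < e -> `|'D_('e_i) ('D_('e_j) f) x - 'D_('e_j) ('D_('e_i) f) x| <= 0 + e.
  move=> e0; have e20 : 0 < e / 2 by rewrite divr_gt0.
  have ji : j != i by rewrite eq_sym.
  have N1 := second_derivative_incr x ij df (ddf j) e20.
  have N2 := second_derivative_incr x ji df (ddf i) e20.
  have [n [h1 h2]] := filter_ex (filterI N1 N2).
  have t0 : 0 < (1 / 2 ^+ n) ^+ 2 :> R by rewrite exprn_gt0// divr_gt0// exprn_gt0.
  rewrite add0r; rewrite -(ler_pM2r t0) -(gtr0_norm t0) -normrM (gtr0_norm t0).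
  move: h1 h2; rewrite C; move: (incr j _ _ x) ((1 / 2 ^+ n) ^+ 2) => a b.
  move: ('D_('e_i) ('D_('e_j) f) x) ('D_('e_j) ('D_('e_i) f) x) => p q.
  rewrite !ler_norml !mulrBl => /andP[? ?] /andP[? ?]; apply/andP; split; lra.
by apply/eqP; rewrite -subr_eq0 -normr_le0; apply: le_of_approx.
Qed.

End DifferentiableBase.

(** * Limits of metrics *)

Section DominatedLimits.
Variables (R : realType) (N : nat).
Local Notation V := 'rV[R]_N.
Implicit Types (i j k : 'I_N) (l : seq 'I_N) (x z : V) (s : 'I_N -> R)
  (F : nat -> V -> R) (f : V -> R) (t e : R).
Local Notation "''e_' i" := (unitv R i) (at level 8, i at level 2).

(** A continuous bound common to all [n] is integrable over each segment, as dominated convergence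
    requires, and yields a continuous bound again after translation, multiplication and
    integration. *)
Definition dominated F := exists2 C : V -> R, continuous C & forall n z, `|F n z| <= C z.

Lemma dominated_cst (c : V -> R) : continuous c -> dominated (fun=> c).
Proof.
move=> cc; exists (fun z => `|c z|) => //.
by apply: (@continuous_compose _ _ _ (fun r : R => `|r|)) => //; exact: norm_continuous.
Qed.

Lemma dominated_add F F' : dominated F -> dominated F' ->
  dominated (fun n z => F n z + F' n z).
Proof.
move=> [C cC H] [C' cC' H']; exists (fun z => C z + C' z); first exact: continuous_add.
by move=> n z; apply: (le_trans (ler_normD _ _)); exact: lerD.
Qed.

Lemma dominated_mul F F' : dominated F -> dominated F' ->
  dominated (fun n z => F n z * F' n z).
Proof.
move=> [C cC H] [C' cC' H']; exists (fun z => C z * C' z); first exact: continuous_mul.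
by move=> n z; rewrite normrM; exact: ler_pM.
Qed.

Lemma dominated_sum (I : Type) (r : seq I) (F : I -> nat -> V -> R) :
  (forall a, dominated (F a)) -> dominated (fun n z => \sum_(a <- r) F a n z).
Proof.
move=> dF; elim: r => [|a r IH].
  rewrite (_ : (fun _ _ => _) = (fun=> cst 0)); last first.
    by apply/funext => n; apply/funext => z; rewrite big_nil.
  by apply: dominated_cst; exact: continuous_cst.
rewrite (_ : (fun _ _ => _) = (fun n z => F a n z + \sum_(b <- r) F b n z)).
  exact: dominated_add.
by apply/funext => n; apply/funext => z; rewrite big_cons.
Qed.

Lemma dominated_shift F v : dominated F -> dominated (fun n z => F n (z + v)).
Proof.
move=> [C cC H]; exists (fun z => C (z + v)); first exact: translation_continuous.
by move=> n z; exact: H.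
Qed.

Lemma dominated_opp F : dominated F -> dominated (fun n z => - F n z).
Proof. by move=> [C cC H]; exists C => // n z; rewrite normrN. Qed.

Lemma dominated_incr F i t : dominated F -> dominated (fun n => incr i t (F n)).
Proof.
by move=> dF; exact: (dominated_add (dominated_shift (t *: 'e_i) dF) (dominated_opp dF)).
Qed.

Lemma dominated_intg F i t : 0 <= t -> (forall n, continuous (F n)) ->
  dominated F -> dominated (fun n => intg i t (F n)).
Proof.
move=> t0 cF [C cC H]; exists (intg i t C); first exact: intg_continuous.
move=> n z; rewrite ler_norml; apply/andP; split.
  rewrite -mulN1r -intgZ//; apply: intg_le => //.
    by apply: continuous_mul => //; exact: continuous_cst.
  by move=> r _; rewrite mulN1r; have := H n (z + r *: 'e_i); rewrite ler_norml => /andP[].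
apply: intg_le => // r _.
by have := H n (z + r *: 'e_i); rewrite ler_norml => /andP[].
Qed.

Lemma cvg_intg F f i t x : 0 <= t -> (forall n, continuous (F n)) -> continuous f ->
  dominated F -> (forall z, F n z @[n --> \oo] --> f z) ->
  intg i t (F n) x @[n --> \oo] --> intg i t f x.
Proof.
move=> t0 cF cf [C cC H] Ff.
have E (h : V -> R) : continuous h ->
    intg i t h x = \int[lebesgue_measure]_(r in `[0, t]) h (x + r *: 'e_i).
  by move=> ch; rewrite /intg prim_int//; exact: line1_continuous.
have I (h : V -> R) : continuous h ->
    lebesgue_measure.-integrable `[0, t] (EFin \o (fun r : R => h (x + r *: 'e_i))).
  move=> ch; apply: continuous_compact_integrable; first exact: segment_compact.
  by apply: continuous_subspaceT; exact: line1_continuous.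
rewrite E//; under eq_fun do rewrite E//.
apply: fine_cvg; rewrite fineK; last exact: integrable_fin_num (I _ cf).
have [] := @dominated_convergence _ _ _ lebesgue_measure `[0, t] _
  (fun n r => (F n (x + r *: 'e_i))%:E) (fun r => (f (x + r *: 'e_i))%:E)
  (fun r => (C (x + r *: 'e_i))%:E).
- exact: measurable_itv.
- by move=> n; exact: measurable_int (I _ (cF n)).
- exact: measurable_int (I _ cf).
- by apply: aeW => r _; apply: cvg_EFin; [exact: nearW|exact: Ff].
- exact: I.
- by apply: aeW => r n _; rewrite lee_fin.
by [].
Qed.

Lemma dominated_boxint F l s : (forall i, i \in l -> 0 <= s i) ->
  (forall n, continuous (F n)) -> dominated F -> dominated (fun n => boxint l s (F n)).
Proof.
move=> s0 cF dF; elim: l s0 => //= i l IH s0; apply: dominated_intg.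
- by apply: s0; rewrite mem_head.
- by move=> n; exact: boxint_continuous.
- by apply: IH => j jl; apply: s0; rewrite inE jl orbT.
Qed.

Lemma cvg_boxint F f l s x : (forall i, i \in l -> 0 <= s i) ->
  (forall n, continuous (F n)) -> continuous f ->
  dominated F -> (forall z, F n z @[n --> \oo] --> f z) ->
  boxint l s (F n) x @[n --> \oo] --> boxint l s f x.
Proof.
move=> s0 cF cf dF Ff; elim: l x s0 => [|i l IH] x s0 /=; first exact: Ff.
have s0' j : j \in l -> 0 <= s j by move=> jl; apply: s0; rewrite inE jl orbT.
apply: cvg_intg.
- by apply: s0; rewrite mem_head.
- by move=> n; exact: boxint_continuous.
- exact: boxint_continuous.
- exact: dominated_boxint.
- by move=> z; exact: IH.
Qed.

Lemma cvg_flux (p : nat -> 'I_N -> V -> R) (p0 : 'I_N -> V -> R) l s x :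
  (forall i, i \in l -> 0 <= s i) ->
  (forall n k, continuous (p n k)) -> (forall k, continuous (p0 k)) ->
  (forall k, dominated (fun n => p n k)) ->
  (forall k z, p n k z @[n --> \oo] --> p0 k z) ->
  flux l s (p n) x @[n --> \oo] --> flux l s p0 x.
Proof.
move=> s0 cp cp0 dp pp0; apply: cvg_big => [|k _]; first exact: add_continuous.
apply: cvg_boxint.
- by move=> i /mem_rem; exact: s0.
- by move=> n; exact: incr_continuous.
- exact: incr_continuous.
- exact: dominated_incr.
- by move=> z; apply: cvgB; exact: pp0.
Qed.

Definition mxdominated m n (A : nat -> V -> 'M[R]_(m, n)) :=
  forall a b, dominated (fun o z => A o z a b).

Lemma mxdominated_mul m n p (A : nat -> V -> 'M[R]_(m, n)) (B : nat -> V -> 'M[R]_(n, p)) :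
  mxdominated A -> mxdominated B -> mxdominated (fun o z => A o z *m B o z).
Proof.
move=> dA dB a b.
rewrite (_ : (fun _ _ => _) = (fun o z => \sum_c A o z a c * B o z c b)).
  by apply: dominated_sum => c; exact: dominated_mul.
by apply/funext => o; apply/funext => z; rewrite mxE.
Qed.

Lemma mxdominated_cst m n (A : 'M[R]_(m, n)) : mxdominated (fun _ _ => A).
Proof. by move=> a b; apply: dominated_cst; exact: continuous_cst. Qed.

Lemma mxdominated_tr m n (A : nat -> V -> 'M[R]_(m, n)) :
  mxdominated A -> mxdominated (fun o z => (A o z)^T).
Proof.
move=> dA a b; rewrite (_ : (fun _ _ => _) = (fun o z => A o z b a))//.
by apply/funext => o; apply/funext => z; rewrite mxE.
Qed.

Lemma mxdominated_sum (I : Type) (r : seq I) m n (A : I -> nat -> V -> 'M[R]_(m, n)) :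
  (forall c, mxdominated (A c)) -> mxdominated (fun o z => \sum_(c <- r) A c o z).
Proof.
move=> dA a b; rewrite (_ : (fun _ _ => _) = (fun o z => \sum_(c <- r) A c o z a b)).
  by apply: dominated_sum => c; exact: dA.
by apply/funext => o; apply/funext => z; rewrite summxE.
Qed.

Lemma dominated_form n (h : nat -> V -> 'M[R]_n) (v w : nat -> V -> 'cV[R]_n) :
  mxdominated h -> mxdominated v -> mxdominated w ->
  dominated (fun o z => form (h o z) (v o z) (w o z)).
Proof.
move=> dh dv dw.
apply: (mxdominated_mul (A := fun o z => (v o z)^T *m h o z)) dw 0 0.
by apply: mxdominated_mul => //; exact: mxdominated_tr.
Qed.

Lemma mxdominated_form n (A : nat -> V -> 'M[R]_n) :
  (forall o z, (A o z)^T = A o z) ->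
  (forall v, dominated (fun o z => form (A o z) v v)) -> mxdominated A.
Proof.
move=> sA dA a b; pose c := @form_entries R n.
rewrite (_ : (fun _ _ => _) = (fun o z => (form (A o z) (delta_mx a 0 + delta_mx b 0) (delta_mx a 0 + delta_mx b 0)
   + - form (A o z) (delta_mx a 0) (delta_mx a 0) + - form (A o z) (delta_mx b 0) (delta_mx b 0)) * 2^-1)).
  apply: dominated_mul; last by apply: dominated_cst; exact: continuous_cst.
  by apply: dominated_add; [apply: dominated_add => //|]; exact: dominated_opp.
by apply/funext => o; apply/funext => z; rewrite form_entries.
Qed.

End DominatedLimits.

Lemma mxcvg_form (R : realType) n (A : nat -> 'M[R]_n) (A0 : 'M[R]_n) :
  (forall k, (A k)^T = A k) -> A0^T = A0 ->
  (forall v, form (A k) v v @[k --> \oo] --> form A0 v v) -> mxcvg \oo A A0.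
Proof.
move=> sA sA0 H i j; rewrite form_entries//; under eq_fun do rewrite form_entries//.
by apply: cvgMl; apply: cvgB => //; exact: cvgB.
Qed.

(* Pointwise limits of convex functions: the slopes converge where the limit is
   differentiable. *)
Lemma cvg_slopes (R : realType) (F : nat -> R -> R) (f : R -> R) (D : nat -> R) (d : R) :
  (forall n r, 0 < r -> F n 0 - F n (- r) <= D n * r <= F n r - F n 0) ->
  (forall r, F n r @[n --> \oo] --> f r) -> is_derive (0 : R) 1 f d ->
  D n @[n --> \oo] --> d.
Proof.
move=> HD Ff /is_derive_epsP df; apply/cvgrPdist_le => e e0.
have e20 : 0 < e / 2 by rewrite divr_gt0.
have /nbhs_ballP[b /= b0 Hb] := df _ e20.
pose r := b / 2; have r0 : 0 < r by rewrite divr_gt0.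
have rb : r < b by rewrite /r ltr_pdivrMr// ltr_pMr// ltrDl.
have /Hb h1 : ball 0 b r by rewrite /ball/= sub0r normrN gtr0_norm.
have /Hb h2 : ball 0 b (- r) by rewrite /ball/= sub0r !normrN gtr0_norm.
(* At distance [r] the slope of [f] deviates from [d] by at most [e / 2], and replacing [f] by [F n]
   at two points adds twice [e / 4 * r] to the increment. *)
have er0 : 0 < e / 4 * r by rewrite mulr_gt0// divr_gt0.
have /cvgrPdist_le/(_ _ er0) n0 := Ff 0.
have /cvgrPdist_le/(_ _ er0) n1 := Ff r.
have /cvgrPdist_le/(_ _ er0) n2 := Ff (- r).
near=> n.
have k0 : `|f 0 - F n 0| <= e / 4 * r by near: n.
have k1 : `|f r - F n r| <= e / 4 * r by near: n.
have k2 : `|f (- r) - F n (- r)| <= e / 4 * r by near: n.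
have /andP[l1 l2] := HD n _ r0.
have E2 : e / 2 * r = 2 * (e / 4 * r) by field.
have E4 : e * r = 4 * (e / 4 * r) by field.
rewrite -(ler_pM2r r0) -[X in `|_| * X](gtr0_norm r0) -normrM E4 mulrBl.
move: h1 h2; rewrite /= !add0r normrN (gtr0_norm r0) mulrN E2.
move: k0 k1 k2 l1 l2.
move: (F n 0) (F n r) (F n (- r)) (D n * r) (f 0) (f r) (f (- r)) (d * r) (e / 4 * r).
clear=> a1 a2 a3 a4 a5 a6 a7 a8 a9; rewrite !ler_norml.
move=> /andP[? ?] /andP[? ?] /andP[? ?] ? ? /andP[? ?] /andP[? ?].
by apply/andP; split; lra.
Unshelve. all: by end_near. Qed.

Section MarginalLimit.
Variables (R : realType) (N d : nat).
Local Notation V := 'rV[R]_N.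
Implicit Types (i j k : 'I_N) (l : seq 'I_N) (x z : V) (s : 'I_N -> R) (t r e c : R).
Local Notation "''e_' i" := (unitv R i) (at level 8, i at level 2).

Lemma is_mxderive_inv_line (g : V -> 'M[R]_d) G k x (v : 'cV[R]_d) r : c1_metric g G ->
  is_mxderive (fun r => invmx (g (x + r *: 'e_k)) *m v) r
    (- (invmx (g (x + r *: 'e_k)) *m (G k (x + r *: 'e_k) *m (invmx (g (x + r *: 'e_k)) *m v)))).
Proof.
move=> gG; rewrite -mulmxN -sub0r.
apply: (@is_mxderive_solve _ _ _ (fun r => g (x + r *: 'e_k)) (fun=> v)).
- exact: c1_metric_derive.
- exact: is_mxderive_cst.
- by move=> t; apply: posdef_unit; case: gG.
Qed.

Lemma is_derive_inv_form (g : V -> 'M[R]_d) G k x (v : 'cV[R]_d) r : c1_metric g G ->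
  is_derive r 1 (fun r => form (invmx (g (x + r *: 'e_k))) v v)
    (- form (G k (x + r *: 'e_k)) (invmx (g (x + r *: 'e_k)) *m v) (invmx (g (x + r *: 'e_k)) *m v)).
Proof.
move=> gG; have [pg _ _ _ _] := gG.
have H := is_mxderive_inv_line k x v r gG.
have E z : form (invmx (g z)) v v = \sum_a v a 0 * (invmx (g z) *m v) a 0.
  by rewrite /form -mulmxA mxE; apply: eq_bigr => a _; rewrite mxE.
under eq_fun do rewrite E.
have -> : - form (G k (x + r *: 'e_k)) (invmx (g (x + r *: 'e_k)) *m v) (invmx (g (x + r *: 'e_k)) *m v)
  = \sum_a v a 0 * (- (invmx (g (x + r *: 'e_k)) *m (G k (x + r *: 'e_k) *m (invmx (g (x + r *: 'e_k)) *m v)))) a 0.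
  transitivity (- (v^T *m (invmx (g (x + r *: 'e_k)) *m (G k (x + r *: 'e_k) *m (invmx (g (x + r *: 'e_k)) *m v)))) 0 0).
    by rewrite /form trmx_mul inv_sym ?mulmxA//; case: (pg (x + r *: 'e_k)).
  by rewrite [in LHS]mxE -sumrN; apply: eq_bigr => a _; rewrite [in RHS]mxE [in LHS]mxE mulrN.
apply: is_derive_bigsum => a.
exact: is_deriveZ (H a 0).
Qed.

(* Nakano log concavity in one direction makes [v^T g^-1 v] convex along it. *)
Lemma inv_form_convex (g : V -> 'M[R]_d) G k x (v : 'cV[R]_d) (a b : R) :
  c1_metric g G -> weak_nakano [:: k] g G -> a < b ->
  form (G k (x + b *: 'e_k)) (invmx (g (x + b *: 'e_k)) *m v) (invmx (g (x + b *: 'e_k)) *m v) <=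
  form (G k (x + a *: 'e_k)) (invmx (g (x + a *: 'e_k)) *m v) (invmx (g (x + a *: 'e_k)) *m v).
Proof.
move=> gG wN ab; have [pg cg cG sG _] := gG.
pose X r : V := x + r *: 'e_k.
pose w r := invmx (g (X r)) *m v.
pose q r := form (G k (X r)) (w r) (w r).
rewrite -/(X a) -/(X b) -/(w a) -/(w b) -/(q a) -/(q b).
suff key e : 0 < e -> forall a b : R, a < b -> q b <= q a + e * (b - a).
  apply: le_of_approx => e e0; have ba0 : 0 < b - a by rewrite subr_gt0.
  have e'0 : 0 < e / (b - a) by rewrite divr_gt0.
  by have := key _ e'0 a b ab; rewrite divfK// gt_eqF.
have dw c : is_mxderive w c (- (invmx (g (X c)) *m (G k (X c) *m w c))).
  exact: is_mxderive_inv_line.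
move=> e0' {a b ab}.
apply: (@cousin _ (fun a b => q b <= q a + e * (b - a))).
  by move=> a b c _ _ h1 h2; lra.
(* The weak inequality for the constant vector [u] bounds the increment of [u.(G k) u] by that of
   [I], and [Q] accounts for the motion of [w]. At [c] the derivative of [I + Q] is [D - 2 D], hence
   at most zero. *)
move=> c; pose u := w c.
have cf : continuous (fun z => form (invmx (g z)) (G k z *m u) (G k z *m u)).
  by apply: form_continuous; first exact: c1_metric_inv gG;
    apply: mxcontinuous_mul => //; exact: mxcontinuous_cst.
pose I r := intg k r (fun z => form (invmx (g z)) (G k z *m u) (G k z *m u)) x.
pose Q r := ((w r - u)^T *m (G k (X r) *m u)) 0 0 + ((w r - u)^T *m (G k (X r) *m w r)) 0 0.
pose D := form (invmx (g (X c))) (G k (X c) *m u) (G k (X c) *m u).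
have dQ : is_derive c 1 (fun r => I r + Q r) (D + (- D + - D)).
  apply: is_deriveD; first exact: (@is_derive_intg R N k c _ x cf).
  have dWw : is_mxderive (fun r => (w r - u)^T) c (- (invmx (g (X c)) *m (G k (X c) *m u)))^T.
    have := is_mxderive_sub (dw c) (is_mxderive_cst u c); rewrite subr0.
    exact: is_mxderive_tr.
  have W0 : (w c - u)^T = 0 by rewrite subrr trmx0.
  have cX : mxcvg (nbhs c) (fun r => G k (X r)) (G k (X c)).
    move=> i j; have := @line1_continuous R N (fun z => G k z i j) k x.
    by apply; exact: mxcontinuous_entry.
  have ED : - D = ((- (invmx (g (X c)) *m (G k (X c) *m u)))^T *m (G k (X c) *m u)) 0 0.
    rewrite linearN /= mulNmx [in RHS]mxE trmx_mul inv_sym//; exact: (pg _).1.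
  rewrite ED; apply: is_deriveD.
    apply: (is_mxderive_mul0 dWw W0 (Z := fun r => G k (X r) *m u)).
    by apply: mxcvg_mul; [exact: cX|exact: mxcvg_cst].
  apply: (is_mxderive_mul0 dWw W0 (Z := fun r => G k (X r) *m w r)).
  by apply: mxcvg_mul; [exact: cX|exact: is_mxderive_cvg (dw c)].
have [del del0 H] := is_derive_straddle dQ e0'.
exists del => // a b ac cb ab abd.
have := H a b ac cb abd; rewrite ler_norml => /andP[_].
have D0 : 0 <= D by exact: form_inv_ge0.
have qE r : q r = (u^T *m (G k (X r) *m u)) 0 0 + Q r.
  have := dot_polarize 0 u (w r) (sG k (X r)); rewrite !add0r => <-.
  by rewrite /q /form mulmxA.
have ba0 : 0 < b - a by rewrite subr_gt0.
have /= := wN (fun=> u) (fun=> b - a) (X a) (fun _ _ => ba0).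
have -> : contr [:: k] G (fun=> u) = fun z => G k z *m u.
  by apply/funext => z; rewrite /contr big_seq1.
rewrite /flux big_seq1 /= eqxx /=.
have Xab : X a + (b - a) *: 'e_k = X b by rewrite /X -addrA -scalerDl subrKC.
rewrite /incr Xab.
have := @intg_cat R N k a (b - a) _ x cf; rewrite subrKC -/(I b) -/(I a) -/(X a) => ->.
have Dab : 0 <= D * (b - a) by rewrite mulr_ge0// subr_ge0 ltW.
rewrite !qE mulrDl mulrDl mulNr.
move: (intg _ _ _ (X a)) (I a) (Q a) (Q b) (D * (b - a)) (e * (b - a)) Dab.
move: ((u^T *m (G k (X a) *m u)) 0 0) ((u^T *m (G k (X b) *m u)) 0 0).
by move=> *; lra.
Qed.

End MarginalLimit.

Section WeakNakanoLimit.
Variables (R : realType) (N d : nat).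
Local Notation V := 'rV[R]_N.
Implicit Types (i j k : 'I_N) (l : seq 'I_N) (x z : V) (s : 'I_N -> R) (t r e c : R)
  (v : 'cV[R]_d).
Local Notation "''e_' i" := (unitv R i) (at level 8, i at level 2).

(** The mean value theorem expresses both increments by derivatives on either side of [x], and these
    are monotone by [inv_form_convex]. *)
Lemma inv_form_slopes (g : V -> 'M[R]_d) G k x v r :
  c1_metric g G -> weak_nakano [:: k] g G -> 0 < r ->
  form (invmx (g x)) v v - form (invmx (g (x - r *: 'e_k))) v v <=
    - form (G k x) (invmx (g x) *m v) (invmx (g x) *m v) * r <=
  form (invmx (g (x + r *: 'e_k))) v v - form (invmx (g x)) v v.
Proof.
move=> gG wN r0.
pose f t := form (invmx (g (x + t *: 'e_k))) v v.
pose q t := form (G k (x + t *: 'e_k)) (invmx (g (x + t *: 'e_k)) *m v) (invmx (g (x + t *: 'e_k)) *m v).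
have df t : is_derive t 1 f (- q t) by exact: is_derive_inv_form.
have q_le a b : a <= b -> q b <= q a.
  by rewrite le_eqVlt => /predU1P[->//|ab]; exact: inv_form_convex.
have f0 : f 0 = form (invmx (g x)) v v by rewrite /f scale0r addr0.
have q0 : q 0 = form (G k x) (invmx (g x) *m v) (invmx (g x) *m v).
  by rewrite /q scale0r addr0.
have fN : f (- r) = form (invmx (g (x - r *: 'e_k))) v v by rewrite /f scaleNr.
rewrite -fN -f0 -q0 -/(f r).
have Nr0 : - r <= 0 by rewrite oppr_le0 ltW.
have [a /andP[_ a0] Ea] := mean_value df Nr0.
have [b /andP[b0 _] Eb] := mean_value df (ltW r0).
rewrite Ea Eb sub0r subr0 opprK !mulNr !lerN2.
by apply/andP; split; rewrite ler_pM2r// q_le.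
Qed.

Variables (gL : nat -> V -> 'M[R]_d) (GL : nat -> 'I_N -> V -> 'M[R]_d).
Variables (g : V -> 'M[R]_d) (G : 'I_N -> V -> 'M[R]_d).
Hypotheses (gGL : forall L, c1_metric (gL L) (GL L))
  (wN : forall L l, uniq l -> weak_nakano l (gL L) (GL L))
  (gG : c1_metric g G)
  (gL_cvg : forall z, mxcvg \oo (gL ^~ z) (g z))
  (gL_ge : forall L z v, form (gL 0 z) v v <= form (gL L z) v v)
  (gL_le : forall L z v, form (gL L z) v v <= form (g z) v v).

Let pgL L z : posdef (gL L z). Proof. by case: (gGL L). Qed.
Let pg z : posdef (g z). Proof. by case: gG. Qed.
Let sGL L k z : (GL L k z)^T = GL L k z. Proof. by case: (gGL L). Qed.
Let sG k z : (G k z)^T = G k z. Proof. by case: gG. Qed.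
Let hL L z := invmx (gL L z).
Let h z := invmx (g z).
(** [g^-1 (d_k g) g^-1] is minus the derivative of [g^-1] along [k]; its quadratic forms are, up to
    sign, slopes of convex functions. Convergence and bounds are proved for it and carried over to
    the gradient by multiplying with the metric on both sides. *)
Let AL k L z := hL L z *m GL L k z *m hL L z.
Let A k z := h z *m G k z *m h z.

Let shL L z : (hL L z)^T = hL L z. Proof. by apply: inv_sym; case: (pgL L z). Qed.
Let sh z : (h z)^T = h z. Proof. by apply: inv_sym; case: (pg z). Qed.

Let form_AL k L z v : form (AL k L z) v v = form (GL L k z) (hL L z *m v) (hL L z *m v).
Proof. by rewrite /form trmx_mul shL /AL !mulmxA. Qed.

Let form_A k z v : form (A k z) v v = form (G k z) (h z *m v) (h z *m v).
Proof. by rewrite /form trmx_mul sh /A !mulmxA. Qed.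

Let hL_cvg z : mxcvg \oo (hL ^~ z) (h z).
Proof. by apply: mxcvg_inv => //; exact: posdef_unit. Qed.

Let AL_cvg k z : mxcvg \oo (AL k ^~ z) (A k z).
Proof.
apply: mxcvg_form.
- by move=> L; rewrite /AL !trmx_mul shL sGL mulmxA.
- by rewrite /A !trmx_mul sh sG mulmxA.
move=> v; rewrite form_A -[X in _ --> X]opprK; under eq_fun do rewrite form_AL -[form _ _ _]opprK.
apply: cvgN.
apply: (@cvg_slopes _ (fun L r => form (hL L (z + r *: 'e_k)) v v)
  (fun r => form (h (z + r *: 'e_k)) v v)).
- move=> L r r0; rewrite scale0r addr0 scaleNr.
  by apply: inv_form_slopes => //; exact: wN.
- by move=> r; apply: cvg_form; [exact: hL_cvg| |]; exact: mxcvg_cst.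
have := is_derive_inv_form k z v 0 gG; by rewrite scale0r addr0.
Qed.

Let gL_dom : mxdominated gL.
Proof.
apply: mxdominated_form; first by move=> L z; case: (pgL L z).
move=> v; exists (fun z => form (g z) v v).
  by apply: form_continuous; [case: gG|exact: mxcontinuous_cst|exact: mxcontinuous_cst].
by move=> L z; rewrite ger0_norm ?posdef_ge0.
Qed.

Let h0_continuous v : continuous (fun z => form (hL 0 z) v v).
Proof.
apply: form_continuous; [exact: c1_metric_inv (gGL 0)| |]; exact: mxcontinuous_cst.
Qed.

Let hL_le L z v : form (hL L z) v v <= form (hL 0 z) v v.
Proof. exact: form_inv_antitone. Qed.

Let hL_dom : mxdominated hL.
Proof.
apply: mxdominated_form => // v; exists (fun z => form (hL 0 z) v v) => //.
by move=> L z; rewrite ger0_norm ?form_inv_ge0.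
Qed.

(** Slopes are bracketed by increments over a step of length one. The forms of [hL L] are
    nonnegative and, [gL 0] being the smallest metric, at most those of [hL 0], whose values at
    [z + 'e_k] and [z - 'e_k] therefore bound the slope. *)
Let AL_dom k : mxdominated (AL k).
Proof.
apply: mxdominated_form; first by move=> L z; rewrite /AL !trmx_mul shL sGL mulmxA.
move=> v; exists (fun z => form (hL 0 (z + 'e_k)) v v + form (hL 0 (z - 'e_k)) v v).
  have c0 := @h0_continuous v.
  exact: (continuous_add (@translation_continuous R N _ ('e_k) c0)
    (@translation_continuous R N _ (- 'e_k) c0)).
move=> L z; rewrite form_AL.
have := @inv_form_slopes (gL L) (GL L) k z v 1 (gGL L) (@wN L [:: k] isT) ltr01.
rewrite scale1r mulr1 => /andP[h1 h2].
have := form_inv_ge0 v (pgL L z).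
have := form_inv_ge0 v (pgL L (z + 'e_k)); have := form_inv_ge0 v (pgL L (z - 'e_k)).
have := hL_le L (z + 'e_k) v; have := hL_le L (z - 'e_k) v.
rewrite ler_norml; move: h1 h2; rewrite -!/(hL _ _).
move: (form (hL L z) v v) (form (hL L (z + 'e_k)) v v) (form (hL L (z - 'e_k)) v v).
move: (form (hL 0 (z + 'e_k)) v v) (form (hL 0 (z - 'e_k)) v v) (form (GL _ _ _) _ _).
by move=> *; lra.
Qed.

Let GLE k L z : GL L k z = gL L z *m AL k L z *m gL L z.
Proof.
have u := posdef_unit (pgL L z).
by rewrite /AL !mulmxA mulmxV// mul1mx mulmxKV.
Qed.

Let GE k z : G k z = g z *m A k z *m g z.
Proof.
have u := posdef_unit (pg z).
by rewrite /A !mulmxA mulmxV// mul1mx mulmxKV.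
Qed.

Let GL_cvg k z : mxcvg \oo (fun L => GL L k z) (G k z).
Proof.
rewrite GE; rewrite (_ : (fun _ => _) = (fun L => gL L z *m AL k L z *m gL L z)); last first.
  by apply/funext => L; exact: GLE.
by apply: mxcvg_mul => //; exact: mxcvg_mul.
Qed.

Let GL_dom k : mxdominated (fun L => GL L k).
Proof.
rewrite (_ : (fun _ => _) = (fun L z => gL L z *m AL k L z *m gL L z)); last first.
  by apply/funext => L; apply/funext => z; exact: GLE.
by apply: mxdominated_mul => //; exact: mxdominated_mul.
Qed.

(** Metrics, inverses and gradients all converge pointwise under continuous bounds, so dominated
    convergence over boxes applies to both sides. *)
Lemma weak_nakano_limit l : uniq l -> weak_nakano l g G.
Proof.
move=> ul u s x s0.
have cGL L k : mxcontinuous (GL L k) by case: (gGL L).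
have cG k : mxcontinuous (G k) by case: gG.
have Pc z : mxcvg \oo (fun L => contr l (GL L) u z) (contr l G u z).
  by apply: mxcvg_sum => j; apply: mxcvg_mul => //; exact: mxcvg_cst.
have Pd : mxdominated (fun L => contr l (GL L) u).
  apply: mxdominated_sum => j.
  by apply: mxdominated_mul; [exact: GL_dom|exact: mxdominated_cst].
have fc z : form (hL L z) (contr l (GL L) u z) (contr l (GL L) u z) @[L --> \oo] -->
    form (h z) (contr l G u z) (contr l G u z).
  exact: cvg_form.
have fd : dominated (fun L z => form (hL L z) (contr l (GL L) u z) (contr l (GL L) u z)).
  exact: dominated_form.
have s0' i : i \in l -> 0 <= s i by move=> il; exact/ltW/s0.
apply: (@ler_cvg_to _ \oo _ _
  (fun L => flux l s (fun k z => ((u k)^T *m contr l (GL L) u z) 0 0) x)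
  (fun L => boxint l s (fun z => form (hL L z) (contr l (GL L) u z) (contr l (GL L) u z)) x)).
- have cc (H : 'I_N -> V -> 'M[R]_d) k : (forall k, mxcontinuous (H k)) ->
      continuous (fun z => ((u k)^T *m contr l H u z) 0 0).
    move=> cH; apply: mxcontinuous_entry; apply: mxcontinuous_mul.
      exact: mxcontinuous_cst.
    exact: contr_continuous.
  apply: (@cvg_flux R N (fun L k z => ((u k)^T *m contr l (GL L) u z) 0 0)
    (fun k z => ((u k)^T *m contr l G u z) 0 0)) => //.
  + by move=> L k; exact: cc.
  + by move=> k; exact: cc.
  + by move=> k; exact: (mxdominated_mul (mxdominated_cst _ (u k)^T) Pd 0 0).
  + move=> k z.
    have H : mxcvg \oo (fun L => (u k)^T *m contr l (GL L) u z) ((u k)^T *m contr l G u z).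
      by apply: mxcvg_mul => //; exact: mxcvg_cst.
    exact: (H 0 0).
- apply: (@cvg_boxint R N
    (fun L z => form (hL L z) (contr l (GL L) u z) (contr l (GL L) u z))
    (fun z => form (h z) (contr l G u z) (contr l G u z))) => //.
    by move=> L; apply: form_continuous; [exact: c1_metric_inv (gGL L)| |];
      exact: contr_continuous.
  by apply: form_continuous; [exact: c1_metric_inv gG| |]; exact: contr_continuous.
- by apply: nearW => L; exact: wN.
Qed.

End WeakNakanoLimit.

(** * Twice differentiable metrics *)

Section DifferentiableMetrics.
Variables (R : realType) (N d : nat).
Local Notation V := 'rV[R]_N.
Implicit Types (i j k : 'I_N) (l : seq 'I_N) (x z v : V) (s : 'I_N -> R) (t r e c : R)
  (g : V -> 'M[R]_d) (u : 'I_N -> 'cV[R]_d).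
Local Notation "''e_' i" := (unitv R i) (at level 8, i at level 2).

Definition mxdiff m n (A : V -> 'M[R]_(m, n)) x :=
  forall a b, differentiable (fun z => A z a b) x.

Definition mxderive m n v (A : V -> 'M[R]_(m, n)) x : 'M[R]_(m, n) :=
  \matrix_(a, b) 'D_v (fun z => A z a b) x.

Lemma derive_bigsum (I : Type) (r : seq I) (F : I -> V -> R) x v :
  (forall a, differentiable (F a) x) ->
  differentiable (fun z => \sum_(a <- r) F a z) x /\
  'D_v (fun z => \sum_(a <- r) F a z) x = \sum_(a <- r) 'D_v (F a) x.
Proof.
move=> dF; elim: r => [|a r [IH1 IH2]].
  rewrite (_ : (fun _ => _) = cst 0); last by apply/funext => z; rewrite big_nil.
  by split; [exact: differentiable_cst|rewrite derive_cst big_nil].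
rewrite (_ : (fun _ => _) = F a \+ (fun z => \sum_(b <- r) F b z)); last first.
  by apply/funext => z; rewrite big_cons.
split; first exact: differentiableD.
by rewrite big_cons -IH2 deriveD//; exact: diff_derivable.
Qed.

Lemma derive_scale (f : V -> R) c x v : differentiable f x ->
  differentiable (fun z => c * f z) x /\ 'D_v (fun z => c * f z) x = c * 'D_v f x.
Proof.
move=> df; split; first exact: (differentiableZ c df).
exact: (deriveZ c (diff_derivable df)).
Qed.

Lemma mxderive_mull m n p v (B : 'M[R]_(m, n)) (A : V -> 'M[R]_(n, p)) x : mxdiff A x ->
  mxdiff (fun z => B *m A z) x /\ mxderive v (fun z => B *m A z) x = B *m mxderive v A x.
Proof.
move=> dA.
have E a b : (fun z => (B *m A z) a b) = (fun z => \sum_c B a c * A z c b).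
  by apply/funext => z; rewrite mxE.
have H a b := @derive_bigsum _ (index_enum 'I_n) (fun (c : 'I_n) z => B a c * A z c b) x v
  (fun c : 'I_n => (derive_scale (B a c) v (dA c b)).1).
split; first by move=> a b; rewrite E; exact: (H a b).1.
apply/matrixP => a b; rewrite !mxE E (H a b).2; apply: eq_bigr => c _.
by rewrite mxE (derive_scale (B a c) v (dA c b)).2.
Qed.

Lemma mxderive_mulr m n p v (A : V -> 'M[R]_(m, n)) (B : 'M[R]_(n, p)) x : mxdiff A x ->
  mxdiff (fun z => A z *m B) x /\ mxderive v (fun z => A z *m B) x = mxderive v A x *m B.
Proof.
move=> dA.
have E a b : (fun z => (A z *m B) a b) = (fun z => \sum_c B c b * A z a c).
  by apply/funext => z; rewrite mxE; apply: eq_bigr => o _; rewrite mulrC.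
have H a b := @derive_bigsum _ (index_enum 'I_n) (fun (c : 'I_n) z => B c b * A z a c) x v
  (fun c : 'I_n => (derive_scale (B c b) v (dA a c)).1).
split; first by move=> a b; rewrite E; exact: (H a b).1.
apply/matrixP => a b; rewrite !mxE E (H a b).2; apply: eq_bigr => c _.
by rewrite mxE mulrC (derive_scale (B c b) v (dA a c)).2.
Qed.

Lemma mxderive_sum (I : Type) (r : seq I) m n v (A : I -> V -> 'M[R]_(m, n)) x :
  (forall a, mxdiff (A a) x) ->
  mxdiff (fun z => \sum_(a <- r) A a z) x /\
  mxderive v (fun z => \sum_(a <- r) A a z) x = \sum_(a <- r) mxderive v (A a) x.
Proof.
move=> dA.
have E a b : (fun z => (\sum_(o <- r) A o z) a b) = (fun z => \sum_(o <- r) A o z a b).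
  by apply/funext => z; rewrite summxE.
have H a b := @derive_bigsum _ r (fun o z => A o z a b) x v (fun o => dA o a b).
split; first by move=> a b; rewrite E; exact: (H a b).1.
apply/matrixP => a b; rewrite mxE E (H a b).2 summxE; apply: eq_bigr => c _.
by rewrite mxE.
Qed.

Lemma mxdiff_continuous m n (A : V -> 'M[R]_(m, n)) :
  (forall x, mxdiff A x) -> mxcontinuous A.
Proof.
move=> dA; apply/mxcontinuousP => a b.
by apply: differentiable_cont => x; exact: dA.
Qed.

Definition grad g j : V -> 'M[R]_d := mxderive 'e_j g.

Definition twice_mxdiff g :=
  (forall x, mxdiff g x) /\ (forall j x, mxdiff (grad g j) x).

(* [g *m Theta_jk], where the inner derivative is along [j]. *)
Definition curvature g j k x : 'M[R]_d :=
  mxderive 'e_k (grad g j) x - grad g k x *m invmx (g x) *m grad g j x.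

Lemma derive_entry m n v (A : V -> 'M[R]_(m, n)) a b x :
  'D_v (fun z => A z a b) x = mxderive v A x a b.
Proof. by rewrite mxE. Qed.

Lemma grad_continuous g j : twice_mxdiff g -> mxcontinuous (grad g j).
Proof. by move=> [_ ddg]; exact: mxdiff_continuous. Qed.

Lemma grad_sym g j x : (forall x, (g x)^T = g x) -> (grad g j x)^T = grad g j x.
Proof.
move=> sg; apply/matrixP => a b; rewrite mxE /grad /mxderive [in LHS]mxE [in RHS]mxE.
rewrite (_ : (fun z => g z b a) = (fun z => g z a b))//.
by apply/funext => z; rewrite -{1}sg mxE.
Qed.

(** Transposition exchanges [j] and [k] in the quadratic term, and [mixed_derivatives] does so for
    the second derivatives. For hermitian metrics this symmetry makes the Nakano sum real. *)
Lemma curvature_sym g j k x : twice_mxdiff g -> (forall x, (g x)^T = g x) ->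
  (curvature g j k x)^T = curvature g k j x.
Proof.
move=> dg sg; rewrite /curvature.
have -> (A B : 'M[R]_d) : (A - B)^T = A^T - B^T by rewrite linearB.
rewrite trmx_mul (trmx_mul (grad g k x)) (grad_sym k x sg) (grad_sym j x sg) (inv_sym (sg x)) mulmxA.
congr (_ - _).
apply/matrixP => a b; rewrite [LHS]mxE [LHS]mxE [RHS]mxE.
have E i (o p : 'I_d) : (fun z => grad g i z o p) = 'D_('e_i) (fun z => g z o p).
  by apply/funext => z; rewrite mxE.
rewrite !E (_ : (fun z => g z b a) = (fun z => g z a b)); last first.
  by apply/funext => z; rewrite -{1}sg mxE.
apply: mixed_derivatives; first by move=> z; exact: dg.1.
by move=> i z; have := dg.2 i z a b; rewrite E.
Qed.

Lemma c1_metric_grad g : twice_mxdiff g -> (forall x, posdef (g x)) ->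
  c1_metric g (grad g).
Proof.
move=> dg pg; split => //.
- by apply: mxdiff_continuous; case: dg.
- by move=> j; exact: grad_continuous.
- by move=> j x; apply: grad_sym => z; case: (pg z).
move=> j x t a b; rewrite incr_intg_derive.
- by apply: intg_ext => r; rewrite mxE.
- by move=> z; exact: dg.1.
rewrite (_ : 'D_('e_j) _ = (fun z => grad g j z a b)).
  by apply: mxcontinuous_entry; exact: grad_continuous.
by apply/funext => z; rewrite mxE.
Qed.

Lemma contr_derive g l u k x : twice_mxdiff g ->
  differentiable (fun z => ((u k)^T *m contr l (grad g) u z) 0 0) x /\
  'D_('e_k) (fun z => ((u k)^T *m contr l (grad g) u z) 0 0) x =
    \sum_(j <- l) ((u k)^T *m mxderive 'e_k (grad g j) x *m u j) 0 0.
Proof.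
move=> [_ ddg].
have H j := mxderive_mulr 'e_k (u j) (ddg j x).
have [H1 H2] := mxderive_sum l 'e_k (fun j => (H j).1).
have [H3 H4] := mxderive_mull 'e_k (u k)^T H1.
split; first exact: (H3 0 0).
rewrite derive_entry H4 H2 mulmx_sumr summxE.
by apply: eq_bigr => j _; rewrite (H j).2 mulmxA.
Qed.

(** The vectors [u k] being constant, the divergence meets only second derivatives of [g], while the
    form expands into the terms with [grad g k x *m invmx (g x) *m grad g j x]. *)
Lemma curvature_sum g l u x : twice_mxdiff g -> (forall x, posdef (g x)) ->
  \sum_(k <- l) 'D_('e_k) (fun z => ((u k)^T *m contr l (grad g) u z) 0 0) x -
  form (invmx (g x)) (contr l (grad g) u x) (contr l (grad g) u x) =
  \sum_(j <- l) \sum_(k <- l) ((u k)^T *m curvature g j k x *m u j) 0 0.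
Proof.
move=> dg pg; rewrite [RHS]exchange_big /=.
have -> : form (invmx (g x)) (contr l (grad g) u x) (contr l (grad g) u x) =
    \sum_(k <- l) \sum_(j <- l)
      ((u k)^T *m (grad g k x *m invmx (g x) *m grad g j x) *m u j) 0 0.
  rewrite /form {1}/contr (linear_sum (@trmx R d 1)) /= !mulmx_suml summxE.
  apply: eq_bigr => k _; rewrite /contr mulmx_sumr summxE; apply: eq_bigr => j _.
  rewrite trmx_mul grad_sym ?mulmxA// => z; by case: (pg z).
rewrite -sumrB; apply: eq_bigr => k _.
rewrite (contr_derive l u k x dg).2 -sumrB; apply: eq_bigr => j _.
by rewrite /curvature mulmxBr mulmxBl [RHS]mxE [X in _ = _ + X]mxE.
Qed.

Definition real_nakano g := forall x u,
  \sum_j \sum_k ((u k)^T *m curvature g j k x *m u j) 0 0 <= 0.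

Lemma weak_nakano_grad g l : twice_mxdiff g -> (forall x, posdef (g x)) ->
  real_nakano g -> uniq l -> weak_nakano l g (grad g).
Proof.
move=> dg pg ng ul u s x s0.
have gG := c1_metric_grad dg pg.
have cP : mxcontinuous (contr l (grad g) u).
  by apply: contr_continuous => j; exact: grad_continuous.
apply: flux_of_pointwise => //.
- move=> k; apply: mxcontinuous_entry; apply: mxcontinuous_mul => //.
  exact: mxcontinuous_cst.
- by move=> k z _; exact: (contr_derive l u k z dg).1.
- by apply: form_continuous => //; exact: c1_metric_inv gG.
move=> z; rewrite -subr_le0 curvature_sum//.
(* Extension by zero reduces the directions in [l] to the full family. *)
pose u' j := if j \in l then u j else 0.
apply: le_trans (ng z u'); rewrite le_eqVlt; apply/orP; left; apply/eqP.
have E (F : 'I_N -> R) : (forall j, j \notin l -> F j = 0) -> \sum_j F j = \sum_(j <- l) F j.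
  move=> F0; rewrite [RHS](big_uniq _ ul) /= [LHS](bigID (mem l)) /= [X in _ + X]big1 ?addr0//.
rewrite E; last first.
  move=> j jl; rewrite big1// => k _; rewrite {2}/u' (negbTE jl).
  by rewrite mulmx0 mxE.
apply: eq_big_seq => j jl; rewrite E; last first.
  by move=> k kl; rewrite {1}/u' (negbTE kl) trmx0 !mul0mx mxE.
by apply: eq_big_seq => k kl; rewrite /u' kl jl.
Qed.

Lemma real_nakano_of_weak g : twice_mxdiff g -> (forall x, posdef (g x)) ->
  weak_nakano (index_enum 'I_N) g (grad g) -> real_nakano g.
Proof.
move=> dg pg wN x u.
have gG := c1_metric_grad dg pg.
have cP : mxcontinuous (contr (index_enum 'I_N) (grad g) u).
  by apply: contr_continuous => j; exact: grad_continuous.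
rewrite -curvature_sum// subr_le0.
apply: (@pointwise_of_flux R N _ (fun=> 1) _
  (fun z => form (invmx (g z)) (contr (index_enum 'I_N) (grad g) u z) (contr (index_enum 'I_N) (grad g) u z))) => //.
- exact: index_enum_uniq.
- move=> k; apply: mxcontinuous_entry; apply: mxcontinuous_mul => //.
  exact: mxcontinuous_cst.
- by move=> k _; exact: (contr_derive _ u k x dg).1.
- by apply: form_continuous => //; exact: c1_metric_inv gG.
by move=> s s0; exact: wN.
Qed.

End DifferentiableMetrics.

(** * Restriction along coordinate embeddings *)

Section Pullback.
Variables (R : realType) (N m : nat) (phi : 'rV[R]_m -> 'rV[R]_N) (iota : 'I_m -> 'I_N).
Hypotheses (iota_inj : injective iota) (phi_continuous : continuous phi)
  (phi_line : forall t (r : R) k, phi (t + r *: unitv R k) = phi t + r *: unitv R (iota k)).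
Implicit Types (f : 'rV[R]_N -> R) (l : seq 'I_m) (t : 'rV[R]_m) (r : R).

Lemma intg_pullback f k r t : intg k r (fun t => f (phi t)) t = intg (iota k) r f (phi t).
Proof. by rewrite /intg; congr prim; apply/funext => a; rewrite phi_line. Qed.

Lemma incr_pullback f k r t : incr k r (fun t => f (phi t)) t = incr (iota k) r f (phi t).
Proof. by rewrite /incr phi_line. Qed.

Lemma boxint_pullback f l s s' t : (forall k, s' (iota k) = s k) ->
  boxint l s (fun t => f (phi t)) t = boxint (map iota l) s' f (phi t).
Proof.
move=> ss'; elim: l t => //= k l IH t.
by rewrite -intg_pullback ss'; apply: intg_ext => r; exact: IH.
Qed.

Lemma flux_pullback (p : 'I_m -> 'rV[R]_m -> R) (p' : 'I_N -> 'rV[R]_N -> R) l s s' t :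
  (forall k, s' (iota k) = s k) -> (forall k t, p k t = p' (iota k) (phi t)) ->
  flux l s p t = flux (map iota l) s' p' (phi t).
Proof.
move=> ss' pp'; rewrite /flux big_map; apply: eq_bigr => k _.
rewrite ss'.
have -> : rem (iota k) (map iota l) = map iota (rem k l).
  elim: l => //= j l IH; rewrite (inj_eq iota_inj); case: eqP => //= _.
  by rewrite IH.
rewrite -(boxint_pullback _ _ _ ss'); congr boxint; apply/funext => z.
rewrite -incr_pullback; congr incr; apply/funext => y; exact: pp'.
Qed.

Lemma extend_along (T : Type) (x0 : T) (s : 'I_m -> T) :
  exists s' : 'I_N -> T, forall k, s' (iota k) = s k.
Proof.
exists (fun i => if [pick k | iota k == i] is Some k then s k else x0) => k.
by case: pickP => [j /eqP/iota_inj ->//|/(_ k)]; rewrite eqxx.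
Qed.

Lemma c1_metric_pullback d (g : 'rV[R]_N -> 'M[R]_d) G : c1_metric g G ->
  c1_metric (fun t => g (phi t)) (fun k t => G (iota k) (phi t)).
Proof.
have cphi e (A : 'rV[R]_N -> 'M[R]_e) : mxcontinuous A -> mxcontinuous (fun t => A (phi t)).
  move=> cA; apply/mxcontinuousP => a b.
  apply: (continuous_compose (f := fun z => A z a b)) => //.
  exact: mxcontinuous_entry.
move=> [pg cg cG sG FTC]; split => //.
- exact: cphi.
- by move=> k; exact: cphi.
move=> k t r a b.
rewrite (incr_pullback (fun z => g z a b)) FTC.
by rewrite -(intg_pullback (fun z => G (iota k) z a b)).
Qed.

Lemma weak_nakano_pullback d (g : 'rV[R]_N -> 'M[R]_d) G l :
  weak_nakano (map iota l) g G ->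
  weak_nakano l (fun t => g (phi t)) (fun k t => G (iota k) (phi t)).
Proof.
move=> wN u s t s0.
have [s' ss'] := extend_along 1 s; have [u' uu'] := extend_along 0 u.
have s'0 i : i \in map iota l -> 0 < s' i.
  by move=> /mapP[k kl ->]; rewrite ss' s0.
have E x : contr l (fun k t => G (iota k) (phi t)) u x = contr (map iota l) G u' (phi x).
  by rewrite /contr big_map; apply: eq_bigr => j _; rewrite uu'.
have := wN u' s' (phi t) s'0.
rewrite -(@flux_pullback (fun k t => ((u k)^T *m contr l (fun k t => G (iota k) (phi t)) u t) 0 0) _ l s)//; last first.
  by move=> k x; rewrite uu' E.
rewrite -(boxint_pullback _ l t ss').
move=> /le_trans; apply; rewrite le_eqVlt; apply/orP; left; apply/eqP.
by congr boxint; apply/funext => x; rewrite E.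
Qed.

End Pullback.

(** * Marginals over boxes, one variable at a time *)

Section BoxMarginals.
Variables (R : realType) (N d : nat).
Local Notation V := 'rV[R]_N.
Implicit Types (g : V -> 'M[R]_d) (G : 'I_N -> V -> 'M[R]_d) (ys l : seq 'I_N)
  (s : 'I_N -> R).

Definition mxbox ys s g z : 'M[R]_d := \matrix_(a, b) boxint ys s (fun z => g z a b) z.

Lemma mxbox_cons y ys s g : mxbox (y :: ys) s g = mxintg y (s y) (mxbox ys s g).
Proof.
apply/funext => z; apply/matrixP => a b; rewrite !mxE /=; congr intg.
by apply/funext => z'; rewrite mxE.
Qed.

Lemma mxbox_nil s g : mxbox [::] s g = g.
Proof. by apply/funext => z; apply/matrixP => a b; rewrite mxE. Qed.

Lemma c1_metric_mxbox ys s g G : (forall i, 0 < s i) -> c1_metric g G ->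
  c1_metric (mxbox ys s g) (fun j => mxbox ys s (G j)).
Proof.
move=> s0 gG; elim: ys => [|y ys IH].
  by rewrite mxbox_nil; under eq_fun do rewrite mxbox_nil.
by rewrite mxbox_cons; under eq_fun do rewrite mxbox_cons; exact: c1_metric_marginal.
Qed.

(** The induction keeps [l] general because [weak_nakano_marginal] consumes a direction: the inner
    marginal must satisfy the inequality in the directions [y :: l]. *)
Lemma weak_nakano_mxbox ys s g G : (forall i, 0 < s i) -> c1_metric g G ->
  (forall l, uniq l -> weak_nakano l g G) ->
  forall l, uniq (ys ++ l) -> weak_nakano l (mxbox ys s g) (fun j => mxbox ys s (G j)).
Proof.
move=> s0 gG wN; elim: ys => [|y ys IH] l ul.
  by rewrite mxbox_nil; under eq_fun do rewrite mxbox_nil; exact: wN.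
rewrite mxbox_cons; under eq_fun do rewrite mxbox_cons.
have H : uniq (ys ++ y :: l) by move: ul; rewrite -[(y :: ys) ++ l]/([:: y] ++ ys ++ l) uniq_catCA.
apply: weak_nakano_marginal => //.
- by move: H; rewrite cat_uniq => /and3P[].
- exact: c1_metric_mxbox.
- exact: IH.
Qed.

End BoxMarginals.

(** * Lebesgue measure on tuples *)

Section TupleIntegral.
Variable R : realType.
Local Notation Rt n := (n.-tuple (measurableTypeR R)).

Lemma continuous_of_ball m n (phi : 'rV[R]_m -> 'rV[R]_n) :
  (forall x e y, ball x e y -> ball (phi x) e (phi y)) -> continuous phi.
Proof.
move=> H x A /nbhs_ballP[e /= e0 eA]; apply/nbhs_ballP; exists e => // y /H; exact: eA.
Qed.

Lemma row_mx_continuousr m n (c : 'rV[R]_m) : continuous (fun y : 'rV[R]_n => row_mx c y).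
Proof.
apply: continuous_of_ball => x e y [e0 xy]; split => // i j.
rewrite !mxE; case: splitP => k _; last exact: xy.
by rewrite /ball/= subrr normr0.
Qed.

Lemma row_mx_continuousl m n (c : 'rV[R]_n) : continuous (fun y : 'rV[R]_m => row_mx y c).
Proof.
apply: continuous_of_ball => x e y [e0 xy]; split => // i j.
rewrite !mxE; case: splitP => k _; first exact: xy.
by rewrite /ball/= subrr normr0.
Qed.

Lemma row_mx_liner m n (c : 'rV[R]_m) (t : 'rV[R]_n) (r : R) k :
  row_mx c (t + r *: unitv R k) = row_mx c t + r *: unitv R (rshift m k).
Proof.
apply/rowP => i; rewrite !mxE; case: splitP => j ij; rewrite ?mxE ?eqxx /=.
  rewrite (_ : (i == rshift m k) = false) ?mulr0 ?addr0//.
  by apply/eqP => E; move: ij; rewrite E /= => /eqP; rewrite gtn_eqF// ltn_addr.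
by congr (_ + r * _%:R); rewrite -[in RHS]val_eqE /= ij eqn_add2l val_eqE.
Qed.

Lemma row_mx_linel m n (c : 'rV[R]_n) (t : 'rV[R]_m) (r : R) k :
  row_mx (t + r *: unitv R k) c = row_mx t c + r *: unitv R (lshift n k).
Proof.
apply/rowP => i; rewrite !mxE; case: splitP => j ij; rewrite ?mxE ?eqxx /=.
  by congr (_ + r * _%:R); rewrite -[in RHS]val_eqE /= ij val_eqE.
rewrite (_ : (i == lshift n k) = false) ?mulr0 ?addr0//.
by apply/eqP => E; move: ij; rewrite E /= => /eqP; rewrite ltn_eqF// ltn_addr.
Qed.

Definition cube n (L : R) : set (Rt n) := [set y | forall i, - L <= tnth y i <= L].
Arguments cube : clear implicits.

Lemma measurable_cube n L : measurable (cube n L).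
Proof.
rewrite (_ : cube n L = \bigcap_(i in [set: 'I_n])
    ((fun y : Rt n => tnth y i) @^-1` `[- L, L])).
  apply: fin_bigcap_measurable => // i _.
  by rewrite -[X in measurable X]setTI; exact: measurable_tnth.
by apply/seteqP; split => y /= h i => [_|]; have := h i; rewrite /= in_itv//=; exact.
Qed.

Lemma row_of_tuple_cons n (x : R) (y : Rt n) :
  row_of_tuple (tuple_cons (x, y)) = row_mx (x%:M : 'rV_1) (row_of_tuple y).
Proof.
apply/rowP => i; rewrite !mxE; case: splitP => j ij.
  by rewrite (ord1 j) mxE eqxx; have -> : i = ord0 by apply: val_inj; rewrite /= ij (ord1 j).
have -> : i = lift ord0 j by apply: val_inj; rewrite /= ij.
by rewrite mxE tnthS.
Qed.

Lemma cube_cons n L (x : R) (y : Rt n) :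
  cube n.+1 L (tuple_cons (x, y)) <-> (- L <= x <= L) /\ cube n L y.
Proof.
split=> [H|[H1 H2] i].
  split; first exact: (H ord0).
  by move=> i; have := H (lift ord0 i); rewrite tnthS.
by case: (unliftP ord0 i) => [j|] ->; rewrite ?tnthS.
Qed.

(** Tonelli's theorem separates the head coordinate; the induction hypothesis treats the tail with
    the head fixed, and [boxint_pullback] reads the result as a box integral in the larger space. *)
Lemma ge0_integral_cube n (f : 'rV[R]_n -> R) L : 0 <= L ->
  continuous f -> (forall z, 0 <= f z) ->
  measurable_fun setT (fun y : Rt n => f (row_of_tuple y)) ->
  (\int[lebesgue_tuple R n]_(y in cube n L) (f (row_of_tuple y))%:E =
   (boxint (enum 'I_n) (fun=> 2 * L) f (const_mx (- L)))%:E)%E.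
Proof.
move=> L0; elim: n f => [|n IH] f cf f0 mf.
  rewrite enum_ord0 /= integral_dirac//; last 2 first.
  - exact: measurable_cube.
  - by apply/measurable_EFinP; apply: measurable_funTS.
  rewrite diracE mem_set ?mul1e; last by case.
  by congr (f _)%:E; apply/rowP; case.
have mfc : measurable_fun setT (fun p : measurableTypeR R * Rt n => f (row_of_tuple (tuple_cons p))).
  by apply: (measurableT_comp (f := fun y : Rt n.+1 => f (row_of_tuple y))) => //; exact: measurable_tuple_cons.
set A := @tuple_cons R n @^-1` cube n.+1 L.
have mA : measurable A.
  by rewrite -[A]setTI; apply: measurable_tuple_cons => //; exact: measurable_cube.
transitivity (\int[lebesgue_measure \x lebesgue_tuple R n]_(p in A)
   (f (row_of_tuple (tuple_cons p)))%:E)%E.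
  rewrite -(@ge0_integral_pushforward _ _ _ _ _ _ (@measurable_tuple_cons R n) _ (cube n.+1 L)
    (fun y => (f (row_of_tuple y))%:E)); last 3 first.
  - exact: measurable_cube.
  - by apply/measurable_EFinP; apply: measurable_funTS.
  - by move=> y _; rewrite lee_fin.
  apply: eq_measure_integral; first exact: measurable_tuple_cons.
  by move=> *.
rewrite integral_mkcond fubini_tonelli1; last 2 first.
- apply/(measurable_restrictT _ mA); apply/measurable_EFinP; exact: measurable_funTS.
- by move=> p; rewrite patchE; case: ifP => // _; rewrite lee_fin.
pose c : 'rV[R]_n.+1 := const_mx (- L).
pose H := boxint [seq lift ord0 i | i <- enum 'I_n] (fun=> 2 * L) f.
have cH : continuous H by exact: boxint_continuous.
(* [psi] is a function of the distance to the corner, [phi] of the coordinate itself; they differ by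
   the shift [L]. *)
pose psi r := H (c + r *: unitv R ord0).
have cpsi : continuous psi by exact: line1_continuous.
pose phi x := psi (x + L).
have cphi : continuous phi.
  apply: (continuous_compose cpsi); apply: continuous_add; first exact: continuous_idfun.
  exact: continuous_cst.
transitivity (\int[lebesgue_measure]_(x in `[(- L)%R, L]) (phi x)%:E)%E.
  rewrite [RHS]integral_mkcond; apply: eq_integral => x _.
  rewrite /fubini_F [RHS]patchE; case: ifPn => xL; last first.
    rewrite integral0_eq// => y _; rewrite patchE; case: ifPn => // /[!inE] /cube_cons[xl _].
    by exfalso; move/negP: xL; apply; rewrite inE /= in_itv /= xl.
  pose fx (y : 'rV[R]_n) := f (row_mx (x%:M : 'rV_1) y).
  have cfx : continuous fx.
    exact: (continuous_compose cf (@row_mx_continuousr 1 n _)).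
  have mfx : measurable_fun setT (fun y : Rt n => fx (row_of_tuple y)).
    rewrite (_ : (fun _ => _) = (fun y => f (row_of_tuple (tuple_cons (x, y))))).
      exact: (measurableT_comp mfc (@pair1_measurable _ _ (measurableTypeR R) (Rt n) x)).
    by apply/funext => y; rewrite /fx -row_of_tuple_cons.
  have E := IH fx cfx (fun z => f0 _) mfx; rewrite integral_mkcond in E.
  transitivity ((boxint (enum 'I_n) (fun=> 2 * L) fx (const_mx (- L)))%:E).
    rewrite -E; apply: eq_integral => y _; rewrite !patchE.
    have xL' : - L <= x <= L by move: xL; rewrite inE /= in_itv.
    have -> : ((x, y) \in A) = (y \in cube n L).
      by apply/idP/idP; rewrite !inE; [move=> /cube_cons[]|move=> yL; apply/cube_cons].
    by rewrite /fx -row_of_tuple_cons.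
  congr (_%:E); rewrite /fx.
  rewrite (@boxint_pullback _ _ _ (fun y : 'rV[R]_n => row_mx (x%:M : 'rV_1) y) (@rshift 1 n)
    (@row_mx_liner 1 n _) f _ _ (fun=> 2 * L))//.
  rewrite /phi /psi /H (_ : [seq @rshift 1 n i | i <- enum 'I_n] = [seq lift ord0 i | i <- enum 'I_n]).
    congr boxint; apply/rowP => i; rewrite !mxE; case: splitP => j ij.
      have -> : i = ord0 by apply: val_inj; rewrite /= ij (ord1 j).
      by rewrite (ord1 j) !mxE !eqxx mulr1 mulr1n addrC addrK.
    have -> : i = lift ord0 j by apply: val_inj; rewrite /= ij.
    by rewrite !mxE /= mulr0 addr0.
  by apply: eq_map => i; apply: val_inj.
have Iphi : lebesgue_measure.-integrable `[- L, L] (EFin \o phi).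
  apply: continuous_compact_integrable; first exact: segment_compact.
  exact: continuous_subspaceT.
rewrite -[LHS]fineK; last exact: integrable_fin_num Iphi.
congr (_%:E); rewrite -/(Rintegral _ _ _) Rintegral_prim//; last by lra.
rewrite enum_ordSl /= -/H /intg -/psi.
have d (r : R) : is_derive r 1 (fun r : R => prim phi (r - L)) (psi r).
  apply/is_derive_epsP => e e0.
  have phiE : phi (r - L) = psi r by rewrite /phi subrK.
  have /is_derive_epsP/(_ e e0) := is_derive_prim (r - L) cphi.
  by rewrite phiE; apply: filterS => h; rewrite (addrAC r h).
have -> := prim_unique (2 * L) cpsi d.
by rewrite sub0r; congr (prim phi _ - _); ring.
Qed.

End TupleIntegral.

(** * Exhaustion of the whole space by cubes *)

Section BoxLimits.
Variables (R : realType) (n : nat).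
Local Notation Rt := (n.-tuple (measurableTypeR R)).
Local Notation lam := (lebesgue_tuple R n).
Implicit Types (f : 'rV[R]_n -> R) (L : nat).

(** Starting at [1] makes even the cube of index [0] nondegenerate; its marginal is positive
    definite and bounds the later ones from below. *)
Definition side L : R := L.+1%:R.

Definition boxL L f : R := boxint (enum 'I_n) (fun=> 2 * side L) f (const_mx (- side L)).

Lemma side_ge0 L : 0 <= side L. Proof. exact: ler0n. Qed.

Lemma measurable_of_integrable f :
  lam.-integrable setT (fun y : Rt => (f (row_of_tuple y))%:E) ->
  measurable_fun setT (fun y : Rt => f (row_of_tuple y)).
Proof. by move=> /measurable_int/measurable_EFinP. Qed.

Lemma cube_homo : {homo (fun L => @cube R n (side L)) : L L' / (L <= L')%N >-> (L <= L')%O}.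
Proof.
move=> L L' LL'; apply/subsetPset => y yL i; have := yL i.
have : side L <= side L' by rewrite ler_nat.
lra.
Qed.

Lemma bigcup_cube : \bigcup_L @cube R n (side L) = setT.
Proof.
apply/seteqP; split => // y _.
pose M := \sum_i `|tnth y i|.
exists (Num.truncn M) => // i.
rewrite -ler_norml (@le_trans _ _ M)//; last exact/ltW/truncnS_gt.
by rewrite /M (bigD1 i)//= lerDl sumr_ge0.
Qed.

Lemma boxL_nondecreasing f : continuous f -> (forall z, 0 <= f z) ->
  measurable_fun setT (fun y : Rt => f (row_of_tuple y)) ->
  nondecreasing_seq (boxL ^~ f).
Proof.
move=> cf f0 mf L L' LL'.
rewrite -lee_fin /boxL -!ge0_integral_cube ?side_ge0//.
apply: ge0_subset_integral => //.
- exact: measurable_cube.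
- exact: measurable_cube.
- by apply/measurable_EFinP; exact: measurable_funTS.
- by move=> y _; rewrite lee_fin.
- by apply/subsetPset; exact: cube_homo.
Qed.

Lemma boxL_cvg_ge0 f : continuous f -> (forall z, 0 <= f z) ->
  lam.-integrable setT (fun y : Rt => (f (row_of_tuple y))%:E) ->
  boxL L f @[L --> \oo] --> Rintegral lam setT (fun y : Rt => f (row_of_tuple y)).
Proof.
move=> cf f0 intf; have mf := measurable_of_integrable intf.
suff H : (boxL L f)%:E @[L --> \oo] -->
    (Rintegral lam setT (fun y : Rt => f (row_of_tuple y)))%:E by exact: (fine_cvg H).
rewrite fineK; last exact: integrable_fin_num intf.
have := @ge0_nondecreasing_set_cvg_integral _ _ _ (fun L => @cube R n (side L))
  (fun y : Rt => (f (row_of_tuple y))%:E) lam cube_homo.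
rewrite bigcup_cube.
have -> : (fun L => \int[lam]_(y in @cube R n (side L)) (f (row_of_tuple y))%:E)%E =
    (fun L => (boxL L f)%:E).
  by apply/funext => L; rewrite ge0_integral_cube// side_ge0.
apply.
- by move=> L; exact: measurable_cube.
- by move=> L; apply/measurable_EFinP; exact: measurable_funTS.
- by move=> L y _; rewrite lee_fin.
Qed.

(** [f] is the difference of [|f| + f] and [|f|], both nonnegative, continuous and integrable, for
    which monotone convergence is available. *)
Lemma boxL_cvg f : continuous f ->
  lam.-integrable setT (fun y : Rt => (f (row_of_tuple y))%:E) ->
  boxL L f @[L --> \oo] --> Rintegral lam setT (fun y : Rt => f (row_of_tuple y)).
Proof.
move=> cf intf.
have cN : continuous (fun z => `|f z|).
  by apply: (@continuous_compose _ _ _ (fun r : R => `|r|)) => //; exact: norm_continuous.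
have intN : lam.-integrable setT (fun y : Rt => `|f (row_of_tuple y)|%:E).
  exact: integrable_norm.
have cD : continuous (fun z => `|f z| + f z) by exact: continuous_add.
have intD : lam.-integrable setT (fun y : Rt => (`|f (row_of_tuple y)| + f (row_of_tuple y))%:E).
  by under eq_fun do rewrite EFinD; exact: integrableD.
have D0 z : 0 <= `|f z| + f z by have := ler_norm (- f z); rewrite normrN; lra.
have H1 := boxL_cvg_ge0 cD D0 intD.
have H2 := boxL_cvg_ge0 cN (fun z => normr_ge0 _) intN.
have -> : Rintegral lam setT (fun y : Rt => f (row_of_tuple y)) =
    Rintegral lam setT (fun y : Rt => `|f (row_of_tuple y)| + f (row_of_tuple y)) -
    Rintegral lam setT (fun y : Rt => `|f (row_of_tuple y)|).
  by rewrite RintegralD// addrAC subrr add0r.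
have -> : (boxL ^~ f) = (fun L => boxL L (fun z => `|f z| + f z) - boxL L (fun z => `|f z|)).
  by apply/funext => L; rewrite /boxL boxintD// addrAC subrr add0r.
exact: cvgB.
Qed.

End BoxLimits.

(** * The marginal of a real metric over the whole space *)

Section RealPrekopa.
Variables (R : realType) (n m d : nat) (g : 'rV[R]_(n + m) -> 'M[R]_d).
Local Notation Rt := (n.-tuple (measurableTypeR R)).
Hypotheses (dg : twice_mxdiff g) (pg : forall x, posdef (g x)) (ng : real_nakano g)
  (intg : forall t a b, (lebesgue_tuple R n).-integrable setT
    (fun y : Rt => (g (row_mx (row_of_tuple y) t) a b)%:E)).

Definition real_marginal (t : 'rV[R]_m) : 'M[R]_d :=
  \matrix_(a, b) Rintegral (lebesgue_tuple R n) setT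
    (fun y : Rt => g (row_mx (row_of_tuple y) t) a b).

Let gG := c1_metric_grad dg pg.

Let ys := [seq lshift m i | i <- enum 'I_n].
Let corner L : 'rV[R]_n := const_mx (- side R L).

Let box L (f : 'rV[R]_(n + m) -> 'M[R]_d) (t : 'rV[R]_m) :=
  mxbox ys (fun=> 2 * side R L) f (row_mx (corner L) t).
Let gL L := box L g.
Let GL L (k : 'I_m) := box L (grad g (rshift n k)).

Let side_gt0 L (i : 'I_(n + m)) : 0 < 2 * side R L.
Proof. by rewrite mulr_gt0// ltr0n. Qed.

Let gGL L : c1_metric (gL L) (GL L).
Proof.
apply: (@c1_metric_pullback R (n + m) m (fun t => row_mx (corner L) t) (@rshift n m) _ _ d
  (mxbox ys (fun=> 2 * side R L) g) (fun k => mxbox ys (fun=> 2 * side R L) (grad g k))).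
- exact: row_mx_continuousr.
- exact: row_mx_liner.
- by apply: c1_metric_mxbox => // i; exact: side_gt0.
Qed.

Let wNL L l : uniq l -> weak_nakano l (gL L) (GL L).
Proof.
move=> ul.
apply: (@weak_nakano_pullback R (n + m) m (fun t => row_mx (corner L) t) (@rshift n m) _ _ d
  (mxbox ys (fun=> 2 * side R L) g) (fun k => mxbox ys (fun=> 2 * side R L) (grad g k))).
- exact: rshift_inj.
- exact: row_mx_liner.
apply: weak_nakano_mxbox => //.
- by move=> i; exact: side_gt0.
- by move=> l' ul'; exact: weak_nakano_grad.
rewrite cat_uniq; apply/and3P; split.
- by rewrite map_inj_uniq ?enum_uniq//; exact: lshift_inj.
- apply/hasPn => _ /mapP[k _ ->]; apply/negP => /mapP[j _ /eqP].
  by rewrite eq_sym eq_lrshift.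
- by rewrite map_inj_uniq//; exact: rshift_inj.
Qed.

Let slice_continuous t a b : continuous (fun y : 'rV[R]_n => g (row_mx y t) a b).
Proof.
apply: (continuous_compose (f := fun z => g z a b)).
  by apply: mxcontinuous_entry; case: gG.
exact: row_mx_continuousl.
Qed.

Let gLE L t a b : gL L t a b = boxL L (fun y => g (row_mx y t) a b).
Proof.
rewrite mxE /boxL (@boxint_pullback _ _ _ (fun y : 'rV[R]_n => row_mx y t) (@lshift n m)
  (fun y r k => row_mx_linel t y r k) (fun z => g z a b) _ _ (fun=> 2 * side R L))//.
Qed.

Let gL_cvg t : mxcvg \oo (gL ^~ t) (real_marginal t).
Proof.
move=> a b; rewrite mxE; under eq_fun do rewrite gLE.
exact: boxL_cvg.
Qed.

Let formE (A : 'M[R]_d) v : form A v v = \sum_a \sum_b v a 0 * v b 0 * A a b.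
Proof.
rewrite /form -mulmxA mxE; apply: eq_bigr => a _; rewrite !mxE mulr_sumr.
by apply: eq_bigr => b _; ring.
Qed.

Let slice_form_continuous t v : continuous (fun y : 'rV[R]_n => form (g (row_mx y t)) v v).
Proof.
under eq_fun do rewrite formE.
apply: continuous_sum => a _; apply: continuous_sum => b _.
by apply: continuous_mul; [exact: continuous_cst|exact: slice_continuous].
Qed.

Let form_gLE L t v : form (gL L t) v v = boxL L (fun y => form (g (row_mx y t)) v v).
Proof.
rewrite formE (_ : (fun y => _) = (fun y => \sum_a \sum_b v a 0 * v b 0 * g (row_mx y t) a b)).
  rewrite /boxL boxint_sum; last first.
    move=> a; apply: continuous_sum => b _.
    by apply: continuous_mul; [exact: continuous_cst|exact: slice_continuous].
  apply: eq_bigr => a _; rewrite boxint_sum; last first.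
    by move=> b; apply: continuous_mul; [exact: continuous_cst|exact: slice_continuous].
  by apply: eq_bigr => b _; rewrite boxintZ ?gLE.
by apply/funext => y; rewrite formE.
Qed.

Let form_nondecreasing t v : nondecreasing_seq (fun L => form (gL L t) v v).
Proof.
move=> L L' LL'; rewrite !form_gLE; apply: boxL_nondecreasing => //.
  by move=> y; exact: posdef_ge0.
rewrite (_ : (fun _ => _) = (fun y : Rt => \sum_a \sum_b v a 0 * v b 0 * g (row_mx (row_of_tuple y) t) a b)).
  apply: measurable_sum => a; apply: measurable_sum => b.
  apply: measurable_funM => //.
  exact: (measurable_of_integrable (f := fun y => g (row_mx y t) a b)).
by apply/funext => y; rewrite formE.
Qed.

Let form_le L t v : form (gL L t) v v <= form (real_marginal t) v v.
Proof.
have H : form (gL L t) v v @[L --> \oo] --> form (real_marginal t) v v.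
  by apply: cvg_form => //; exact: mxcvg_cst.
rewrite -(cvg_lim _ H)//; apply: (nondecreasing_cvgn_le (form_nondecreasing t v)).
by apply/cvg_ex; eexists; exact: H.
Qed.

(** Definiteness comes from the lower bound by the cube marginal of index [0]. *)
Lemma posdef_real_marginal t : posdef (real_marginal t).
Proof.
split.
  apply/matrixP => a b; rewrite !mxE; apply: eq_Rintegral => y _.
  by rewrite -{1}(proj1 (pg _)) mxE.
move=> v v0; apply: lt_le_trans (form_le 0 t v).
by have [_] : posdef (gL 0 t); [by case: (gGL 0)|apply].
Qed.

Theorem real_nakano_marginal : twice_mxdiff real_marginal -> real_nakano real_marginal.
Proof.
move=> dt; have pt := posdef_real_marginal.
apply: real_nakano_of_weak => //.
apply: (weak_nakano_limit (gL := gL) (GL := GL)) => //.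
- exact: c1_metric_grad.
- by move=> L t v; apply: form_nondecreasing.
- exact: index_enum_uniq.
Qed.

End RealPrekopa.

(** * Hermitian matrices as real symmetric matrices *)

Section Realification.
Local Open Scope complex_scope.
Local Open Scope sesquilinear_scope.
Variable R : realType.
Local Notation C := R[i].
Implicit Types m n p : nat.

Definition remx m n (A : 'M[C]_(m, n)) : 'M[R]_(m, n) := \matrix_(a, b) complex.Re (A a b).
Definition immx m n (A : 'M[C]_(m, n)) : 'M[R]_(m, n) := \matrix_(a, b) complex.Im (A a b).

Definition realmx m n (A : 'M[C]_(m, n)) : 'M[R]_(m + m, n + n) :=
  block_mx (remx A) (- immx A) (immx A) (remx A).

Definition realcv n (u : 'cV[C]_n) : 'cV[R]_(n + n) := col_mx (remx u) (immx u).

Lemma ReD (x y : C) : complex.Re (x + y) = complex.Re x + complex.Re y.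
Proof. by case: x y => [a b] [c d]. Qed.
Lemma ImD (x y : C) : complex.Im (x + y) = complex.Im x + complex.Im y.
Proof. by case: x y => [a b] [c d]. Qed.
Lemma ReM (x y : C) :
  complex.Re (x * y) = complex.Re x * complex.Re y - complex.Im x * complex.Im y.
Proof. by case: x y => [a b] [c d]. Qed.
Lemma ImM (x y : C) :
  complex.Im (x * y) = complex.Re x * complex.Im y + complex.Im x * complex.Re y.
Proof. by case: x y => [a b] [c d]. Qed.
Lemma Re_sum (I : Type) (r : seq I) (F : I -> C) :
  complex.Re (\sum_(i <- r) F i) = \sum_(i <- r) complex.Re (F i).
Proof.
elim: r => [|i r IH]; first by rewrite !big_nil.
by rewrite !big_cons ReD IH.
Qed.
Lemma Im_sum (I : Type) (r : seq I) (F : I -> C) :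
  complex.Im (\sum_(i <- r) F i) = \sum_(i <- r) complex.Im (F i).
Proof.
elim: r => [|i r IH]; first by rewrite !big_nil.
by rewrite !big_cons ImD IH.
Qed.
Lemma Re_conj (x : C) : complex.Re (Num.conj x) = complex.Re x.
Proof. by case: x. Qed.
Lemma Im_conj (x : C) : complex.Im (Num.conj x) = - complex.Im x.
Proof. by case: x. Qed.
Lemma complex_eq (x y : C) :
  complex.Re x = complex.Re y -> complex.Im x = complex.Im y -> x = y.
Proof. by case: x y => [a b] [c d] /= -> ->. Qed.

Lemma remx_mul m n p (A : 'M[C]_(m, n)) (B : 'M[C]_(n, p)) :
  remx (A *m B) = remx A *m remx B - immx A *m immx B.
Proof.
apply/matrixP => a b; rewrite !mxE Re_sum -sumrB; apply: eq_bigr => c _.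
by rewrite !mxE ReM.
Qed.

Lemma immx_mul m n p (A : 'M[C]_(m, n)) (B : 'M[C]_(n, p)) :
  immx (A *m B) = remx A *m immx B + immx A *m remx B.
Proof.
apply/matrixP => a b; rewrite !mxE Im_sum -big_split; apply: eq_bigr => c _.
by rewrite !mxE ImM.
Qed.

Lemma realmx_mul m n p (A : 'M[C]_(m, n)) (B : 'M[C]_(n, p)) :
  realmx (A *m B) = realmx A *m realmx B.
Proof.
rewrite /realmx mulmx_block remx_mul immx_mul !mulNmx !mulmxN.
congr block_mx; first by rewrite opprD addrC.
  by rewrite addrC.
by rewrite addrC.
Qed.

Lemma realmx_sub m n (A B : 'M[C]_(m, n)) : realmx (A - B) = realmx A - realmx B.
Proof.
have E1 : remx (A - B) = remx A - remx B.
  by apply/matrixP => a b; rewrite !mxE; case: (A a b) (B a b) => [? ?] [? ?].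
have E2 : immx (A - B) = immx A - immx B.
  by apply/matrixP => a b; rewrite !mxE; case: (A a b) (B a b) => [? ?] [? ?].
rewrite /realmx E1 E2 opp_block_mx add_block_mx; congr block_mx => //.
by rewrite opprB opprK addrC.
Qed.

Lemma realmx0 m n : realmx (0 : 'M[C]_(m, n)) = 0.
Proof.
have E1 : remx (0 : 'M[C]_(m, n)) = 0 by apply/matrixP => a b; rewrite !mxE.
have E2 : immx (0 : 'M[C]_(m, n)) = 0 by apply/matrixP => a b; rewrite !mxE.
by rewrite /realmx E1 E2 oppr0 block_mx0.
Qed.

Lemma realmx1 n : realmx (1%:M : 'M[C]_n) = 1%:M.
Proof.
have E1 : remx (1%:M : 'M[C]_n) = 1%:M.
  by apply/matrixP => a b; rewrite !mxE; case: eqP.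
have E2 : immx (1%:M : 'M[C]_n) = 0.
  by apply/matrixP => a b; rewrite !mxE; case: eqP.
by rewrite /realmx E1 E2 oppr0 -scalar_mx_block.
Qed.

Lemma realmx_adj m n (A : 'M[C]_(m, n)) : realmx (A ^t*) = (realmx A)^T.
Proof.
rewrite /realmx tr_block_mx.
have -> : remx (A ^t*) = (remx A)^T by apply/matrixP => a b; rewrite !mxE Re_conj.
have -> : immx (A ^t*) = - (immx A)^T by apply/matrixP => a b; rewrite !mxE Im_conj.
by rewrite opprK linearN.
Qed.

Lemma realmx_inj m n : injective (@realmx m n).
Proof.
move=> A B /eq_block_mx[E1 _ E2 _]; apply/matrixP => a b; apply: complex_eq.
  by have /matrixP/(_ a b) := E1; rewrite !mxE.
by have /matrixP/(_ a b) := E2; rewrite !mxE.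
Qed.

Lemma realcv_mul m n (A : 'M[C]_(m, n)) (u : 'cV[C]_n) :
  realcv (A *m u) = realmx A *m realcv u.
Proof. by rewrite /realcv /realmx mul_block_col mulNmx remx_mul immx_mul addrC [X in col_mx _ X]addrC. Qed.

Lemma Re_adj_mul n (u v : 'cV[C]_n) :
  complex.Re ((v ^t* *m u) 0 0) = ((realcv v)^T *m realcv u) 0 0.
Proof.
rewrite mxE Re_sum /realcv tr_col_mx mul_row_col mxE [X in _ = X + _]mxE [X in _ = _ + X]mxE.
rewrite -big_split; apply: eq_bigr => i _.
by rewrite ReM !mxE Re_conj Im_conj mulNr opprK.
Qed.

Lemma Re_adj_form n (A : 'M[C]_n) (u v : 'cV[C]_n) :
  complex.Re ((v ^t* *m A *m u) 0 0) = ((realcv v)^T *m realmx A *m realcv u) 0 0.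
Proof. by rewrite -mulmxA Re_adj_mul realcv_mul mulmxA. Qed.

Definition complexcv n (v : 'cV[R]_(n + n)) : 'cV[C]_n :=
  \col_a (usubmx v a 0 +i* dsubmx v a 0).

Lemma complexcvK n (v : 'cV[R]_(n + n)) : realcv (complexcv v) = v.
Proof.
rewrite -[RHS]vsubmxK; congr col_mx; apply/matrixP => a b.
  by rewrite !mxE /= (ord1 b).
by rewrite !mxE /= (ord1 b).
Qed.

Lemma realcvK n (u : 'cV[C]_n) : complexcv (realcv u) = u.
Proof.
apply/matrixP => a b; rewrite (ord1 b) mxE /realcv col_mxKu col_mxKd !mxE.
by case: (u a 0).
Qed.

Lemma realcv_eq0 n (u : 'cV[C]_n) : (realcv u == 0) = (u == 0).
Proof.
apply/eqP/eqP => [E|->].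
  rewrite -[u]realcvK E; apply/matrixP => a b; rewrite !mxE.
  by apply: complex_eq.
rewrite -[RHS]vsubmxK; congr col_mx; apply/matrixP => a b; by rewrite !mxE.
Qed.

Lemma adj_adj m n (A : 'M[C]_(m, n)) : (A ^t*) ^t* = A.
Proof. by apply: realmx_inj; rewrite !realmx_adj trmxK. Qed.

Lemma hermP n (A : 'M[C]_n) : reflect (A ^t* = A) (A \is hermsymmx).
Proof.
apply: (iffP idP) => [/is_hermitianmxP|E]; first by rewrite expr0 scale1r.
by apply/is_hermitianmxP; rewrite expr0 scale1r E.
Qed.

Lemma conj_adj_form n (A : 'M[C]_n) (u v : 'cV[C]_n) :
  Num.conj ((v ^t* *m A *m u) 0 0) = (u ^t* *m A ^t* *m v) 0 0.
Proof.
have E : (v ^t* *m A *m u) ^t* = u ^t* *m A ^t* *m v.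
  apply: realmx_inj; rewrite realmx_adj !realmx_mul !trmx_mul -!realmx_adj adj_adj.
  by rewrite mulmxA.
by rewrite -E [RHS]mxE; congr Num.conj; rewrite [RHS]mxE.
Qed.

Lemma Im_adj_form n (A : 'M[C]_n) (v : 'cV[C]_n) : A ^t* = A ->
  complex.Im ((v ^t* *m A *m v) 0 0) = 0.
Proof.
move=> sA; have := congr1 (@complex.Im R) (conj_adj_form A v v).
by rewrite Im_conj sA; lra.
Qed.

(** Every real vector of double length is some [realcv v], and the form of [realmx A] there is the
    real part of [v^* A v]; the imaginary part vanishes for hermitian [A]. *)
Lemma posdef_realmx n (A : 'M[C]_n) :
  posdef (realmx A) <-> (A \is hermsymmx) /\ posdefmx A.
Proof.
split=> [[sA pA]|[/hermP sA pA]].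
  have hA : A ^t* = A by apply: realmx_inj; rewrite realmx_adj.
  split; first exact/hermP.
  move=> v v0; rewrite ltcE /= Im_adj_form// eqxx /= Re_adj_form.
  by apply: pA; rewrite realcv_eq0.
split; first by rewrite -realmx_adj sA.
move=> v v0; have v0' : complexcv v != 0 by rewrite -realcv_eq0 complexcvK.
by have := pA _ v0'; rewrite ltcE => /andP[_] /=; rewrite Re_adj_form complexcvK.
Qed.

(** A row [v] with [v *m A = 0] satisfies [realmx v *m realmx A = 0], hence vanishes;
    multiplicativity of [realmx] then identifies the inverses. *)
Lemma realmx_inv n (A : 'M[C]_n) : posdef (realmx A) ->
  A \in unitmx /\ realmx (invmx A) = invmx (realmx A).
Proof.
move=> pA; have uR := posdef_unit pA.
have uA : A \in unitmx.
  rewrite -row_free_unit -kermx_eq0; apply/rowV0P => v /sub_kermxP vA.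
  have : realmx v *m realmx A = 0 by rewrite -realmx_mul vA realmx0.
  move=> /(congr1 (mulmx^~ (invmx (realmx A)))); rewrite mulmxK// mul0mx => E.
  by apply: realmx_inj; rewrite E realmx0.
split => //; rewrite -[LHS]mulmx1 -(mulmxV uR) mulmxA -realmx_mul mulVmx//.
by rewrite realmx1 mul1mx.
Qed.

End Realification.

(** * Curvature of hermitian metrics *)

Section ComplexMetrics.
Local Open Scope complex_scope.
Local Open Scope sesquilinear_scope.
Variables (R : realType) (N r : nat).
Local Notation C := R[i].
Local Notation V := 'rV[R]_N.
Implicit Types (g A : V -> 'M[C]_r) (j k : 'I_N) (x : V).

Lemma block_ind (P : 'I_(r + r) -> 'I_(r + r) -> Prop) :
  (forall a b, P (lshift r a) (lshift r b)) -> (forall a b, P (lshift r a) (rshift r b)) ->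
  (forall a b, P (rshift r a) (lshift r b)) -> (forall a b, P (rshift r a) (rshift r b)) ->
  forall i i' : 'I_(r + r), P i i'.
Proof.
move=> h1 h2 h3 h4 i i'.
by case: (split_ordP i) => a ->; case: (split_ordP i') => b ->.
Qed.

Lemma realmx_entries (A : 'M[C]_r) a b :
  (realmx A (lshift r a) (lshift r b) = complex.Re (A a b)) *
  (realmx A (lshift r a) (rshift r b) = - complex.Im (A a b)) *
  (realmx A (rshift r a) (lshift r b) = complex.Im (A a b)) *
  (realmx A (rshift r a) (rshift r b) = complex.Re (A a b)).
Proof. by rewrite /realmx block_mxEul block_mxEur block_mxEdl block_mxEdr !mxE. Qed.

Lemma mxdiff_realmx A x :
  (forall a b, differentiable (fun z => complex.Re (A z a b)) x /\
               differentiable (fun z => complex.Im (A z a b)) x) ->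
  mxdiff (fun z => realmx (A z)) x.
Proof.
move=> dA; apply: block_ind => a b; under eq_fun do rewrite realmx_entries.
- exact: (dA a b).1.
- exact: (differentiableN (dA a b).2).
- exact: (dA a b).2.
- exact: (dA a b).1.
Qed.

Lemma mxderive_realmx A j x :
  (forall a b, differentiable (fun z => complex.Re (A z a b)) x /\
               differentiable (fun z => complex.Im (A z a b)) x) ->
  mxderive (unitv R j) (fun z => realmx (A z)) x = realmx (mxpartial j A x).
Proof.
move=> dA; apply/matrixP; apply: block_ind => a b;
  rewrite mxE realmx_entries mxE /=; under eq_fun do rewrite realmx_entries; rewrite //.
exact: (deriveN (diff_derivable (dA a b).2)).
Qed.

(** The product [g Theta_jk] with the derivative of the inverse carried out, as [Theta_ccurvature]
    confirms. *)
Definition ccurvature g j k x : 'M[C]_r :=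
  mxpartial k (mxpartial j g) x - mxpartial k g x *m invmx (g x) *m mxpartial j g x.

Section OneMetric.
Variable g : V -> 'M[C]_r.
Hypotheses (dg : mxtwice_differentiable g) (pg : forall x, posdef (realmx (g x))).
Let G x := realmx (g x).

Lemma grad_realmx j : grad G j = fun x => realmx (mxpartial j g x).
Proof.
apply/funext => x; apply: mxderive_realmx => a b.
by have [[d1 _] [d2 _]] := dg a b; split; [exact: d1|exact: d2].
Qed.

Lemma differentiable_mxpartial j x a b :
  differentiable (fun z => complex.Re (mxpartial j g z a b)) x /\
  differentiable (fun z => complex.Im (mxpartial j g z a b)) x.
Proof.
have [[_ d1] [_ d2]] := dg a b; split.
- have -> : (fun z => complex.Re (mxpartial j g z a b)) = partial j (fun z => complex.Re (g z a b)).
    by apply/funext => z; rewrite mxE.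
  exact: d1.
- have -> : (fun z => complex.Im (mxpartial j g z a b)) = partial j (fun z => complex.Im (g z a b)).
    by apply/funext => z; rewrite mxE.
  exact: d2.
Qed.

Lemma twice_mxdiff_realmx : twice_mxdiff G.
Proof.
split=> [x|j x].
  apply: mxdiff_realmx => a b.
  by have [[d1 _] [d2 _]] := dg a b; split; [exact: d1|exact: d2].
by rewrite grad_realmx; apply: mxdiff_realmx => a b; exact: differentiable_mxpartial.
Qed.

Lemma curvature_realmx j k x : curvature G j k x = realmx (ccurvature g j k x).
Proof.
rewrite /ccurvature realmx_sub !realmx_mul (realmx_inv (pg x)).2 /curvature !grad_realmx.
by rewrite mxderive_realmx// => a b; exact: differentiable_mxpartial.
Qed.

Lemma ccurvature_adj j k x : (ccurvature g j k x) ^t* = ccurvature g k j x.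
Proof.
apply: realmx_inj; rewrite realmx_adj.
have sG z : (G z)^T = G z by case: (pg z).
exact: etrans (congr1 trmx (esym (curvature_realmx j k x)))
  (etrans (curvature_sym j k x twice_mxdiff_realmx sG) (curvature_realmx k j x)).
Qed.

(** The realified product of inverse and gradient is differentiated by [is_mxderive_solve] along the
    line through [x] in the direction [k]. *)
Lemma Theta_ccurvature j k x : Theta g j k x = invmx (g x) *m ccurvature g j k x.
Proof.
have dG := twice_mxdiff_realmx.
have gG := c1_metric_grad dG pg.
pose e := unitv R k.
have dK : is_mxderive (fun t : R => grad G j (x + t *: e)) 0 (mxderive e (grad G j) x).
  move=> a b; rewrite mxE.
  have := @is_derive_line R N (fun z => grad G j z a b) k x 0.
  by rewrite scale0r addr0; apply; exact: (dG.2 j x a b).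
have dA : is_mxderive (fun t : R => G (x + t *: e)) 0 (grad G k x).
  by have := c1_metric_derive k x 0 gG; rewrite scale0r addr0.
have uG t : G (x + t *: e) \in unitmx by exact: posdef_unit (pg _).
have := is_mxderive_solve dA dK uG; rewrite scale0r addr0.
have -> : mxderive e (grad G j) x - grad G k x *m (invmx (G x) *m grad G j x) =
    curvature G j k x by rewrite /curvature mulmxA.
rewrite curvature_realmx -(realmx_inv (pg x)).2 -realmx_mul => H.
have HE t : invmx (G (x + t *: e)) *m grad G j (x + t *: e) =
    realmx (invmx (g (x + t *: e)) *m mxpartial j g (x + t *: e)).
  by rewrite realmx_mul (realmx_inv (pg _)).2 grad_realmx.
have line (f : V -> R) d : is_derive (0 : R) 1 (fun t : R => f (x + t *: e)) d ->
    'D_e f x = d.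
  have E : (fun h : R => h^-1 *: (f (h *: e + x) - f x)) =
      (fun h : R => h^-1 *: (f (x + (h *: 1 + 0) *: e) - f (x + 0 *: e))).
    by apply/funext => h; rewrite scale0r !addr0 [h *: 1]mulr1 (addrC x).
  by move=> [_ <-]; rewrite /derive /= E.
(* The left block column of a realified matrix holds real parts above and imaginary parts below. *)
apply/matrixP => a b; rewrite mxE /cpartial /partial; apply: complex_eq => /=.
  apply: line; have := H (lshift r a) (lshift r b); rewrite realmx_entries.
  by under eq_fun do rewrite HE realmx_entries.
apply: line; have := H (rshift r a) (lshift r b); rewrite realmx_entries.
by under eq_fun do rewrite HE realmx_entries.
Qed.

Lemma mxform_Theta j k x u v :
  mxform (g x) (Theta g j k x *m u) v = (v ^t* *m ccurvature g j k x *m u) 0 0.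
Proof.
have [ug _] := realmx_inv (pg x).
by rewrite /mxform Theta_ccurvature -!mulmxA mulKVmx// !mulmxA.
Qed.

(** The real part of the complex sum is the real sum for the vectors [realcv (u j)], and these
    exhaust the real vectors. The order on complex numbers demands in addition that the complex sum
    be real. *)
Lemma nakano_realmx :
  (forall x (u : 'I_N -> 'cV[C]_r),
    \sum_(j < N) \sum_(k < N) mxform (g x) (Theta g j k x *m u j) (u k) <= 0) <->
  real_nakano G.
Proof.
have ReE x (u : 'I_N -> 'cV[C]_r) :
  complex.Re (\sum_(j < N) \sum_(k < N) mxform (g x) (Theta g j k x *m u j) (u k)) =
  \sum_j \sum_k ((realcv (u k))^T *m curvature G j k x *m realcv (u j)) 0 0.
  rewrite Re_sum; apply: eq_bigr => j _; rewrite Re_sum; apply: eq_bigr => k _.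
  by rewrite mxform_Theta Re_adj_form curvature_realmx.
split=> [H x u|H x u].
  have := H x (fun j => complexcv (u j)); rewrite lecE => /andP[_].
  rewrite ReE /=; under eq_bigr do under eq_bigr do rewrite !complexcvK.
  exact.
rewrite lecE ReE H andbT /= eq_sym; apply/eqP.
set S := \sum_(j < N) _.
(* By [ccurvature_adj], conjugation exchanges [j] and [k] in each summand, so the double sum is its
   own conjugate. *)
suff E : Num.conj S = S by have := congr1 (@complex.Im R) E; rewrite Im_conj; lra.
rewrite /S [in LHS]exchange_big /= rmorph_sum; apply: eq_bigr => k _.
rewrite rmorph_sum; apply: eq_bigr => j _.
rewrite !mxform_Theta; apply: etrans (conj_adj_form _ _ _) _.
by rewrite ccurvature_adj.
Qed.

End OneMetric.

End ComplexMetrics.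

Lemma realmx_marginal (R : realType) (n m r : nat) (g : 'rV[R]_(n + m) -> 'M[R[i]]_r)
    (hconv : marginal_converges g) :
  (forall t a b, (lebesgue_tuple R n).-integrable setT (fun y : n.-tuple (measurableTypeR R) =>
    (realmx (g (row_mx (row_of_tuple y) t)) a b)%:E)) /\
  (fun t => realmx (marginal g t)) = real_marginal (fun x => realmx (g x)).
Proof.
split=> [t|].
  apply: block_ind => a b; under eq_fun do rewrite realmx_entries.
  - exact: (hconv t a b).1.
  - exact: (integrableN (hconv t a b).2).
  - exact: (hconv t a b).2.
  - exact: (hconv t a b).1.
apply/funext => t; apply/matrixP; apply: block_ind => a b;
  rewrite realmx_entries [RHS]mxE mxE /=;
  apply/esym; under eq_fun do rewrite realmx_entries; rewrite //.
under eq_fun do rewrite -mulN1r.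
by rewrite RintegralZl ?mulN1r//; exact: (hconv t a b).2.
Qed.

(* Nakano log concavity is a property of metrics, so the marginal has to be twice
   differentiable for the conclusion to make sense; this does not follow from the
   other hypotheses, even for n = m = r = 1 and g smooth. *)
Theorem theorem1p2 (R : realType) (n m r : nat)
    (hn : (0 < n)%N) (hm : (0 < m)%N) (hr : (0 < r)%N)
    (g : 'rV[R]_(n + m) -> 'M[R[i]]_r)
    (hmetric : is_metric g)
    (hnakano : nakano_log_concave g)
    (hconv : marginal_converges g)
    (hdiff : mxtwice_differentiable (marginal g)) :
  nakano_log_concave (marginal g).
Proof.
case: hmetric => dg hg; case: hnakano => _ ng.
have pG x : posdef (realmx (g x)) by apply/posdef_realmx; exact: hg.
have dG := twice_mxdiff_realmx dg.
have nG : real_nakano (fun x => realmx (g x)) by apply/(nakano_realmx dg pG).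
have [iG EG] := realmx_marginal hconv.
have pM t : posdef (realmx (marginal g t)).
  by have := posdef_real_marginal dG pG iG t; rewrite -EG.
split; first by split => // t; apply/posdef_realmx.
apply/(nakano_realmx hdiff pM); rewrite EG.
by apply: real_nakano_marginal => //; rewrite -EG; exact: twice_mxdiff_realmx.
Qed.
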